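(* Let $X$ be an elliptic curve over $\mathbb{F}_q$, let $x$ be a closed point of $X$ and $\mathcal{L}_1,\dots,\mathcal{L}_n$ line bundles on $X$. If $\mathcal{E}'=\mathcal{L}_1\oplus\cdots\oplus\mathcal{L}_n$ with $\deg(\mathcal{L}_i)>\deg(\mathcal{L}_{i-1})+|x|$ for $i=2,\dots,n$, then $$\mathcal{V}_{x,1}(\mathcal{E}')=\bigcup_{k=1}^n\Big\{\big(\mathcal{E}',\ \mathcal{L}_1\oplus\cdots\oplus\mathcal{L}_k(-x)\oplus\cdots\oplus\mathcal{L}_n,\ q_x^{\,k-1}\big)\Big\}.$$
   Context: $X$ is a smooth projective geometrically irreducible genus one curve over $\mathbb{F}_q$ with a rational point. $|x|$ is the degree of the closed point $x$, $q_x=q^{|x|}$, $\mathcal{L}(-x)=\mathcal{L}\otimes\mathcal{O}_X(-x)$, and $\mathcal{K}_x$ is the skyscraper sheaf at $x$ with stalk the residue field $\kappa(x)$. For rank $n$ vector bundles $\mathcal{A},\mathcal{B}$ on $X$, $m_{x,r}(\mathcal{A},\mathcal{B})$ is the number of subsheaves $\mathcal{B}''\subseteq\mathcal{A}$ with $\mathcal{B}''\cong\mathcal{B}$ and $\mathcal{A}/\mathcal{B}''\cong\mathcal{K}_x^{\oplus r}$. $\mathcal{V}_{x,r}(\mathcal{A})$ is the set of triples $(\mathcal{A},\mathcal{B},m)$, with $\mathcal{B}$ running through isomorphism classes of rank $n$ vector bundles, such that $m=m_{x,r}(\mathcal{A},\mathcal{B})\ne0$. *)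

(* Defs.v *)
From HB Require Import structures.
From mathcomp Require Import all_boot all_order all_algebra.
From mathcomp Require Import all_classical.

Set Implicit Arguments.
Unset Strict Implicit.
Unset Printing Implicit Defensive.

Import Order.TTheory GRing.Theory Num.Theory.

Local Open Scope classical_set_scope.
Local Open Scope ring_scope.

Record subring_set (K : fieldType) := SubringSet {
  srset :> K -> Prop;
  sr1 : srset 1;
  srB : forall a b, srset a -> srset b -> srset (a - b);
  srM : forall a b, srset a -> srset b -> srset (a * b)
}.

Section SubringType.
Variables (K : fieldType) (S : subring_set K).

Definition srpred : pred K := fun a => `[< S a >].

Lemma srpred_closed : subring_closed srpred.
Proof.
split=> [|a b|a b]; first exact/asboolP/sr1.
- by move=> /asboolP Sa /asboolP Sb; exact/asboolP/srB.
- by move=> /asboolP Sa /asboolP Sb; exact/asboolP/srM.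
Qed.

Definition srtype := {a : K | srpred a}.
HB.instance Definition _ := SubChoice.on srtype.
HB.instance Definition _ :=
  GRing.SubChoice_isSubComNzRing.Build K srpred srtype srpred_closed.

Definition mksr (a : K) (h : S a) : srtype := exist _ a (asboolT h).
Lemma srtypeP (a : srtype) : S (val a). Proof. exact/asboolP/(valP a). Qed.

End SubringType.

Record submod_set (R : comNzRingType) (V : lmodType R) := SubmodSet {
  smset :> V -> Prop;
  sm0 : smset 0;
  smD : forall u v, smset u -> smset v -> smset (u + v);
  smZ : forall (a : R) v, smset v -> smset (a *: v)
}.

Section SubmodType.
Variables (R : comNzRingType) (V : lmodType R) (S : submod_set V).

Definition smpred : pred V := fun v => `[< S v >].

Lemma smpred_closed : subsemimod_closed smpred.
Proof.
split; first split.
- exact/asboolP/sm0.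
- by move=> u v /asboolP Su /asboolP Sv; exact/asboolP/smD.
- by move=> a v /asboolP Sv; exact/asboolP/smZ.
Qed.

Definition smtype := {v : V | smpred v}.
HB.instance Definition _ := SubChoice.on smtype.
HB.instance Definition _ :=
  GRing.SubChoice_isSubLmodule.Build R V smpred smtype smpred_closed.

Definition mksm (v : V) (h : S v) : smtype := exist _ v (asboolT h).
Lemma smtypeP (v : smtype) : S (val v). Proof. exact/asboolP/(valP v). Qed.

End SubmodType.

Section ProdMod.
Variables (R : comNzRingType) (I : Type) (M : I -> lmodType R).

Definition prodmod := forall i, M i.
HB.instance Definition _ := gen_eqMixin prodmod.
HB.instance Definition _ := gen_choiceMixin prodmod.

Let add (u v : prodmod) : prodmod := fun i => u i + v i.
Let opp (u : prodmod) : prodmod := fun i => - u i.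
Let zero : prodmod := fun i => 0.
Let scale (a : R) (u : prodmod) : prodmod := fun i => a *: u i.

Let addA : associative add.
Proof. by move=> u v w; apply: functional_extensionality_dep => i; rewrite /add addrA. Qed.
Let addC : commutative add.
Proof. by move=> u v; apply: functional_extensionality_dep => i; rewrite /add addrC. Qed.
Let add0 : left_id zero add.
Proof. by move=> u; apply: functional_extensionality_dep => i; rewrite /add add0r. Qed.
Let addN : left_inverse zero opp add.
Proof. by move=> u; apply: functional_extensionality_dep => i; rewrite /add addNr. Qed.
HB.instance Definition _ := GRing.isZmodule.Build prodmod addA addC add0 addN.

Let scaleA a b (v : prodmod) : scale a (scale b v) = scale (a * b) v.
Proof. by apply: functional_extensionality_dep => i; rewrite /scale scalerA. Qed.
Let scale1 : left_id 1 scale.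
Proof. by move=> v; apply: functional_extensionality_dep => i; rewrite /scale scale1r. Qed.
Let scaleDr : right_distributive scale +%R.
Proof. by move=> a u v; apply: functional_extensionality_dep => i; rewrite /scale scalerDr. Qed.
Let scaleDl v : {morph scale^~ v : a b / a + b}.
Proof. by move=> a b; apply: functional_extensionality_dep => i; rewrite /scale scalerDl. Qed.
HB.instance Definition _ :=
  GRing.Zmodule_isLmodule.Build R prodmod scaleA scale1 scaleDr scaleDl.

End ProdMod.

(* A smooth projective geometrically irreducible curve over the finite (hence
   perfect) field F is given by its function field: a finitely generated
   extension of F of transcendence degree one in which F is algebraically
   closed.  The scheme is recovered from it: its closed points are the proper
   valuation rings of the function field over F, and its nonempty open sets are
   the complements of finite sets of closed points. *)

Record curve (F : finFieldType) := Curve {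
  funfield : fieldType;
  cst : {rmorphism F -> funfield};
  trdeg1 : exists t : funfield, ~ algebraicOver cst t /\
    exists (d : nat) (e : 'I_d -> funfield), forall f : funfield,
      exists p q : 'I_d -> {poly F},
        (forall i, (map_poly cst (q i)).[t] != 0) /\
        f = \sum_(i < d) (map_poly cst (p i)).[t] / (map_poly cst (q i)).[t] * e i;
  full_constants : forall f, algebraicOver cst f -> exists a, f = cst a
}.

Section OnCurve.
Variables (F : finFieldType) (X : curve F).
Local Notation K := (funfield X).

Record closed_point := Point {
  vset :> K -> Prop;
  v_cst : forall a : F, vset (cst X a);
  vB : forall f g, vset f -> vset g -> vset (f - g);
  vM : forall f g, vset f -> vset g -> vset (f * g);
  v_proper : exists f, ~ vset f;
  v_val : forall f, vset f \/ vset f^-1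
}.
HB.instance Definition _ := gen_eqMixin closed_point.
HB.instance Definition _ := gen_choiceMixin closed_point.

Section Local.
Variable x : closed_point.

Lemma v1 : x 1. Proof. by rewrite -(rmorph1 (cst X)); exact: v_cst. Qed.

Definition local_ring_set := SubringSet (v1) (@vB x) (@vM x).
Definition local_ring := srtype local_ring_set.

(* In MathComp 0^-1 = 0, so 0 has to be listed apart from the nonunits. *)
Definition maximal_set : set K := [set f | f = 0 \/ ~ x f^-1].

Lemma maximal_sub f : maximal_set f -> x f.
Proof.
case=> [->|nf]; last by case: (v_val x f).
by rewrite -(subrr 1); apply: vB; exact: v1.
Qed.

Definition maximal_pred : pred local_ring := fun f => `[< maximal_set (val f) >].

Lemma maximal_closed : idealr_closed maximal_pred.
Proof.
have v0 : x 0 by apply: maximal_sub; left.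
have vN f : x f -> x (- f) by move=> xf; rewrite -sub0r; exact: vB.
have vD f g : x f -> x g -> x (f + g).
  by move=> xf xg; rewrite -(opprK g); apply/vB/vN.
have mM a f : x a -> maximal_set f -> maximal_set (a * f).
  move=> xa [->|nf]; first by left; rewrite mulr0.
  have [->|a0] := eqVneq a 0; first by left; rewrite mul0r.
  right=> xaf; apply: nf.
  have -> : f^-1 = a * (a * f)^-1 by rewrite invfM mulrA divff ?mul1r.
  exact: vM.
have mD f g : maximal_set f -> maximal_set g -> maximal_set (f + g).
  move=> mf mg.
  have [f0|f0] := eqVneq f 0; first by rewrite f0 add0r.
  have [g0|g0] := eqVneq g 0; first by rewrite g0 addr0.
  case: (v_val x (f / g)) => xfg.
    have -> : f + g = (f / g + 1) * g by rewrite mulrDl mul1r divfK.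
    by apply: mM mg; apply: vD xfg v1.
  have -> : f + g = ((f / g)^-1 + 1) * f by rewrite mulrDl mul1r invf_div divfK // addrC.
  by apply: mM mf; apply: vD xfg v1.
split.
- by apply/asboolP; left.
- apply/negP => /asboolP[/eqP|]; first by rewrite [val _]/= oner_eq0.
  by apply; rewrite [val _]/= invr1; exact: v1.
- move=> a u v /asboolP mu /asboolP mv; apply/asboolP.
  by apply: mD mv; apply: mM mu; exact: srtypeP.
Qed.

HB.instance Definition _ := isIdealr.Build local_ring maximal_pred maximal_closed.

Definition residue_field : comNzRingType := {ideal_quot (maximal_pred : idealr local_ring)}.

Definition residue : {rmorphism local_ring -> residue_field} :=
  (\pi_({ideal_quot (maximal_pred : idealr local_ring)}))%qT.

Definition residue_cst (a : F) : residue_field :=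
  residue (mksr (S := local_ring_set) (v_cst x a)).

Definition uniformizer (t : K) :=
  [/\ t != 0, maximal_set t & forall f, maximal_set f -> x (f / t)].

(* v_x(f) >= k; a uniformizer exists at every closed point. *)
Definition val_ge (k : int) : set K :=
  [set f | forall t, uniformizer t -> x (f / t ^ k)].

End Local.

(* S has dimension d over F, which acts through j and multiplication. *)
Definition has_dim (A : comNzRingType) (j : F -> A) (S : set A) (d : nat) :=
  exists e : 'I_d -> A, (forall i, S (e i)) /\
    forall s, S s -> exists! c : {ffun 'I_d -> F}, s = \sum_(i < d) j (c i) * e i.

Definition dim_over (A : comNzRingType) (j : F -> A) (S : set A) : nat :=
  xget 0%N [set d | has_dim j S d].

Definition degree_pt (x : closed_point) : nat := dim_over (@residue_cst x) setT.

Record divisor := Divisor {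
  dcoef :> closed_point -> int;
  dcoef_fin : finite_set [set x | dcoef x != 0]
}.

Definition degree_div (D : divisor) : int :=
  \sum_(x \in [set: closed_point]) D x * (degree_pt x)%:Z.

Lemma v0 (x : closed_point) : x 0. Proof. by apply: maximal_sub; left. Qed.

Lemma vD (x : closed_point) f g : x f -> x g -> x (f + g).
Proof.
by move=> xf xg; rewrite -(opprK g); apply: vB xf _; rewrite -sub0r; apply: vB xg; exact: v0.
Qed.

(* [open_set] lists the nonempty open sets of the scheme, each given by its
   closed points; all of them contain the generic point.  The empty open set is
   left out: sheaves take the value 0 on it, and since the curve is irreducible
   it does not occur as an intersection. *)

Record open_set := OpenSet {
  oset :> closed_point -> Prop;
  ocofinite : finite_set [set x | ~ oset x]
}.

Definition osub (V U : open_set) : Prop := forall x, V x -> U x.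

Lemma open_top_subproof : finite_set [set x : closed_point | ~ True].
Proof. by rewrite (_ : [set x | _] = set0) ?eqEsubset; [exact: finite_set0|split=> x //=; tauto]. Qed.
Definition open_top : open_set := OpenSet open_top_subproof.

Lemma openI_subproof (U V : open_set) : finite_set [set x | ~ (U x /\ V x)].
Proof.
apply: (@sub_finite_set _ _ ([set x | ~ U x] `|` [set x | ~ V x])).
  by move=> x /= /not_andP.
by rewrite finite_setU; split; exact: ocofinite.
Qed.
Definition openI (U V : open_set) : open_set := OpenSet (openI_subproof U V).

Lemma openIl U V : osub (openI U V) U. Proof. by move=> x []. Qed.
Lemma openIr U V : osub (openI U V) V. Proof. by move=> x []. Qed.

Definition regular_on (U : open_set) (f : K) : Prop := forall x : closed_point, U x -> x f.

Lemma regular1 U : regular_on U 1. Proof. by move=> x _; exact: v1. Qed.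
Lemma regularB U f g : regular_on U f -> regular_on U g -> regular_on U (f - g).
Proof. by move=> hf hg x Ux; apply: vB; [exact: hf|exact: hg]. Qed.
Lemma regularM U f g : regular_on U f -> regular_on U g -> regular_on U (f * g).
Proof. by move=> hf hg x Ux; apply: vM; [exact: hf|exact: hg]. Qed.

Definition OX_set (U : open_set) : subring_set K :=
  SubringSet (@regular1 U) (@regularB U) (@regularM U).

Definition OX (U : open_set) : comNzRingType := srtype (OX_set U).

Lemma OXP U (a : OX U) : regular_on U (val a).
Proof. exact: (@srtypeP _ (OX_set U) a). Qed.

Lemma OX_res_subproof U V (h : osub V U) (a : OX U) : regular_on V (val a).
Proof. by move=> x /h; exact: OXP. Qed.

Definition OX_res U V (h : osub V U) (a : OX U) : OX V :=
  mksr (S := OX_set V) (OX_res_subproof h a).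

(* A nonempty index set is required so that the generic point is covered. *)
Record open_cover (U : open_set) := Cover {
  cidx : Type;
  cidx0 : cidx;
  cset :> cidx -> open_set;
  csub : forall i, osub (cset i) U;
  ccov : forall x, U x -> exists i, cset i x
}.

Record modsheaf := ModSheaf {
  sec :> forall U : open_set, lmodType (OX U);
  res : forall U V, osub V U -> sec U -> sec V;
  res_add : forall U V (h : osub V U) s t, res h (s + t) = res h s + res h t;
  res_scale : forall U V (h : osub V U) (a : OX U) s,
    res h (a *: s) = OX_res h a *: res h s;
  res_id : forall U (h : osub U U) s, res h s = s;
  res_comp : forall U V W (h : osub V U) (k : osub W V) (l : osub W U) s,
    res k (res h s) = res l s;
  res_glue : forall U (C : open_cover U) (s : forall i, sec (C i)),
    (forall i j, res (@openIl (C i) (C j)) (s i) =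
                 res (@openIr (C i) (C j)) (s j)) ->
    exists! t : sec U, forall i, res (@csub _ C i) t = s i
}.

Record sheaf_hom (M N : modsheaf) := SheafHom {
  happ :> forall U, {linear M U -> N U};
  hnat : forall U V (h : osub V U) (s : M U), happ V (res h s) = res h (happ U s)
}.

Definition sheaf_iso (M N : modsheaf) : Prop :=
  exists f : sheaf_hom M N, forall U, bijective (f U).

Record subsheaf (M : modsheaf) := Subsheaf {
  ssec :> forall U, submod_set (M U);
  ssec_res : forall U V (h : osub V U) s, ssec U s -> ssec V (res h s);
  ssec_loc : forall U (C : open_cover U) (s : M U),
    (forall i, ssec (C i) (res (@csub _ C i) s)) -> ssec U s
}.

Section SubsheafSheaf.
Variables (M : modsheaf) (S : subsheaf M).

Definition sub_sec U : lmodType (OX U) := smtype (S U).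

Definition sub_res U V (h : osub V U) (s : sub_sec U) : sub_sec V :=
  mksm (ssec_res h (smtypeP s)).

Lemma sub_res_add U V (h : osub V U) s t :
  sub_res h (s + t) = sub_res h s + sub_res h t.
Proof. by apply/val_inj; exact: res_add. Qed.

Lemma sub_res_scale U V (h : osub V U) (a : OX U) s :
  sub_res h (a *: s) = OX_res h a *: sub_res h s.
Proof. by apply/val_inj; exact: res_scale. Qed.

Lemma sub_res_id U (h : osub U U) s : sub_res h s = s.
Proof. by apply/val_inj; exact: res_id. Qed.

Lemma sub_res_comp U V W (h : osub V U) (k : osub W V) (l : osub W U) s :
  sub_res k (sub_res h s) = sub_res l s.
Proof. by apply/val_inj; exact: res_comp. Qed.

Lemma sub_glue U (C : open_cover U) (s : forall i, sub_sec (C i)) :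
  (forall i j, sub_res (@openIl (C i) (C j)) (s i) =
               sub_res (@openIr (C i) (C j)) (s j)) ->
  exists! t : sub_sec U, forall i, sub_res (@csub _ C i) t = s i.
Proof.
move=> E; have [|t [tE tU]] := @res_glue M U C (fun i => val (s i)).
  by move=> i j; have /(congr1 val) := E i j.
have St : S U t by apply: (ssec_loc (C := C)) => i; rewrite tE; exact: smtypeP.
exists (mksm St); split=> [i|t' t'E]; first by apply/val_inj; exact: tE.
by apply/val_inj; apply: tU => i; rewrite -t'E.
Qed.

Definition sheaf_of_sub : modsheaf :=
  ModSheaf sub_res_add sub_res_scale sub_res_id sub_res_comp sub_glue.

End SubsheafSheaf.

(* M / S is isomorphic to Q: there is an exact sequence 0 -> S -> M -> Q -> 0. *)
Definition quotient_iso (M : modsheaf) (S : subsheaf M) (Q : modsheaf) : Prop :=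
  exists p : sheaf_hom M Q,
    (forall U (t : Q U) x, U x -> exists V (h : osub V U),
       V x /\ exists s : M V, p V s = res h t) /\
    (forall U (s : M U), p U s = 0 <-> S U s).

Section DirectSum.
Variables (n : nat) (M : 'I_n -> modsheaf).

Definition ds_sec U : lmodType (OX U) := prodmod (fun i => M i U).

Definition ds_res U V (h : osub V U) (s : ds_sec U) : ds_sec V :=
  fun i => res h (s i).

Lemma ds_res_add U V (h : osub V U) s t :
  ds_res h (s + t) = ds_res h s + ds_res h t.
Proof. by apply: functional_extensionality_dep => i; exact: res_add. Qed.

Lemma ds_res_scale U V (h : osub V U) (a : OX U) s :
  ds_res h (a *: s) = OX_res h a *: ds_res h s.
Proof. by apply: functional_extensionality_dep => i; exact: res_scale. Qed.

Lemma ds_res_id U (h : osub U U) s : ds_res h s = s.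
Proof. by apply: functional_extensionality_dep => i; exact: res_id. Qed.

Lemma ds_res_comp U V W (h : osub V U) (k : osub W V) (l : osub W U) s :
  ds_res k (ds_res h s) = ds_res l s.
Proof. by apply: functional_extensionality_dep => i; exact: res_comp. Qed.

Lemma ds_glue U (C : open_cover U) (s : forall i, ds_sec (C i)) :
  (forall i j, ds_res (@openIl (C i) (C j)) (s i) =
               ds_res (@openIr (C i) (C j)) (s j)) ->
  exists! t : ds_sec U, forall i, ds_res (@csub _ C i) t = s i.
Proof.
move=> E.
have tE k : exists t : M k U,
    unique (fun t => forall i, res (@csub _ C i) t = s i k) t.
  apply: (@res_glue (M k) U C (fun i => s i k)) => i j.
  by have := E i j => /(congr1 (fun f => f k)).
pose t k := sval (cid (tE k)); have tP k := svalP (cid (tE k)).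
exists t; split=> [i|t' t'E]; apply: functional_extensionality_dep => k.
  by have [+ _] := tP k; apply.
by have [_ tU] := tP k; apply: tU => i; rewrite -t'E.
Qed.

Definition dsum : modsheaf :=
  ModSheaf ds_res_add ds_res_scale ds_res_id ds_res_comp ds_glue.

End DirectSum.

Record bilinear_map (L N P : modsheaf) := BilinearMap {
  bapp :> forall U, L U -> N U -> P U;
  blinl : forall U (t : N U), linear (fun s : L U => bapp s t);
  blinr : forall U (s : L U), linear (fun t : N U => bapp s t);
  bnat : forall U V (h : osub V U) (s : L U) (t : N U),
    bapp (res h s) (res h t) = res h (bapp s t)
}.

Definition is_tensor (L N T : modsheaf) (b : bilinear_map L N T) : Prop :=
  forall (P : modsheaf) (c : bilinear_map L N P), exists2 f : sheaf_hom T P,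
    (forall U s t, f U (b U s t) = c U s t) &
    forall g : sheaf_hom T P, (forall U s t, g U (b U s t) = c U s t) ->
      forall U w, g U w = f U w.

(* A choice of tensor product over O_X, which is unique up to isomorphism; the
   second branch never occurs, as tensor products of sheaves exist. *)
Definition tensor (L N : modsheaf) : modsheaf :=
  if pselect (exists T, exists b : bilinear_map L N T, is_tensor b) is left e
  then sval (cid e) else L.

Section ConstantSheaf.

Definition Ksec (U : open_set) : Type := K.
HB.instance Definition _ U := GRing.Zmodule.copy (Ksec U) K.

Section Scale.
Variable U : open_set.
Let scale (a : OX U) (f : Ksec U) : Ksec U := val a * f.
Let scaleA a b v : scale a (scale b v) = scale (a * b) v.
Proof. exact: mulrA. Qed.
Let scale1 : left_id 1 scale. Proof. by move=> v; exact: mul1r. Qed.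
Let scaleDr : right_distributive scale +%R. Proof. by move=> a u v; exact: mulrDr. Qed.
Let scaleDl v : {morph scale^~ v : a b / a + b}. Proof. by move=> a b; exact: mulrDl. Qed.
HB.instance Definition _ :=
  GRing.Zmodule_isLmodule.Build (OX U) (Ksec U) scaleA scale1 scaleDr scaleDl.
End Scale.

Definition Kres U V (h : osub V U) (s : Ksec U) : Ksec V := s.

Lemma K_glue U (C : open_cover U) (s : forall i, Ksec (C i)) :
  (forall i j, Kres (@openIl (C i) (C j)) (s i) =
               Kres (@openIr (C i) (C j)) (s j)) ->
  exists! t : Ksec U, forall i, Kres (@csub _ C i) t = s i.
Proof.
move=> E; exists (s (cidx0 C)); split=> [i|t <- //].
exact: (E (cidx0 C) i).
Qed.

(* The sheaf of rational functions, constant because X is irreducible. *)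
Definition Ksheaf : modsheaf :=
  @ModSheaf (fun U => Ksec U : lmodType (OX U)) Kres
    (fun _ _ _ _ _ => erefl) (fun _ _ _ _ _ => erefl) (fun _ _ _ => erefl)
    (fun _ _ _ _ _ _ _ => erefl) K_glue.

End ConstantSheaf.

Section OXD.
Variable D : divisor.

Definition OXD_set (U : open_set) (f : K) : Prop :=
  forall x, U x -> val_ge x (- D x) f.

Lemma OXD0 U : OXD_set U (0 : Ksheaf U).
Proof. by move=> x _ t _; rewrite (mul0r (_ : K)); exact: v0. Qed.

Lemma OXDD U (f g : Ksheaf U) : OXD_set U f -> OXD_set U g -> OXD_set U (f + g).
Proof.
by move=> hf hg x Ux t ht; rewrite (mulrDl (f : K) (g : K)); apply: vD; [exact: hf|exact: hg].
Qed.

Lemma OXDZ U (a : OX U) (f : Ksheaf U) : OXD_set U f -> OXD_set U (a *: f).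
Proof.
move=> hf x Ux t ht; rewrite -(mulrA (val a : K) (f : K)); apply: vM; last exact: hf.
exact: OXP.
Qed.

Definition OXD_sec U : submod_set (Ksheaf U) :=
  SubmodSet (V := Ksheaf U) (@OXD0 U) (@OXDD U) (@OXDZ U).

Lemma OXD_res U V (h : osub V U) s : OXD_sec U s -> OXD_sec V (@res Ksheaf U V h s).
Proof. by move=> hs x /h; exact: hs. Qed.

Lemma OXD_loc U (C : open_cover U) (s : Ksheaf U) :
  (forall i, OXD_sec (C i) (res (@csub _ C i) s)) -> OXD_sec U s.
Proof. by move=> hs x Ux; have [i Cx] := ccov C Ux; exact: (hs i). Qed.

Definition OXD : modsheaf := sheaf_of_sub (Subsheaf OXD_res OXD_loc).

End OXD.

Section Skyscraper.
Variable x : closed_point.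

Definition germ (U : open_set) (Ux : U x) (a : OX U) : local_ring x :=
  mksr (S := local_ring_set x) (OXP a Ux).

Definition kappa (U : open_set) (Ux : U x) : Type := residue_field x.
HB.instance Definition _ (U : open_set) (Ux : U x) := GRing.Zmodule.copy (@kappa U Ux) (residue_field x).

Section Scale.
Variables (U : open_set) (Ux : U x).
Let scale (a : OX U) (v : kappa Ux) : kappa Ux := residue x (germ Ux a) * v.
Let scaleA a b v : scale a (scale b v) = scale (a * b) v.
Proof.
rewrite /scale (_ : germ Ux (a * b) = germ Ux a * germ Ux b); last exact/val_inj.
by rewrite rmorphM mulrA.
Qed.
Let scale1 : left_id 1 scale.
Proof.
move=> v; rewrite /scale (_ : germ Ux 1 = 1); last exact/val_inj.
by rewrite rmorph1 mul1r.
Qed.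
Let scaleDr : right_distributive scale +%R. Proof. by move=> a u v; exact: mulrDr. Qed.
Let scaleDl v : {morph scale^~ v : a b / a + b}.
Proof.
move=> a b; rewrite /scale (_ : germ Ux (a + b) = germ Ux a + germ Ux b); last exact/val_inj.
by rewrite rmorphD mulrDl.
Qed.
HB.instance Definition _ :=
  GRing.Zmodule_isLmodule.Build (OX U) (kappa Ux) scaleA scale1 scaleDr scaleDl.
End Scale.

(* A product over the proofs of x \in U: it is the residue field at x if
   x \in U and 0 otherwise. *)
Definition sky_sec U : lmodType (OX U) := prodmod (fun Ux : U x => kappa Ux).

Definition sky_res U V (h : osub V U) (s : sky_sec U) : sky_sec V :=
  fun Vx => s (h x Vx).

Lemma sky_res_add U V (h : osub V U) s t :
  sky_res h (s + t) = sky_res h s + sky_res h t.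
Proof. by []. Qed.

Lemma sky_res_scale U V (h : osub V U) (a : OX U) s :
  sky_res h (a *: s) = OX_res h a *: sky_res h s.
Proof.
apply: functional_extensionality_dep => Vx.
by congr (residue x _ * _); exact/val_inj.
Qed.

Lemma sky_res_id U (h : osub U U) s : sky_res h s = s.
Proof.
apply: functional_extensionality_dep => Ux.
by rewrite /sky_res (Prop_irrelevance (h x Ux) Ux).
Qed.

Lemma sky_res_comp U V W (h : osub V U) (k : osub W V) (l : osub W U) s :
  sky_res k (sky_res h s) = sky_res l s.
Proof.
apply: functional_extensionality_dep => Wx.
by rewrite /sky_res (Prop_irrelevance (h x (k x Wx)) (l x Wx)).
Qed.

Lemma sky_glue U (C : open_cover U) (s : forall i, sky_sec (C i)) :
  (forall i j, sky_res (@openIl (C i) (C j)) (s i) =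
               sky_res (@openIr (C i) (C j)) (s j)) ->
  exists! t : sky_sec U, forall i, sky_res (@csub _ C i) t = s i.
Proof.
move=> E.
have sE i j (p : C i x) (q : C j x) : s i p = s j q :> residue_field x.
  have := E i j => /(congr1 (fun f => f (conj p q))); rewrite /sky_res.
  by rewrite (Prop_irrelevance (openIl _) p) (Prop_irrelevance (openIr _) q).
pose t : sky_sec U := fun Ux => let e := cid (ccov C Ux) in s (sval e) (svalP e).
exists t; split=> [i|t' t'E]; apply: functional_extensionality_dep => p; first exact: sE.
rewrite /t; case: cid => i q /=.
rewrite -(t'E i) /sky_res; congr (t' _); exact: Prop_irrelevance.
Qed.

Definition skyscraper : modsheaf :=
  ModSheaf sky_res_add sky_res_scale sky_res_id sky_res_comp sky_glue.

End Skyscraper.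

(* dim_F H^0(X, O_X(D)) *)
Definition ell (D : divisor) : nat := dim_over (cst X) [set f | OXD_set D open_top f].

(* The genus of a function field: the maximum of deg D - l(D) + 1. *)
Definition has_genus (g : int) : Prop :=
  (forall D : divisor, degree_div D - (ell D)%:Z + 1 <= g) /\
  (exists D : divisor, degree_div D - (ell D)%:Z + 1 = g).

Definition elliptic : Prop := has_genus 1 /\ exists x : closed_point, degree_pt x = 1%N.

(* Locally free of rank n: M restricted to some neighbourhood U of each point
   has a frame e_1, ..., e_n, that is, an isomorphism from O_U^n. *)
Definition vector_bundle (n : nat) (M : modsheaf) : Prop :=
  forall x : closed_point, exists U : open_set, U x /\ exists e : 'I_n -> M U,
    forall V (h : osub V U) (s : M V),
      exists! a : {ffun 'I_n -> OX V}, s = \sum_(i < n) a i *: res h (e i).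

Definition line_bundle (L : modsheaf) : Prop := vector_bundle 1 L.

(* deg D for any D with L isomorphic to O_X(D) *)
Definition degree (L : modsheaf) : int :=
  xget 0 [set d | exists2 D, sheaf_iso L (OXD D) & d = degree_div D].

Lemma minus_point_subproof (x : closed_point) :
  finite_set [set y | (if y == x then -1 else 0 : int) != 0].
Proof.
by apply: (sub_finite_set _ (finite_set1 x)) => y /=; case: (eqVneq y x).
Qed.
Definition minus_point (x : closed_point) : divisor := Divisor (minus_point_subproof x).

(* L(-x), the tensor product of L and O_X(-x) *)
Definition twist (x : closed_point) (L : modsheaf) : modsheaf := tensor L (OXD (minus_point x)).

(* Sets of sheaves are written as predicates: they are too large for the
   universe of [set]. *)
Definition isoclass (M : modsheaf) : modsheaf -> Prop := sheaf_iso M.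

Definition hecke_subsheaves (x : closed_point) (r : nat) (A B : modsheaf) : set (subsheaf A) :=
  [set S | sheaf_iso (sheaf_of_sub S) B /\
           quotient_iso S (dsum (fun _ : 'I_r => skyscraper x))].

(* m_{x,r}(A, B) *)
Definition hecke_mult (x : closed_point) (r : nat) (A B : modsheaf) : nat :=
  xget 0%N [set m | (@hecke_subsheaves x r A B #= `I_m)%card].

(* The triples (A, B, m), with A and B isomorphism classes. *)
Record hecke_edge := HeckeEdge {
  source : modsheaf -> Prop;
  target : modsheaf -> Prop;
  multiplicity : nat
}.

(* V_{x,r}(A) for A of rank n *)
Definition hecke_neighbours (n : nat) (x : closed_point) (r : nat) (A : modsheaf) :
    hecke_edge -> Prop :=
  fun t => exists B : modsheaf, [/\ vector_bundle n B, hecke_mult x r A B <> 0%N &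
    t = HeckeEdge (isoclass A) (isoclass B) (hecke_mult x r A B)].

End OnCurve.

(* Main.v *)
Require Import Defs.
From HB Require Import structures.
From mathcomp Require Import all_boot all_order all_algebra.
From mathcomp Require Import all_classical zify ring finmap.

(** Write L_0, ..., L_(n-1) for the summands, in order of increasing degree.  A
    subsheaf of the sum A whose quotient is the skyscraper at x is the kernel of
    a nonzero linear functional lam on the fibre of A at x, and it determines
    lam up to a scalar ([quotient_functional], [ker_sheaf_inj]).  Let k be the
    last index with lam_k nonzero, and normalize lam_k to 1.  For i < k the
    degree of L_k exceeds that of L_i by more than |x|, so the fibre of
    Hom(L_i, L_k) at x is filled by global homomorphisms; choosing them with
    values lam_i yields a shear of A that carries the kernel of lam to the
    kernel of the k-th coordinate, which is A with L_k replaced by L_k(-x)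
    ([ker_shear_iso]).  The coordinates lam_i with i < k are free, which makes
    q_x ^ k subsheaves for each k.  Different k give sheaves that are not
    isomorphic: their degrees still increase strictly, so a homomorphism between
    two of them is given by a matrix of rational functions with a block of zeros
    too large for it to be invertible ([dsum_not_iso]).

    The global homomorphisms come from Riemann-Roch in genus one: H^0(D) maps
    onto the fibre of O(D) at x as soon as deg D > |x| ([H0_eval_surj]), because
    H^0(D) has exactly q ^ deg D elements when deg D > 0 ([H0_card]).  That it
    has no fewer is the definition of the genus.  For the upper bound, some
    divisor D1 attains the genus, and for a suitable m a section of m D - D1
    makes m D equivalent to the sum of D1 and an effective divisor, whence the
    bound for m D ([H0_multiple_bound]).  If H^0(D) had more than q ^ d
    elements, where d = deg D, a rational point z would provide d + 1 sections
    with increasing orders at z; their products would be m d + 1 sections of m D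
    with increasing orders, which is too many.  This use of the rational point
    replaces duality.

    The curve is only known through its function field K, so the local theory
    starts from the valuation rings.  Any N elements of K are dependent over F[u],
    for some N depending on u ([finite_rank]); for u in the maximal ideal
    of a valuation ring this makes its residue field finite and its valuation
    discrete ([residue_has_dim], [uniformizer_exists]).  As F is finite,
    dimensions are compared through cardinalities.

    Two facts connect sheaves with divisors.  A line bundle is isomorphic to
    some O(D), through the coordinate of its sections in a fixed frame
    ([line_bundle_OXD]); and the product of rational functions
    O(D) x O(E) -> O(D + E) has the universal property of the tensor product
    ([product_tensor]), so that twisting by -x subtracts x from the divisor. *)

Set Implicit Arguments.
Unset Strict Implicit.
Unset Printing Implicit Defensive.

Import Order.TTheory GRing.Theory Num.Theory.
Local Open Scope classical_set_scope.
Local Open Scope ring_scope.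

(** * Cardinality and dimension over a finite field *)

Lemma card_le_fin (T : Type) (A : set T) (fT : finType) (f : T -> fT) :
  (forall a b, A a -> A b -> f a = f b -> a = b) -> (A #<= `I_#|fT|)%card.
Proof.
move=> fI; pose g a := nat_of_ord (enum_rank (f a)).
have gI : {in A &, injective g}.
  by move=> a b /set_mem Aa /set_mem Ab /val_inj/enum_rank_inj; exact: fI.
rewrite -(card_le_eql (inj_card_eq gI)); apply: subset_card_le => _ [a _ <-] /=.
exact: ltn_ord.
Qed.

Lemma card_ge_fin (T : Type) (A : set T) (fT : finType) (g : fT -> T) :
  injective g -> (forall i, A (g i)) -> (`I_#|fT| #<= A)%card.
Proof.
move=> gI gA; case: (posnP #|fT|) => [->|fT0].
  by rewrite II0 card_ge0.
pose i0 : 'I_#|fT| := Ordinal fT0.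
pose h (m : nat) := g (enum_val (insubd i0 m)).
have hI : {in `I_#|fT| &, injective h}.
  move=> a b /set_mem/= la /set_mem/= lb /gI/enum_val_inj/(congr1 val).
  by rewrite !val_insubd la lb.
rewrite -(card_le_eql (inj_card_eq hI)); apply: subset_card_le => _ [a _ <-] /=.
exact: gA.
Qed.

Lemma card_le_inj (T U : Type) (A : set T) (B : set U) (f : T -> U) :
  (forall a b, A a -> A b -> f a = f b -> a = b) -> (forall a, A a -> B (f a)) ->
  (A #<= B)%card.
Proof.
move=> fI fB; have fI' : {in A &, injective f}.
  by move=> a b /set_mem Aa /set_mem Ab; exact: fI.
rewrite -(card_le_eql (inj_card_eq fI')); apply: subset_card_le => _ [a Aa <-].
exact: fB.
Qed.

Lemma card_leI_ex (T : Type) (A : set T) n : (A #<= `I_n)%card ->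
  exists2 f : T -> nat, (forall a b, A a -> A b -> f a = f b -> a = b) &
    (forall a, A a -> (f a < n)%N).
Proof.
move=> /pcard_leP -[f]; exists f; last by move=> a Aa; have := @funS _ _ _ _ f a Aa.
by move=> a b Aa Ab; apply: (@inj _ _ _ f); apply/mem_set.
Qed.

Lemma card_bounds (T : Type) (A : set T) m n :
  (`I_m #<= A)%card -> (A #<= `I_n)%card -> (m <= n)%N.
Proof. by move=> mA An; rewrite -card_le_II; exact: card_le_trans An. Qed.

(** The counting substitute for the rank-nullity theorem: the fibres of a linear
    map are translates of its kernel. *)
Lemma card_le_fibres (T U : Type) (A : set T) (B : set U) (phi : T -> U) a b :
  (forall w, A w -> B (phi w)) ->
  (forall w, A w -> (A `&` [set v | phi v = phi w] #<= `I_a)%card) ->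
  (B #<= `I_b)%card -> (A #<= `I_(a * b)%N)%card.
Proof.
move=> AB Aa /card_leI_ex[g gI gb].
pose P (u : U) (f : T -> nat) := forall v w, A v -> A w -> phi v = u -> phi w = u ->
  (f v < a)%N /\ (f v = f w -> v = w).
have ex u : exists f, P u f.
  have [[w [Aw <-]]|no] := pselect (exists w, A w /\ phi w = u).
    have [f fI fa] := card_leI_ex (Aa w Aw).
    by exists f => v v' Av Av' pv pv'; split; [exact: fa | exact: fI].
  by exists (fun=> 0%N) => v w Av _ pv; case: no; exists v.
have [f fP] := choice ex.
pose h w := (f (phi w) w + a * g (phi w))%N.
apply: (card_le_trans (B := `I_(a * b)%N)); last exact: card_lexx.
apply: (@card_le_inj _ _ _ _ h) => [v w Av Aw hvw|w Aw]; rewrite /h.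
  have [fva _] := fP _ v v Av Av erefl erefl.
  have [fwa _] := fP _ w w Aw Aw erefl erefl.
  have a0 : (0 < a)%N by exact: leq_ltn_trans fva.
  have gg : g (phi v) = g (phi w).
    have := congr1 (fun z => z %/ a)%N hvw; rewrite /h ![(a * _)%N]mulnC.
    by rewrite !divnDMl ?divn_small.
  have pvw : phi v = phi w by apply: gI => //; exact: AB.
  have [_] := fP _ v w Av Aw pvw erefl; apply.
  by move: hvw; rewrite /h pvw => /addIn.
have [fwa _] := fP _ w w Aw Aw erefl erefl.
rewrite /=; apply: (@leq_trans (a + a * g (phi w)))%N; first by rewrite ltn_add2r.
by rewrite -mulnS leq_mul2l gb ?orbT //; exact: AB.
Qed.

Section Dimension.
Variables (F : finFieldType) (A : comNzRingType) (j : {rmorphism F -> A}).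

Definition lincomb d (e : 'I_d -> A) (c : {ffun 'I_d -> F}) : A :=
  \sum_(i < d) j (c i) * e i.

Lemma lincombB d (e : 'I_d -> A) c c' :
  lincomb e c - lincomb e c' = lincomb e [ffun i => c i - c' i].
Proof.
rewrite /lincomb -sumrB; apply: eq_bigr => i _.
by rewrite ffunE rmorphB mulrBl.
Qed.

Lemma has_dim_card S d : has_dim j S d ->
  (forall c e, (forall i : 'I_d, S (e i)) -> S (lincomb e c)) ->
  (S #<= `I_(#|F| ^ d)%N)%card /\ (`I_(#|F| ^ d)%N #<= S)%card.
Proof.
move=> [e [Se eU]] cl; have cardE : #|{: {ffun 'I_d -> F}}| = (#|F| ^ d)%N.
  by rewrite card_ffun card_ord.
rewrite -cardE; split.
  have ex s : exists c : {ffun 'I_d -> F}, S s -> s = lincomb e c.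
    have [Ss|nS] := pselect (S s); last by exists [ffun=> 0].
    by have [c [-> _]] := eU s Ss; exists c.
  have [c cP] := choice ex.
  by apply: (@card_le_fin _ _ _ c) => a b /cP + /cP + ab => -> ->; rewrite ab.
apply: (@card_ge_fin _ _ _ (lincomb e)) => [c c' cc'|c]; last exact: cl.
have [c0 [_ c0U]] := eU (lincomb e c) (cl c e Se).
by rewrite -(c0U c erefl) -(c0U c' cc').
Qed.

Definition dependent d (e : 'I_d -> A) := exists2 c, c != [ffun=> 0] & lincomb e c = 0.

(** A longest independent tuple is a basis, and the hypothesis bounds the length
    of independent tuples. *)
Lemma bounded_has_dim (S : set A) N :
  (forall a b, S a -> S b -> S (a + b)) -> (forall a f, S f -> S (j a * f)) ->
  (forall e : 'I_N -> A, (forall i, S (e i)) -> dependent e) ->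
  exists d, has_dim j S d.
Proof.
move=> SD SZ dep.
pose Q d := `[< exists2 e : 'I_d -> A, (forall i, S (e i)) & ~ dependent e >].
have Q0 : exists d, Q d.
  exists 0%N; apply/asboolP; exists (fun=> 0); first by case.
  by move=> [c] /eqP + _; apply; apply/ffunP => -[].
have Qle d : Q d -> (d <= N)%N.
  move=> /asboolP[e Se ne]; rewrite leqNgt; apply/negP => /ltnW Nd; apply: ne.
  have [c c0 ce] := dep (fun i => e (widen_ord Nd i)) (fun i => Se _).
  pose c' : {ffun 'I_d -> F} := [ffun i : 'I_d => oapp c 0 (insub (val i))].
  have c'E (k : 'I_N) : c' (widen_ord Nd k) = c k.
    rewrite ffunE (_ : insub _ = Some k) //=.
    by rewrite insubT //= => lt; congr Some; exact/val_inj.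
  exists c'.
    apply: contraNneq c0 => c'0; apply/eqP/ffunP => k.
    by rewrite -c'E c'0 !ffunE.
  rewrite -ce /lincomb (bigID (fun i : 'I_d => (i < N)%N)) /= [X in _ + X]big1 ?addr0.
    rewrite (big_ord_narrow Nd) //=.
    by apply: eq_bigr => i _; rewrite c'E.
  by move=> i /negbTE iN; rewrite ffunE insubF // rmorph0 mul0r.
case: (ex_maxnP Q0 Qle) => d /asboolP[e Se ne] dmax.
exists d, e; split=> // s Ss.
pose e' (i : 'I_d.+1) := if unlift ord_max i is Some k then e k else s.
have e'l k : e' (lift ord_max k) = e k by rewrite /e' liftK.
have e'm : e' ord_max = s by rewrite /e' unlift_none.
have [c c0 ce] : dependent e'.
  apply: contrapT => ne'; suff : Q d.+1 by move/dmax; rewrite ltnn.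
  by apply/asboolP; exists e' => // i; rewrite /e'; case: unliftP.
have sumE : lincomb e [ffun k => c (lift ord_max k)] + j (c ord_max) * s = 0.
  rewrite -[RHS]ce /lincomb [RHS]big_ord_recr /= e'm; congr (_ + _).
  apply: eq_bigr => k _; rewrite ffunE.
  have -> : widen_ord (leqnSn d) k = lift ord_max k by apply/val_inj; rewrite /= /bump leqNgt ltn_ord.
  by rewrite e'l.
have cm : c ord_max != 0.
  apply/eqP => cm0; apply: ne; exists [ffun k => c (lift ord_max k)].
    apply: contraNneq c0 => z; apply/eqP/ffunP => i; rewrite ffunE.
    case: (unliftP ord_max i) => [k ->|-> //].
    by have /ffunP/(_ k) := z; rewrite !ffunE.
  by move: sumE; rewrite cm0 rmorph0 mul0r addr0.
have inj c1 c2 : lincomb e c1 = lincomb e c2 -> c1 = c2.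
  move=> eq; apply: contrapT => neq; apply: ne; exists [ffun i => c1 i - c2 i].
    apply/eqP => /ffunP z; apply: neq; apply/ffunP => i; apply/eqP.
    by rewrite -subr_eq0; have := z i; rewrite !ffunE => ->.
  by rewrite -lincombB eq subrr.
exists [ffun k => - c (lift ord_max k) / c ord_max].
suff sE : s = lincomb e [ffun k => - c (lift ord_max k) / c ord_max].
  by split=> // c' c'E; apply: inj; rewrite -sE.
have : j (c ord_max)^-1 * (lincomb e [ffun k => c (lift ord_max k)] + j (c ord_max) * s) = 0.
  by rewrite sumE mulr0.
rewrite mulrDr mulrA -rmorphM mulVf // rmorph1 mul1r => /eqP.
rewrite addrC addr_eq0 => /eqP {1}->.
rewrite /lincomb mulr_sumr -sumrN; apply: eq_bigr => k _; rewrite !ffunE.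
by rewrite mulrA -rmorphM -mulNr -rmorphN mulrC mulNr [_ * c _]mulrC mulrC.
Qed.

End Dimension.

(** * Dependence over F[u] *)

Lemma uniform_bound m (P : 'I_m -> nat -> Prop) :
  (forall i s s', (s <= s')%N -> P i s -> P i s') ->
  (forall i, exists s, P i s) -> exists s, forall i, P i s.
Proof.
move=> mono /choice[s sP]; exists (\sum_i s i)%N => i.
by apply: mono (sP i); rewrite (bigD1 i) //= leq_addr.
Qed.

Section FunctionField.
Variables (F : finFieldType) (X : curve F).
Local Notation K := (funfield X).
Local Notation cst := (Defs.cst X).

Definition evalp (t : K) (p : {poly F}) : K := (map_poly cst p).[t].

Lemma evalpM t p r : evalp t (p * r) = evalp t p * evalp t r.
Proof. by rewrite /evalp rmorphM hornerM. Qed.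
Lemma evalpD t p r : evalp t (p + r) = evalp t p + evalp t r.
Proof. by rewrite /evalp rmorphD hornerD. Qed.
Lemma evalpX t p k : evalp t (p ^+ k) = evalp t p ^+ k.
Proof. by rewrite /evalp rmorphXn horner_exp. Qed.
Lemma evalp_sum t I (r : seq I) (P : pred I) (p : I -> {poly F}) :
  evalp t (\sum_(i <- r | P i) p i) = \sum_(i <- r | P i) evalp t (p i).
Proof. by rewrite /evalp rmorph_sum horner_sum. Qed.
Lemma evalp_prod t I (r : seq I) (P : pred I) (p : I -> {poly F}) :
  evalp t (\prod_(i <- r | P i) p i) = \prod_(i <- r | P i) evalp t (p i).
Proof. by rewrite /evalp rmorph_prod horner_prod. Qed.
Lemma evalpZ t a p : evalp t (a *: p) = cst a * evalp t p.
Proof. by rewrite /evalp map_polyZ hornerZ. Qed.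
Lemma evalp0 t : evalp t 0 = 0.
Proof. by rewrite /evalp map_poly0 horner0. Qed.
Lemma evalpC t a : evalp t a%:P = cst a.
Proof. by rewrite /evalp map_polyC hornerC. Qed.
Lemma evalpX1 t : evalp t 'X = t.
Proof. by rewrite /evalp map_polyX hornerX. Qed.

Section Lattice.
Variables (t : K) (d : nat) (e : 'I_d -> K).

(** The degree filtration of the F[t]-module spanned by the e_i: [s] bounds the
    sizes of the coordinates, that is their degrees plus one. *)
Definition in_lattice s (g : K) := exists2 P : 'I_d -> {poly F},
  (forall i, (size (P i) <= s)%N) & g = \sum_i evalp t (P i) * e i.

Lemma in_lattice_mono s s' g : (s <= s')%N -> in_lattice s g -> in_lattice s' g.
Proof. by move=> ss' [P Ps ->]; exists P => // i; exact: leq_trans ss'. Qed.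

Lemma size_mul_add (p r : {poly F}) a b :
  (size p <= a)%N -> (size r <= b)%N -> (size (p * r)%R <= a + b)%N.
Proof.
move=> pa rb; apply: leq_trans (size_polyMleq p r) _.
by apply: leq_trans (leq_pred _) _; exact: leq_add.
Qed.

Lemma in_latticeM s g (r : {poly F}) : in_lattice s g -> in_lattice (s + size r) (evalp t r * g).
Proof.
move=> [P Ps ->]; exists (fun i => P i * r) => [i|]; first exact: size_mul_add.
by rewrite mulr_sumr; apply: eq_bigr => i _; rewrite evalpM mulrA [evalp t r * _]mulrC.
Qed.

Hypothesis span : forall f : K, exists p q : 'I_d -> {poly F},
  (forall i, evalp t (q i) != 0) /\ f = \sum_(i < d) evalp t (p i) / evalp t (q i) * e i.

Lemma denominator (f : K) : exists2 Q, evalp t Q != 0 & exists s, in_lattice s (evalp t Q * f).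
Proof.
have [p [r [r0 ->]]] := span f; exists (\prod_i r i).
  by rewrite evalp_prod; apply/prodf_neq0 => i _; exact: r0.
pose P i := p i * \prod_(k | k != i) r k.
have [s sP] : exists s, forall i, (size (P i) <= s)%N.
  apply: uniform_bound => [i s s' ss' /leq_trans|i]; first exact.
  by exists (size (P i)).
exists s, P => //; rewrite mulr_sumr; apply: eq_bigr => i _.
rewrite (bigD1 i) //= !evalpM mulrA; congr (_ * _); move: (r0 i) => ri0.
by rewrite mulrC -!mulrA; congr (_ * _); rewrite mulKf.
Qed.

Lemma common_denominator m (f : 'I_m -> K) :
  exists2 Q, evalp t Q != 0 & exists s, forall i, in_lattice s (evalp t Q * f i).
Proof.
have ex i : exists Q, evalp t Q != 0 /\ exists s, in_lattice s (evalp t Q * f i).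
  by have [Q Q0 Qf] := denominator (f i); exists Q.
have [Q QP] := choice ex; exists (\prod_i Q i).
  by rewrite evalp_prod; apply/prodf_neq0 => i _; have [] := QP i.
apply: uniform_bound => [i s s'|i]; first exact: in_lattice_mono.
have [_ [s sP]] := QP i.
exists (s + size (\prod_(k | k != i) Q k)%R)%N.
rewrite [X in evalp t X](bigD1 i) //= evalpM [evalp t (Q i) * _]mulrC -mulrA; exact: in_latticeM.
Qed.

End Lattice.

(** After denominators are cleared, multiplication by u raises the degrees of
    the coordinates in a spanning family of K over F(t) by a bounded amount C'.
    Hence the u ^ m b_j with m < M and j < N lie in an F-space whose dimension
    grows like d C' M, less than their number M N when N > d C' and M is large. *)
Lemma finite_rank (u : K) : exists N, forall b : 'I_N -> K, exists p : 'I_N -> {poly F},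
  (exists i, p i != 0) /\ \sum_i evalp u (p i) * b i = 0.
Proof.
have [t [_ [d [e span]]]] := trdeg1 X.
have [Q Q0 [C QC]] := common_denominator span (fun i => u * e i).
have step s g : in_lattice t e s g -> in_lattice t e (s + C) (evalp t Q * u * g).
  move=> [P Ps ->]; have /choice[A AP] : forall i, exists A : 'I_d -> {poly F},
      (forall k, (size (A k) <= C)%N) /\ evalp t Q * (u * e i) = \sum_k evalp t (A k) * e k.
    by move=> i; have [A AC AE] := QC i; exists A.
  exists (fun k => \sum_i P i * A i k) => [k|].
    apply: (big_ind (fun p : {poly F} => size p <= s + C)%N); first by rewrite size_poly0.
      by move=> p r ps rs; apply: leq_trans (size_polyD _ _) _; rewrite geq_max ps.
    by move=> i _; apply: size_mul_add => //; have [] := AP i.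
  under [RHS]eq_bigr do rewrite evalp_sum mulr_suml.
  rewrite exchange_big mulr_sumr; apply: eq_bigr => i _ /=.
  under eq_bigr do rewrite evalpM -mulrA.
  rewrite -mulr_sumr; have [_ <-] := AP i.
  by rewrite mulrCA -!mulrA.
pose C' := (C + size Q)%N.
have steps s g M m : (m <= M)%N -> in_lattice t e s g ->
    in_lattice t e (s + M * C') (evalp t Q ^+ M * u ^+ m * g).
  move=> + sg; elim: M m => [|M IH] m.
    by rewrite leqn0 => /eqP->; rewrite !expr0 !mul1r mul0n addn0.
  rewrite leq_eqVlt => /orP[/eqP->|]; last rewrite ltnS => /IH /(in_latticeM Q).
    have := step _ _ (IH M (leqnn M)); rewrite !exprS.
    have -> : evalp t Q * u * (evalp t Q ^+ M * u ^+ M * g) =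
      evalp t Q * evalp t Q ^+ M * (u * u ^+ M) * g.
      by rewrite !mulrA; congr (_ * _ * _); rewrite -!mulrA [u * _]mulrC.
    by apply: in_lattice_mono; rewrite mulSn; move: (M * C')%N => z; rewrite /C'; lia.
  rewrite exprS -!mulrA; apply: in_lattice_mono.
  by rewrite mulSn; move: (M * C')%N => z; rewrite /C'; lia.
(* With d elements spanning K, d C' is the growth rate of the target dimension. *)
exists (d * C').+1 => b.
have [Q1 Q10 [C1 QC1]] := common_denominator span b.
(* M beats the part d C1 of the dimension that comes from the b_j. *)
pose N := (d * C').+1; pose M := (d * C1).+1; pose s := (C1 + M * C')%N.
have ex (x : 'I_M * 'I_N) : exists P : 'I_d -> {poly F}, (forall i, (size (P i) <= s)%N) /\
    evalp t Q ^+ M * u ^+ x.1 * (evalp t Q1 * b x.2) = \sum_i evalp t (P i) * e i.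
  by have [P Ps PE] := steps _ _ M x.1 (ltnW (ltn_ord _)) (QC1 x.2); exists P.
have [P PP] := choice ex.
pose img (c : {ffun 'I_M * 'I_N -> F}) : {ffun 'I_d * 'I_s -> F} :=
  [ffun y : 'I_d * 'I_s => \sum_x c x * (P x y.1)`_y.2].
have [c c0 imc] : exists2 c, c != [ffun=> 0] & img c = [ffun=> 0].
  have [[c [c' [ne eq]]]|inj] := pselect (exists c c', c <> c' /\ img c = img c').
    exists [ffun x => c x - c' x].
      apply/eqP => z; apply: ne; apply/ffunP => x.
      by move/ffunP/(_ x): z; rewrite !ffunE => /eqP; rewrite subr_eq0 => /eqP.
    apply/ffunP => y; move/ffunP/(_ y): eq; rewrite !ffunE => /eqP.
    rewrite -subr_eq0 -sumrB => /eqP z; rewrite -[RHS]z.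
    by apply: eq_bigr => x _; rewrite ffunE mulrBl.
  have imgI : injective img.
    by move=> c c' eq; apply: contrapT => ne; apply: inj; exists c, c'.
  have := leq_card _ imgI; rewrite !card_ffun !card_prod !card_ord.
  have F1 : (1 < #|F|)%N by exact: card_finNzRing_gt1.
  rewrite leq_exp2l // leqNgt => /negP; case.
  rewrite -/s /s mulnDr [(d * (M * C'))%N]mulnCA /N mulnS ltn_add2r.
  exact: ltnSn.
exists (fun k => \poly_(m < M) c (inord m, k)); split.
  have [x cx] : exists x, c x != 0.
    apply: contrapT => no; move/eqP: c0; apply; apply/ffunP => x; rewrite ffunE.
    by apply/eqP; apply: contrapT => /negP cx; apply: no; exists x.
  exists x.2; apply: contraNneq cx => /polyP/(_ x.1).
  by rewrite coef_poly ltn_ord coef0 inord_val -surjective_pairing => ->.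
have z : \sum_x cst (c x) * (evalp t Q ^+ M * u ^+ x.1 * (evalp t Q1 * b x.2)) = 0.
  under eq_bigr => x _ do rewrite (PP x).2 mulr_sumr.
  rewrite exchange_big big1 // => i _ /=.
  under eq_bigr do rewrite mulrA -evalpZ.
  rewrite -mulr_suml -evalp_sum (_ : \sum_x _ = 0) ; last first.
    apply/polyP => l; rewrite coef0 coef_sum; have [ls|sl] := ltnP l s.
      have /ffunP/(_ (i, Ordinal ls)) := imc; rewrite !ffunE => imE.
      by rewrite -[RHS]imE; apply: eq_bigr => x _; rewrite coefZ.
    by rewrite big1 // => x _; rewrite coefZ nth_default ?mulr0 // (leq_trans _ sl) ?(PP x).1.
  by rewrite evalp0 mul0r.
apply: (mulfI (_ : evalp t Q ^+ M * evalp t Q1 != 0)); first by rewrite mulf_neq0 ?expf_neq0.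
rewrite mulr0; transitivity (\sum_(m < M) \sum_(k < N)
    cst (c (m, k)) * (evalp t Q ^+ M * u ^+ m * (evalp t Q1 * b k))); last first.
  by rewrite pair_bigA -[RHS]z; apply: eq_bigr => -[m k] _.
rewrite exchange_big mulr_sumr.
apply: eq_bigr => k _; rewrite poly_def evalp_sum mulr_suml mulr_sumr.
apply: eq_bigr => m _; rewrite evalpZ evalpX evalpX1 inord_val; ring.
Qed.

End FunctionField.

(** * Residue fields and discrete valuations *)

Section Points.
Variables (F : finFieldType) (X : curve F).
Local Notation K := (funfield X).
Local Notation cst := (Defs.cst X).

(** A relation can be divided by a power of u until some constant coefficient
    is nonzero, so that it says something modulo u. *)
Lemma finite_rank0 (u : K) : u != 0 -> exists N, forall b : 'I_N -> K,
  exists p : 'I_N -> {poly F}, (exists i, (p i)`_0 != 0) /\ \sum_i evalp u (p i) * b i = 0.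
Proof.
move=> u0; have [N NP] := finite_rank u; exists N => b.
have [p [[i0 pi0] pb]] := NP b.
have ex : exists k, [exists i, (p i)`_k != 0].
  exists (size (p i0)).-1; apply/existsP; exists i0.
  by rewrite -/(lead_coef (p i0)) lead_coef_eq0.
case: (ex_minnP ex) => k /existsP[i1 pi1] kmin.
have pE i : p i = drop_poly k (p i) * 'X^k.
  rewrite -[LHS](poly_take_drop k) (_ : take_poly _ _ = 0) ?add0r //.
  apply/polyP => l; rewrite coef_take_poly coef0; case: ltnP => // lk.
  apply/eqP; apply: contraTT lk => pl; rewrite -leqNgt kmin //.
  by apply/existsP; exists i.
exists (fun i => drop_poly k (p i)); split.
  by exists i1; rewrite coef_drop_poly add0n.
apply: (mulfI (_ : u ^+ k != 0)); first by rewrite expf_neq0.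
rewrite mulr0 -[RHS]pb mulr_sumr; apply: eq_bigr => i _.
by rewrite [in RHS]pE evalpM evalpX evalpX1; ring.
Qed.

Section Point.
Variable y : closed_point X.
Local Notation m := (maximal_set y).

Lemma vN f : y f -> y (- f).
Proof. by move=> yf; rewrite -sub0r; apply: vB yf; exact: v0. Qed.

Lemma vX f k : y f -> y (f ^+ k).
Proof. by move=> yf; elim: k => [|k IH]; rewrite ?expr0 ?exprS; [exact: v1|exact: vM]. Qed.

Lemma v_sum I (r : seq I) (P : pred I) (f : I -> K) :
  (forall i, P i -> y (f i)) -> y (\sum_(i <- r | P i) f i).
Proof. by move=> yf; apply: big_ind => //; [exact: v0 | exact: vD]. Qed.

Lemma maximal_lin a f g : y a -> m f -> m g -> m (a * f + g).
Proof.
move=> ya mf mg; have [_ _ cl] := maximal_closed y.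
pose mk h (yh : y h) : local_ring y := mksr (S := local_ring_set y) yh.
have := cl (mk _ ya) (mk _ (maximal_sub mf)) (mk _ (maximal_sub mg)).
by rewrite -!topredE /= => /(_ (asboolT mf) (asboolT mg)) /asboolP.
Qed.

Lemma maximal0 : m 0. Proof. by left. Qed.

Lemma maximalM a f : y a -> m f -> m (a * f).
Proof. by move=> ya mf; rewrite -[_ * _]addr0; apply: maximal_lin => //; exact: maximal0. Qed.

Lemma maximalD f g : m f -> m g -> m (f + g).
Proof. by move=> mf mg; rewrite -[f]mul1r; apply: maximal_lin => //; exact: v1. Qed.

Lemma maximalN f : m f -> m (- f).
Proof. by move=> mf; rewrite -mulN1r; apply: maximalM => //; apply: vN; exact: v1. Qed.

Lemma maximal_sum I (r : seq I) (P : pred I) (f : I -> K) :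
  (forall i, P i -> m (f i)) -> m (\sum_(i <- r | P i) f i).
Proof. by move=> mf; apply: big_ind => //; [exact: maximal0 | exact: maximalD]. Qed.

Lemma maximal_inv f : f != 0 -> y f -> y f^-1 -> ~ m f.
Proof. by move=> /eqP f0 yf yfV []. Qed.

Lemma maximalNP f : ~ m f -> f != 0 /\ y f^-1.
Proof.
move=> nm; split; first by apply/eqP => f0; apply: nm; left.
by apply: contrapT => h; apply: nm; right.
Qed.

Lemma cst_unit (a : F) : a != 0 -> ~ m (cst a).
Proof.
move=> a0; apply: maximal_inv; [by rewrite fmorph_eq0|exact: v_cst|].
by rewrite -fmorphV; exact: v_cst.
Qed.

Lemma v_evalp u p : y u -> y (evalp u p).
Proof.
move=> yu; rewrite -[p]coefK poly_def evalp_sum; apply: v_sum => i _.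
by rewrite evalpZ evalpX evalpX1; apply: vM; [exact: v_cst|exact: vX].
Qed.

Lemma evalp_split u p : evalp u p = cst p`_0 + u * evalp u (drop_poly 1 p).
Proof.
rewrite -{1}[p](poly_take_drop 1) evalpD evalpM evalpX1 [_ * u]mulrC; congr (_ + _).
rewrite -(evalpC u); congr evalp; apply/polyP => -[|i]; by rewrite coef_take_poly coefC.
Qed.

(** Reduction modulo the maximal ideal, extended by zero outside the valuation
    ring so that it can be applied to rational functions directly. *)
Definition value_at (f : K) : residue_field y :=
  if pselect (y f) is left h then residue y (mksr (S := local_ring_set y) h) else 0.

Lemma value_atE f (h : y f) : value_at f = residue y (mksr (S := local_ring_set y) h).
Proof.
rewrite /value_at; case: pselect => // h'; congr (residue y _); exact/val_inj.
Qed.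

Lemma value_atD f g : y f -> y g -> value_at (f + g) = value_at f + value_at g.
Proof.
move=> yf yg; rewrite (value_atE (vD yf yg)) (value_atE yf) (value_atE yg) -rmorphD.
by congr (residue y _); exact/val_inj.
Qed.

Lemma value_atM f g : y f -> y g -> value_at (f * g) = value_at f * value_at g.
Proof.
move=> yf yg; rewrite (value_atE (vM yf yg)) (value_atE yf) (value_atE yg) -rmorphM.
by congr (residue y _); exact/val_inj.
Qed.

Lemma value_at1 : value_at 1 = 1.
Proof.
rewrite (value_atE (v1 y)) -(rmorph1 (residue y)); congr (residue y _); exact/val_inj.
Qed.

Lemma value_at_cst a : value_at (cst a) = residue_cst y a.
Proof. by rewrite (value_atE (v_cst y a)). Qed.

Lemma value_at_eq0 f : y f -> value_at f = 0 <-> m f.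
Proof.
move=> yf; rewrite (value_atE yf); have := Quotient.idealrBE
  (maximal_pred (x:=y) : idealr (local_ring y)) (mksr (S := local_ring_set y) yf) 0.
rewrite subr0 => E; split=> [r0|mf].
  apply/asboolP; have : mksr (S := local_ring_set y) yf \in maximal_pred (x:=y).
    by rewrite E; apply/eqP; rewrite -[LHS]/(residue y _) r0 -(rmorph0 (residue y)).
  by [].
rewrite -(rmorph0 (residue y)); apply/eqP; rewrite -[_ == _]E.
exact/asboolP.
Qed.

Lemma value_atB f g : y f -> y g -> value_at (f - g) = value_at f - value_at g.
Proof.
move=> yf yg; rewrite value_atD //; last exact: vN.
congr (_ + _); apply/eqP; rewrite -addr_eq0 -value_atD //; last exact: vN.
by rewrite addNr; apply/eqP/value_at_eq0; [exact: v0 | exact: maximal0].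
Qed.

Lemma value_at_sum I (r : seq I) (P : pred I) (f : I -> K) :
  (forall i, P i -> y (f i)) -> value_at (\sum_(i <- r | P i) f i) = \sum_(i <- r | P i) value_at (f i).
Proof.
move=> yf; suff [] : y (\sum_(i <- r | P i) f i) /\
  value_at (\sum_(i <- r | P i) f i) = \sum_(i <- r | P i) value_at (f i) by [].
apply: (big_rec2 (fun a b => y a /\ value_at a = b)).
  by split; [exact: v0 | apply/value_at_eq0; [exact: v0 | exact: maximal0]].
move=> i b a Pi [ya <-]; split; first by apply: vD => //; exact: yf.
by rewrite value_atD //; exact: yf.
Qed.

Lemma value_at_surj (r : residue_field y) : exists2 f, y f & value_at f = r.
Proof.
exists (val (repr r)); first exact: srtypeP.
rewrite (value_atE (srtypeP (repr r))) -[RHS]reprK; congr (residue y _); exact/val_inj.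
Qed.

Lemma residue_cst_zmod : zmod_morphism (residue_cst y).
Proof.
by move=> a b; rewrite -!value_at_cst rmorphB value_atB //; exact: v_cst.
Qed.

Lemma residue_cst_monoid : monoid_morphism (residue_cst y).
Proof.
split; first by rewrite -value_at_cst rmorph1 value_at1.
by move=> a b; rewrite -!value_at_cst rmorphM value_atM //; exact: v_cst.
Qed.

HB.instance Definition _ :=
  GRing.isZmodMorphism.Build F (residue_field y) (residue_cst y) residue_cst_zmod.
HB.instance Definition _ :=
  GRing.isMonoidMorphism.Build F (residue_field y) (residue_cst y) residue_cst_monoid.

Lemma maximal_nonzero : exists2 u, u != 0 & m u.
Proof.
have [f nf] := v_proper y; exists f^-1.
  by rewrite invr_eq0; apply/eqP => f0; apply: nf; rewrite f0; exact: v0.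
by right; rewrite invrK.
Qed.

(** For u in the maximal ideal, elements whose residues are independent over F
    are independent over F[u]: otherwise a relation with some nonzero constant
    coefficient would reduce to a relation between the residues. *)
Lemma residue_has_dim : has_dim (residue_cst y) setT (degree_pt y).
Proof.
apply: (xgetPex 0%N); have [u u0 mu] := maximal_nonzero; have yu := maximal_sub mu.
have [N NP] := finite_rank0 u0.
apply: (@bounded_has_dim F _ (residue_cst y) setT N) => // e _.
have ex i : exists f, y f /\ value_at f = e i by have [f] := value_at_surj (e i); exists f.
have [b bP] := choice ex; have [p [[i0 pi0] pb]] := NP b.
exists [ffun i => (p i)`_0].
  by apply: contraNneq pi0 => /ffunP/(_ i0); rewrite !ffunE => ->.
rewrite /lincomb; transitivity (value_at (\sum_i evalp u (p i) * b i)); last first.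
  by rewrite pb; apply/value_at_eq0; [exact: v0 | exact: maximal0].
have yb i : y (b i) by have [] := bP i.
rewrite value_at_sum; last by move=> i _; apply: vM => //; exact: v_evalp.
apply: eq_bigr => i _; rewrite value_atM //; last exact: v_evalp.
have [_ ->] := bP i; congr (_ * _); rewrite ffunE evalp_split value_atD; last 2 first.
- exact: v_cst.
- by apply: vM => //; exact: v_evalp.
rewrite value_at_cst (_ : value_at (u * _) = 0) ?addr0 //; apply/value_at_eq0.
  by apply: vM => //; exact: v_evalp.
by rewrite mulrC; apply: maximalM => //; exact: v_evalp.
Qed.

Lemma residue_card :
  ([set: residue_field y] #<= `I_(#|F| ^ degree_pt y)%N)%card /\
  (`I_(#|F| ^ degree_pt y)%N #<= [set: residue_field y])%card.
Proof. exact: (has_dim_card residue_has_dim). Qed.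

Lemma degree_pt_gt0 : (0 < degree_pt y)%N.
Proof.
rewrite lt0n; apply/eqP => d0; have [+ _] := residue_card.
rewrite d0 expn0 => /card_leI_ex[f fI f1].
have /eqP := oner_neq0 (residue_field y); apply; apply: fI => //.
by have := f1 1 I; have := f1 0 I; case: (f 1) => //; case: (f 0).
Qed.

(** The elements of a chain for divisibility in the maximal ideal are linearly
    independent over the polynomials in its first element. *)
Lemma chain_bounded (u : K) : u != 0 -> exists N, forall x : nat -> K,
  x 0%N = u -> (forall i, (i < N)%N -> m (x i) /\ x i != 0) ->
  (forall i, (i.+1 < N)%N -> m (x i / x i.+1)) -> False.
Proof.
move=> u0; have [N NP] := finite_rank0 u0; exists N => x x0 mx xx.
have [p [[i0 pi0] px]] := NP (fun i : 'I_N => x i).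
have N0 : (0 < N)%N by exact: leq_ltn_trans (ltn_ord i0).
have mu : m u by rewrite -x0; have [] := mx 0%N N0.
have yu := maximal_sub mu.
have xN i j : (i < j)%N -> (j < N)%N -> m (x i / x j).
  elim: j => // j IH; rewrite ltnS leq_eqVlt => /orP[/eqP->|ij] jN; first exact: xx.
  have [_ xj] := mx j (ltnW jN).
  have -> : x i / x j.+1 = (x i / x j) * (x j / x j.+1) by rewrite mulrA divfK.
  by apply: maximalM; [apply: maximal_sub; apply: IH => //; exact: ltnW | exact: xx].
(* Divided by x_j, every term of the relation other than the j-th lies in the
   maximal ideal: for i < j because of x_i / x_j, for j < i because of p_i. *)
have [j pj jmax] := @arg_maxnP _ i0 (fun i : 'I_N => (p i)`_0 != 0) (fun i => i : nat) pi0.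
have [_ xj0] := mx j (ltn_ord j).
have mpj : m (evalp u (p j)).
  have -> : evalp u (p j) = - \sum_(i < N | i != j) evalp u (p i) * (x i / x j).
    apply/eqP; rewrite -addr_eq0; apply/eqP.
    apply: (mulIf xj0); rewrite mul0r -[RHS]px [RHS](bigD1 j) //= mulrDl mulr_suml.
    by congr (_ + _); apply: eq_bigr => i _; rewrite -mulrA divfK.
  apply: maximalN; apply: maximal_sum => i ij.
  case: (ltngtP i j) => [lt|gt|/val_inj eq]; last by rewrite eq eqxx in ij.
    by apply: maximalM; [exact: v_evalp | exact: xN].
  have pi : (p i)`_0 = 0.
    by apply/eqP; apply: contraLR gt => /jmax; rewrite -leqNgt.
  rewrite evalp_split pi rmorph0 add0r.
  have -> : u * evalp u (drop_poly 1 (p i)) * (x i / x j) =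
     (u / x j * evalp u (drop_poly 1 (p i))) * x i by field.
  apply: maximalM; last by have [] := mx i (ltn_ord i).
  apply: vM; last exact: v_evalp.
  case: (posnP j) => [j0|j0]; first by rewrite j0 x0 divff //; exact: v1.
  by rewrite -x0; apply: maximal_sub; exact: xN.
apply: (cst_unit pj).
have -> : cst (p j)`_0 = - evalp u (drop_poly 1 (p j)) * u + evalp u (p j).
  by rewrite [evalp u (p j)]evalp_split; ring.
by apply: maximal_lin => //; apply: vN; exact: v_evalp.
Qed.

(** Without a uniformizer every nonzero element of the maximal ideal would be
    properly divisible in it, and the chains would be unbounded. *)
Lemma uniformizer_exists : exists t, uniformizer y t.
Proof.
apply: contrapT => no; have [u u0 mu] := maximal_nonzero.
have next f : exists g, m f /\ f != 0 -> [/\ m g, g != 0 & m (f / g)].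
  have [[mf f0]|h] := pselect (m f /\ f != 0); last by exists 0.
  have [g [mg nfg]] : exists g, m g /\ ~ y (g / f).
    apply: contrapT => h; apply: no; exists f; split=> // g mg.
    by apply: contrapT => nfg; apply: h; exists g.
  exists g => _; split=> //.
    by apply/eqP => g0; apply: nfg; rewrite g0 mul0r; exact: v0.
  by right; rewrite invf_div.
have [nx nxP] := choice next.
have chain i : m (iter i nx u) /\ iter i nx u != 0.
  by elim: i => // i IH; have [] := nxP _ IH.
have [N NP] := chain_bounded u0; apply: (NP (fun i => iter i nx u)) => //.
by move=> i _; have [] := nxP _ (chain i).
Qed.

Definition unif : K := sval (cid uniformizer_exists).
Local Notation t := unif.

Lemma unifP : uniformizer y t. Proof. exact: svalP (cid uniformizer_exists). Qed.
Lemma unif_neq0 : t != 0. Proof. by have [] := unifP. Qed.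
Lemma maximal_unif : m t. Proof. by have [] := unifP. Qed.

Lemma v_unif_expz (k : int) : y (t ^ k) <-> 0 <= k.
Proof.
have yt := maximal_sub maximal_unif; case: k => k; first by split=> // _; exact: vX.
rewrite NegzE -exprnN; split=> // h; exfalso.
have [] := maximal_inv unif_neq0 yt _ maximal_unif.
have -> : t^-1 = t ^+ k * t ^- k.+1.
  by rewrite exprS invfM mulrCA divff ?mulr1 // expf_neq0 // unif_neq0.
by apply: vM => //; exact: vX.
Qed.

Definition v_unit f := [/\ f != 0, y f & y f^-1].

Lemma v_unitM f g : v_unit f -> v_unit g -> v_unit (f * g).
Proof.
move=> [f0 yf yfV] [g0 yg ygV]; split; first by rewrite mulf_neq0.
  exact: vM.
by rewrite invfM; exact: vM.
Qed.

Lemma v_unitV f : v_unit f -> v_unit f^-1.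
Proof. by case=> f0 yf yfV; split; rewrite ?invr_eq0 ?invrK. Qed.

(** An element divisible by all powers of the uniformizer t would be the start
    of the chains f, t ^ (N - 1), ..., t, for every N. *)
Lemma unif_decomp f : f != 0 -> exists k : int, v_unit (f / t ^ k).
Proof.
have pos g : g != 0 -> y g -> exists k : nat, v_unit (g / t ^+ k).
  move=> g0 yg; apply: contrapT => no.
  have yk k : y (g / t ^+ k).
    elim: k => [|k IH]; first by rewrite expr0 divr1.
    have [mg|/maximalNP[h0 hV]] := pselect (m (g / t ^+ k)).
      have [_ _ tP] := unifP; have := tP _ mg.
      by rewrite exprSr invfM mulrA mulrAC.
    by case: no; exists k.
  have [N NP] := chain_bounded g0.
  have tk0 k : t ^+ k != 0 by rewrite expf_neq0 // unif_neq0.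
  have mgk k : m (g / t ^+ k).
    have -> : g / t ^+ k = g / t ^+ k.+1 * t.
      by rewrite exprSr invfM mulrA divfK // unif_neq0.
    by apply: maximalM (yk _) _; exact: maximal_unif.
  apply: (NP (fun i => if i is 0%N then g else t ^+ (N - i))) => //.
    case=> [|i] iN; first by split=> //; have := mgk 0%N; rewrite expr0 divr1.
    split=> //; have : (0 < N - i.+1)%N by rewrite subn_gt0.
    case: (N - _)%N => // k _; rewrite exprSr; apply: maximalM maximal_unif.
    exact/vX/maximal_sub/maximal_unif.
  case=> [|i] iN; first exact: mgk.
  rewrite [(N - i.+2)%N]subnS; have : (1 < N - i.+1)%N by lia.
  case: (N - i.+1)%N => [|[|k]] // _ /=.
  by rewrite exprS mulfK //; exact: maximal_unif.
move=> f0; case: (v_val y f) => yf.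
  by have [k kP] := pos f f0 yf; exists k.
have fV0 : f^-1 != 0 by rewrite invr_eq0.
have [k kP] := pos _ fV0 yf; exists (- k%:Z).
rewrite (_ : f / _ = (f^-1 / t ^+ k)^-1); first exact: v_unitV.
by rewrite invfM invrK -invr_expz invrK.
Qed.

Definition ord f : int := xget 0 [set k : int | v_unit (f / t ^ k)].

Lemma texpz_neq0 (k : int) : t ^ k != 0.
Proof. by rewrite expfz_neq0 // unif_neq0. Qed.

Lemma ord_unit f : f != 0 -> v_unit (f / t ^ ord f).
Proof.
move=> f0; have [k kP] := unif_decomp f0; rewrite /ord.
by case: xgetP => [l _ //|/(_ k)].
Qed.

Lemma v_unitMr u f : v_unit u -> y (u * f) <-> y f.
Proof.
move=> [u0 yu yuV]; split=> [yuf|yf]; last exact: vM.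
by rewrite -[f](mulKf u0); exact: vM.
Qed.

Lemma ordE f k : v_unit (f / t ^ k) -> ord f = k.
Proof.
move=> fk; have f0 : f != 0.
  by case: fk => + _ _; apply: contra_neq => ->; rewrite mul0r.
have le a b : v_unit (f / t ^ a) -> v_unit (f / t ^ b) -> a <= b.
  move=> fa fb; rewrite -subr_ge0 -v_unif_expz.
  have -> : t ^ (b - a) = (f / t ^ a) * (f / t ^ b)^-1.
    rewrite expfzDr ?unif_neq0 // -invr_expz.
    by have := texpz_neq0 a; have := texpz_neq0 b => tb ta; field; rewrite tb ta f0.
  by have [_ + _] := v_unitM fa (v_unitV fb).
by apply/le_anti; rewrite !le //; exact: ord_unit.
Qed.

Lemma ordM f g : f != 0 -> g != 0 -> ord (f * g) = ord f + ord g.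
Proof.
move=> f0 g0; apply: ordE; rewrite expfzDr ?unif_neq0 // invfM mulrACA.
by apply: v_unitM; exact: ord_unit.
Qed.

Lemma ord_one : ord 1 = 0.
Proof.
by apply: ordE; rewrite expr0z divr1; split; rewrite ?invr1 ?oner_eq0 //; exact: v1.
Qed.

Lemma ordV f : f != 0 -> ord f^-1 = - ord f.
Proof.
move=> f0; have fV0 : f^-1 != 0 by rewrite invr_eq0.
by have := ordM fV0 f0; rewrite mulVf // ord_one => /eqP; rewrite eq_sym addr_eq0 => /eqP.
Qed.

Lemma ordX f k : f != 0 -> ord (f ^+ k) = ord f * k%:Z.
Proof.
move=> f0; elim: k => [|k IH]; first by rewrite expr0 ord_one mulr0.
by rewrite exprS ordM ?expf_neq0 // IH -[k.+1]addn1 PoszD mulrDr mulr1 addrC.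
Qed.

Lemma ord_expz f (k : int) : f != 0 -> ord (f ^ k) = ord f * k.
Proof.
move=> f0; case: k => k; first exact: ordX.
by rewrite NegzE -exprnN ordV ?expf_neq0 // ordX // mulrN.
Qed.

Lemma ord_unif : ord t = 1.
Proof. by apply: ordE; rewrite expr1z divff ?unif_neq0 //; split; rewrite ?invr1 ?oner_eq0 //; exact: v1. Qed.

Lemma v_ord f : f != 0 -> y f <-> 0 <= ord f.
Proof.
move=> f0; rewrite -v_unif_expz -(v_unitMr (t ^ ord f) (ord_unit f0)) divfK //; exact: texpz_neq0.
Qed.

Lemma maximal_ord f : f != 0 -> m f <-> 0 < ord f.
Proof.
move=> f0; rewrite ltNge -oppr_ge0 -ordV //; split=> [mf|/negP nf].
  apply/negP => /(v_ord _); rewrite invr_eq0 => /(_ f0) yfV.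
  exact: (maximal_inv f0 (maximal_sub mf) yfV mf).
by right=> yfV; apply: nf; apply/(v_ord _) => //; rewrite invr_eq0.
Qed.

Lemma ord_uniformizer s : uniformizer y s -> ord s = 1.
Proof.
move=> [s0 ms sP]; apply/le_anti; rewrite -[1 <= _]/(0 < ord s).
move/(maximal_ord s0): (ms) => ->; rewrite andbT.
rewrite -subr_ge0 -{1}ord_unif -ordV // -ordM ?unif_neq0 ?invr_eq0 //.
apply/v_ord; first by rewrite mulf_neq0 ?unif_neq0 ?invr_eq0.
exact/sP/maximal_unif.
Qed.

Lemma val_geP k f : f != 0 -> val_ge y k f <-> k <= ord f.
Proof.
move=> f0; have E s : uniformizer y s -> y (f / s ^ k) <-> k <= ord f.
  move=> us; have [s0 _ _] := us; have sk0 : s ^ k != 0 by rewrite expfz_neq0.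
  rewrite v_ord ?mulf_neq0 ?invr_eq0 // ordM ?invr_eq0 // ordV // ord_expz //.
  by rewrite (ord_uniformizer us) mul1r subr_ge0.
by split=> [/(_ _ unifP)/(E _ unifP) //|kf s us]; exact/E.
Qed.

Lemma val_ge0 k : val_ge y k (0 : K).
Proof. by move=> s _; rewrite mul0r; exact: v0. Qed.

Lemma val_geD k f g : val_ge y k f -> val_ge y k g -> val_ge y k (f + g).
Proof. by move=> kf kg s us; rewrite mulrDl; apply: vD; [exact: kf | exact: kg]. Qed.

Lemma val_geM k l f g : val_ge y k f -> val_ge y l g -> val_ge y (k + l) (f * g).
Proof.
move=> kf lg s us; have [s0 _ _] := us.
by rewrite expfzDr // invfM mulrACA; apply: vM; [exact: kf | exact: lg].
Qed.

Lemma val_ge_v f : val_ge y 0 f <-> y f.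
Proof.
split=> [/(_ _ unifP)|yf s _]; first by rewrite expr0z divr1.
by rewrite expr0z divr1.
Qed.

End Point.
End Points.

Arguments ord : simpl never.

(** * Divisors and global sections *)

Section Divisors.
Variables (F : finFieldType) (X : curve F).
Local Notation K := (funfield X).
Local Notation cst := (Defs.cst X).
Local Notation point := (closed_point X).
Implicit Types (D E : divisor X) (y z : point).

Lemma dzero_subproof : finite_set [set y : point | (0 : int) != 0].
Proof. by rewrite (_ : [set _ | _] = set0) //; apply/seteqP; split=> y //=; rewrite eqxx. Qed.
Definition dzero : divisor X := Divisor dzero_subproof.

Lemma dadd_subproof D E : finite_set [set y | D y + E y != 0].
Proof.
apply: (@sub_finite_set _ _ ([set y | D y != 0] `|` [set y | E y != 0])).
  move=> y /= DE; have [Dy|] := eqVneq (D y) 0; last by left.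
  by right; rewrite Dy add0r in DE.
by rewrite finite_setU; split; exact: dcoef_fin.
Qed.
Definition dadd D E : divisor X := Divisor (@dadd_subproof D E).

Lemma dscale_subproof (k : int) D : finite_set [set y | k * D y != 0].
Proof.
apply: (sub_finite_set _ (dcoef_fin D)) => y /=.
by apply: contra_neq => ->; rewrite mulr0.
Qed.
Definition dscale k D : divisor X := Divisor (dscale_subproof k D).

Lemma dpoint_subproof y : finite_set [set z | ((z == y)%:R : int) != 0].
Proof.
by apply: (sub_finite_set _ (finite_set1 y)) => z /=; case: (eqVneq z y).
Qed.
Definition dpoint y : divisor X := Divisor (dpoint_subproof y).

Definition dpoints (l : seq point) : divisor X := foldr (fun y D => dadd (dpoint y) D) dzero l.

Lemma degree_divE D (A : {fset point}) : (forall y, y \notin A -> D y = 0) ->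
  degree_div D = \sum_(y <- A) D y * (degree_pt y)%:Z.
Proof. by move=> DA; apply: fsbigTE => y /DA ->; rewrite mul0r. Qed.

Lemma degree_dzero : degree_div dzero = 0.
Proof. by rewrite (degree_divE (A := fset0)) // big_seq_fset0. Qed.

Lemma notin_support D y (A : {fset point}) :
  y \notin (fset_set [set y | D y != 0%R] `|` A)%fset -> D y = 0.
Proof.
rewrite in_fsetU negb_or => /andP[+ _]; rewrite in_fset_set ?notin_setE /=; last exact: dcoef_fin.
by move=> /negP; rewrite negbK => /eqP.
Qed.

Lemma degree_dadd D E : degree_div (dadd D E) = degree_div D + degree_div E.
Proof.
pose A := (fset_set [set y | D y != 0%R] `|` fset_set [set y | E y != 0%R])%fset.
have DA y : y \notin A -> D y = 0 by exact: notin_support.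
have EA y : y \notin A -> E y = 0 by rewrite /A fsetUC; exact: notin_support.
rewrite !(degree_divE (A := A)) //; last by move=> y yA /=; rewrite DA ?EA.
by rewrite -big_split /=; apply: eq_bigr => y _; rewrite mulrDl.
Qed.

Lemma degree_dscale k D : degree_div (dscale k D) = k * degree_div D.
Proof.
pose A := (fset_set [set y | D y != 0%R] `|` fset0)%fset.
have DA y : y \notin A -> D y = 0 by exact: notin_support.
rewrite !(degree_divE (A := A)) //; last by move=> y yA /=; rewrite DA ?mulr0.
by rewrite big_distrr /=; apply: eq_bigr => y _; rewrite mulrA.
Qed.

Lemma degree_dpoint y : degree_div (dpoint y) = degree_pt y.
Proof.
rewrite (degree_divE (A := [fset y]%fset)) ?big_seq_fset1 /= ?eqxx ?mul1r //.
by move=> z; rewrite in_fset1 => /negbTE ->.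
Qed.

Lemma degree_dpoints l : degree_div (dpoints l) = (\sum_(y <- l) degree_pt y)%N.
Proof.
elim: l => [|y l IH]; first by rewrite big_nil degree_dzero.
by rewrite big_cons /= degree_dadd degree_dpoint IH PoszD.
Qed.

Lemma size_degree_dpoints (l : seq point) : (size l <= \sum_(y <- l) degree_pt y)%N.
Proof. by elim: l => // y l IH; rewrite big_cons /= -add1n leq_add ?degree_pt_gt0. Qed.

(** Global sections of O(D), as a set of rational functions. *)
Definition H0 D : set K := [set f | OXD_set D (open_top X) f].

Lemma H0_eq D E : (forall y, D y = E y) -> H0 D = H0 E.
Proof. by move=> DE; apply/seteqP; split=> f Df y /Df; rewrite DE. Qed.

Lemma H0P D f : f != 0 -> H0 D f <-> forall y, - D y <= ord y f.
Proof. by move=> f0; split=> h y; [exact/val_geP/h | move=> _; exact/val_geP]. Qed.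

Lemma H0_0 D : H0 D 0.
Proof. by move=> y _; exact: val_ge0. Qed.

Lemma H0D D f g : H0 D f -> H0 D g -> H0 D (f + g).
Proof. by move=> hf hg y yT; apply: val_geD; [exact: hf | exact: hg]. Qed.

Lemma H0M D E f g : H0 D f -> H0 E g -> H0 (dadd D E) (f * g).
Proof. by move=> hf hg y yT; rewrite /= opprD; apply: val_geM; [exact: hf|exact: hg]. Qed.

Lemma H0Z D a f : H0 D f -> H0 D (cst a * f).
Proof.
by move=> hf y yT; rewrite -[- D y]add0r; apply: val_geM; [exact/val_ge_v/v_cst|exact: hf].
Qed.

Lemma H0N D f : H0 D f -> H0 D (- f).
Proof. by move=> /(H0Z (-1)); rewrite rmorphN rmorph1 mulN1r. Qed.

Lemma H0_sub D E : (forall y, D y <= E y) -> H0 D `<=` H0 E.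
Proof.
move=> DE f; have [->|f0] := eqVneq f 0; first by move=> _; exact: H0_0.
by move=> /(H0P _ f0) hf; apply/(H0P _ f0) => y; apply: le_trans (hf y); rewrite lerN2.
Qed.

Lemma H0_mul_inj D E f n : f != 0 -> H0 D f ->
  (H0 (dadd D E) #<= `I_n)%card -> (H0 E #<= `I_n)%card.
Proof.
move=> f0 Df; apply: card_le_trans; apply: (@card_le_inj _ _ _ _ ( *%R f)).
  by move=> a b _ _ /(mulfI f0).
by move=> g; exact: H0M.
Qed.

(** The function u generates O(D) near y, so that f |-> (f / u)(y) is the
    restriction to the fibre at y, with kernel the sections of O(D - y). *)
Lemma value_at_eq_sub y u D f g : u != 0 -> ord y u = - D y -> H0 D f -> H0 D g ->
  value_at y (f / u) = value_at y (g / u) -> H0 (dadd D (dscale (-1) (dpoint y))) (f - g).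
Proof.
move=> u0 ou Df Dg E; have [fg|nz] := eqVneq (f - g) 0; first by rewrite fg; exact: H0_0.
have yq h : H0 D h -> y (h / u).
  move=> Dh; have [->|h0] := eqVneq h 0; first by rewrite mul0r; exact: v0.
  apply/v_ord; first by rewrite mulf_neq0 ?invr_eq0.
  rewrite ordM ?invr_eq0 // ordV // ou opprK -lerBlDr sub0r.
  exact: ((H0P _ h0).1 Dh).
have Dfg : H0 D (f - g) by apply: H0D => //; exact: H0N.
apply/(H0P _ nz) => z /=; case: (eqVneq z y) => [->|zy].
  rewrite mulN1r opprD opprK -ou lezD1.
  have q0 : (f - g) / u != 0 by rewrite mulf_neq0 ?invr_eq0.
  rewrite -subr_gt0 -ordV // -ordM ?invr_eq0 //; apply/maximal_ord => //.
  apply/value_at_eq0; first exact: yq.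
  by rewrite mulrBl value_atB ?E ?subrr //; exact: yq.
by rewrite mulr0 addr0; exact: ((H0P _ nz).1 Dfg).
Qed.

(** The new sections are told apart, modulo the old ones, by their values in the
    fibre of O(D + y) at y. *)
Lemma H0_step y D n : (H0 D #<= `I_n)%card ->
  (H0 (dadd D (dpoint y)) #<= `I_(n * #|F| ^ degree_pt y)%N)%card.
Proof.
move=> Dn; pose u := unif y ^ (- D y - 1).
have u0 : u != 0 by exact: texpz_neq0.
have ou : ord y u = - dadd D (dpoint y) y.
  by rewrite /= eqxx ord_expz ?unif_neq0 // ord_unif mul1r opprD.
have [rc _] := residue_card y.
apply: (card_le_fibres (phi := fun f => value_at y (f / u)) (B := setT)) => // w Dw.
apply: card_le_trans Dn; apply: (@card_le_inj _ _ _ _ (fun f => f - w)).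
  by move=> a b _ _ /addIr.
move=> f [Df fw]; rewrite (@H0_eq _ (dadd (dadd D (dpoint y)) (dscale (-1) (dpoint y)))).
  exact: value_at_eq_sub fw.
by move=> z /=; rewrite mulN1r addrK.
Qed.

Lemma H0_steps l D a : (H0 D #<= `I_(#|F| ^ a)%N)%card ->
  (H0 (dadd D (dpoints l)) #<= `I_(#|F| ^ (a + \sum_(y <- l) degree_pt y))%N)%card.
Proof.
elim: l => [|y l IH] Da.
  by rewrite big_nil addn0 (@H0_eq _ D) // => y /=; rewrite addr0.
rewrite big_cons addnCA addnC expnD.
rewrite (@H0_eq _ (dadd (dadd D (dpoints l)) (dpoint y))); first exact/H0_step/IH.
by move=> z /=; rewrite addrCA addrC.
Qed.

Lemma card_setT_D1 (T : Type) (r : T) n :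
  ([set: T] #<= `I_n.+1)%card -> ([set v : T | v <> r] #<= `I_n)%card.
Proof.
move=> /card_leI_ex[g gI gn]; have gI' a b : g a = g b -> a = b by exact: gI.
pose h v := if g v == n then g r else g v.
apply: (@card_le_inj _ _ _ _ h) => [a b /= ar br|a /= ar]; rewrite /h.
  case: eqP => [an|an]; case: eqP => [bn|bn].
  - by move=> _; apply: gI'; rewrite an bn.
  - by move=> /gI' /esym.
  - by move=> /gI'.
  - exact: gI'.
case: eqP => [an|an]; last by rewrite ltn_neqAle -ltnS gn // andbT; exact/eqP.
rewrite ltn_neqAle -ltnS gn // andbT; apply/eqP => rn; apply: ar; apply: gI'.
by rewrite an rn.
Qed.

Lemma card_F_gt1 : (1 < #|F|)%N. Proof. exact: card_finNzRing_gt1. Qed.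

(** If one value were missed, there would be too few fibres for the size of
    H0 D. *)
Lemma value_at_surj_of_card y D u a : u != 0 -> ord y u = - D y ->
  (`I_(#|F| ^ (a + degree_pt y))%N #<= H0 D)%card ->
  (H0 (dadd D (dscale (-1) (dpoint y))) #<= `I_(#|F| ^ a)%N)%card ->
  forall r, exists2 f, H0 D f & value_at y (f / u) = r.
Proof.
move=> u0 ou lo hi r; apply: contrapT => no.
have [rc _] := residue_card y; have q0 : (0 < #|F|)%N by exact: ltnW card_F_gt1.
have q0' b : (0 < #|F| ^ b)%N by rewrite expn_gt0 q0.
have up : (H0 D #<= `I_(#|F| ^ a * (#|F| ^ degree_pt y).-1)%N)%card.
  apply: (card_le_fibres (phi := fun f => value_at y (f / u)) (B := [set v | v <> r])).
  - by move=> f Df fr; apply: no; exists f.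
  - move=> w Dw; apply: card_le_trans hi; apply: (@card_le_inj _ _ _ _ (fun f => f - w)).
      by move=> b c _ _ /addIr.
    by move=> f [Df fw]; exact: value_at_eq_sub fw.
  - by apply: card_setT_D1; rewrite prednK.
have := card_bounds lo up; rewrite expnD leq_pmul2l // leqNgt prednK ?leqnn //.
Qed.
End Divisors.

(** * Riemann-Roch in genus one *)

Section RiemannRoch.
Variables (F : finFieldType) (X : curve F).
Local Notation K := (funfield X).
Local Notation cst := (Defs.cst X).
Local Notation point := (closed_point X).
Local Notation q := #|F|.
Implicit Types (D E : divisor X) (y z : point).

(** The longest such family measures the dimension of H0 D when y is rational,
    and, unlike bases, such families for D and E multiply to one for D + E. *)
Definition increasing y D r (c : nat -> K) :=
  (forall i, (i < r)%N -> H0 D (c i) /\ c i != 0) /\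
  (forall i, (i.+1 < r)%N -> ord y (c i) < ord y (c i.+1)).

Lemma H0_sum D I (s : seq I) (P : pred I) (f : I -> K) :
  (forall i, P i -> H0 D (f i)) -> H0 D (\sum_(i <- s | P i) f i).
Proof. by move=> Df; apply: big_ind => //; [exact: H0_0 | exact: H0D]. Qed.

Lemma increasing_lt y D r c : increasing y D r c ->
  forall i j, (i < j)%N -> (j < r)%N -> ord y (c i) < ord y (c j).
Proof.
move=> [_ cc] i; elim=> // j IH; rewrite ltnS leq_eqVlt => /orP[/eqP->|ij] jr; first exact: cc.
by apply: lt_trans (cc _ jr); apply: IH => //; exact: ltnW.
Qed.

Lemma ord_cst y (a : F) : a != 0 -> ord y (cst a) = 0.
Proof.
move=> a0; apply: ordE; rewrite expr0z divr1; split; first by rewrite fmorph_eq0.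
  exact: v_cst.
by rewrite -fmorphV; exact: v_cst.
Qed.

(** Functions with distinct orders at one point are linearly independent. *)
Lemma increasing_card y D r c : increasing y D r c -> (`I_(q ^ r)%N #<= H0 D)%card.
Proof.
move=> ic; have [Dc _] := ic.
have <- : #|{: {ffun 'I_r -> F}}| = (q ^ r)%N by rewrite card_ffun card_ord.
apply: (@card_ge_fin _ _ _ (fun a : {ffun 'I_r -> F} => \sum_(i < r) cst (a i) * c i)); last first.
  by move=> a; apply: H0_sum => i _; apply: H0Z; have [] := Dc i (ltn_ord i).
move=> a b ab; apply: contrapT => ne.
have [i0 i0P] : exists i, a i - b i != 0.
  apply: contrapT => no; apply: ne; apply/ffunP => i; apply/eqP; rewrite -subr_eq0.
  by apply: contrapT => /negP h; apply: no; exists i.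
have [i di imin] := @arg_minnP _ i0 (fun i => a i - b i != 0) (fun i => i : nat) i0P.
have [_ ci0] := Dc i (ltn_ord i).
pose d := a i - b i.
have ab0 : \sum_(k < r) cst (a k - b k) * c k = 0.
  under eq_bigr do rewrite rmorphB mulrBl.
  by rewrite sumrB; apply/eqP; rewrite subr_eq0; exact/eqP.
have E : cst d * c i = - \sum_(k < r | k != i) cst (a k - b k) * c k.
  by apply/eqP; rewrite -addr_eq0; move/eqP: ab0; rewrite (bigD1 i).
have : val_ge y (ord y (c i) + 1) (cst d * c i).
  rewrite E -sumrN; apply: big_ind => [||k ki]; [exact: val_ge0|exact: val_geD|].
  case: (ltngtP k i) => [lt|gt|/val_inj eq]; last by rewrite eq eqxx in ki.
    have -> : a k - b k = 0 by apply/eqP; apply: contraLR lt => /imin; rewrite -leqNgt.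
    by rewrite rmorph0 mul0r oppr0; exact: val_ge0.
  rewrite -mulNr -rmorphN -[_ + 1]add0r; apply: val_geM; first exact/val_ge_v/v_cst.
  apply/val_geP; first by have [] := Dc k (ltn_ord k).
  by rewrite lezD1; exact: increasing_lt ic _ _ gt (ltn_ord k).
have d0 : cst d != 0 by rewrite fmorph_eq0.
move/val_geP => /(_ (mulf_neq0 d0 ci0)); rewrite ordM // ord_cst // add0r.
by rewrite lezD1 ltxx.
Qed.

Hypothesis hX : elliptic X.

(** This is the bound expressed by the genus.  For deg D > 0 it makes l(D)
    nonzero, so that l(D) is a genuine dimension and not the value 0 that stands
    for an infinite one. *)
Lemma riemann_inequality D (d : nat) : (0 < d)%N -> d%:Z <= degree_div D ->
  exists2 e, (d <= e)%N & (H0 D #<= `I_(q ^ e)%N)%card /\ (`I_(q ^ e)%N #<= H0 D)%card.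
Proof.
move=> d0 dD; have [[le1 _] _] := hX; have := le1 D.
rewrite gerDr subr_le0 => Dl; exists (ell D); first by rewrite -lez_nat; exact: le_trans dD Dl.
have e0 : ell D <> 0%N.
  move=> e0; move: (le_trans dD Dl); rewrite e0 lez_nat leqn0 => /eqP dd.
  by rewrite dd in d0.
apply: (@has_dim_card F K cst (H0 D)).
  by move: e0; rewrite /ell /dim_over; case: xgetP.
by move=> c e De; rewrite /lincomb; apply: H0_sum => i _; exact: H0Z.
Qed.

Lemma rational_point : exists z : point, degree_pt z = 1%N.
Proof. by case: hX. Qed.

Lemma H0_finite D : exists e, (H0 D #<= `I_(q ^ e)%N)%card.
Proof.
have [z z1] := rational_point; pose k := (`|degree_div D| + 1)%N.
have [||e _ [he _]] := @riemann_inequality (dadd D (dscale k (dpoint z))) 1 => //.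
  rewrite degree_dadd degree_dscale degree_dpoint z1 mulr1 /k; lia.
exists e; apply: card_le_trans he; apply/subset_card_le/H0_sub => y /=.
by rewrite lerDl mulr_ge0.
Qed.

(** If deg E < 0, multiplication by the powers f ^ e would embed the spaces
    H0 (z - e E), whose sizes are unbounded, in the fixed finite space H0 z. *)
Lemma degree_ge0_of_section E f : f != 0 -> H0 E f -> 0 <= degree_div E.
Proof.
move=> f0 Ef; rewrite leNgt; apply/negP => E0.
have [z z1] := rational_point; have [e he] := H0_finite (dpoint z).
pose G := dadd (dpoint z) (dscale (- e%:Z) E).
have [|e' ee' [_ lo]] := @riemann_inequality G e.+1 isT.
  rewrite degree_dadd degree_dscale degree_dpoint z1 -addn1 PoszD addrC lerD2l.
  by rewrite mulNr -mulrN ler_peMr // -gtz0_ge1 oppr_gt0.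
have fe : H0 (dscale e E) (f ^+ e).
  apply/H0P => [|y /=]; first by rewrite expf_neq0.
  by rewrite ordX // [leRHS]mulrC -mulrN ler_wpM2l //; exact: ((H0P _ f0).1 Ef).
have hi : (H0 G #<= `I_(q ^ e)%N)%card.
  apply: (H0_mul_inj (f := f ^+ e) _ fe); first by rewrite expf_neq0.
  rewrite (@H0_eq _ _ _ (dpoint z)) // => y /=.
  by rewrite mulNr addrCA subrr addr0.
by have := card_bounds lo hi; rewrite leq_exp2l ?card_F_gt1 // leqNgt ee'.
Qed.

(** The divisor of zeros of f as a section of O(E) is the largest sum of points
    that can be subtracted from E; the degree of E bounds its length. *)
Lemma section_divisor E f : f != 0 -> H0 E f ->
  exists l, H0 (dadd E (dscale (-1) (dpoints l))) f /\
   forall y, ord y f = - (E y - dpoints l y).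
Proof.
move=> f0 Ef; pose Q n := `[< exists2 l, size l = n & H0 (dadd E (dscale (-1) (dpoints l))) f >].
have exQ : exists n, Q n.
  exists 0%N; apply/asboolP; exists [::] => //; rewrite (@H0_eq _ _ _ E) // => y /=.
  by rewrite mulr0 addr0.
have [n nE] : exists n : nat, n%:Z = degree_div E.
  by exists `|degree_div E|%N; rewrite gez0_abs //; exact: degree_ge0_of_section Ef.
have Qle m : Q m -> (m <= n)%N.
  move=> /asboolP[l <- /(degree_ge0_of_section f0)].
  rewrite degree_dadd degree_dscale mulN1r subr_ge0 degree_dpoints -nE lez_nat.
  exact/leq_trans/size_degree_dpoints.
case: (ex_maxnP exQ Qle) => m /asboolP[l lm lf] mmax; exists l; split=> // y.
apply/le_anti; have /= := (H0P _ f0).1 lf y; rewrite mulN1r => ->; rewrite andbT leNgt.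
apply/negP => lt; suff : Q m.+1 by move/mmax; rewrite ltnn.
apply/asboolP; exists (y :: l); first by rewrite /= lm.
apply/(H0P _ f0) => z; have /= := (H0P _ f0).1 lf z.
case: (eqVneq z y) => [->|_]; first by move: lt; lia.
by rewrite add0r.
Qed.

Lemma finite_ord_support E f : f != 0 -> H0 E f -> finite_set [set y | ord y f != 0].
Proof.
move=> f0 /(section_divisor f0)[l [_ lE]].
have -> : [set y | ord y f != 0] = [set y | dadd E (dscale (-1) (dpoints l)) y != 0].
  by apply/seteqP; split=> y /=; rewrite lE mulN1r oppr_eq0.
exact: dcoef_fin.
Qed.

(** The divisor that attains the genus: it has finitely many sections, so l(D)
    does count them. *)
Lemma exact_divisor : exists D (a : nat), degree_div D = a /\ (H0 D #<= `I_(q ^ a)%N)%card.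
Proof.
have [[_ [D DE]] _] := hX; exists D, (ell D).
have dE : degree_div D = ell D.
  by move/eqP: DE; rewrite -subr_eq0 addrK subr_eq0 => /eqP.
split=> //; have [e he] := H0_finite D.
have [d hd] : exists d, has_dim cst (H0 D) d.
  apply: (@bounded_has_dim F K cst (H0 D) e.+1); [exact: H0D|exact: H0Z|].
  move=> b Db; apply: contrapT => nd.
  have : (`I_(q ^ e.+1)%N #<= H0 D)%card.
    have <- : #|{: {ffun 'I_e.+1 -> F}}| = (q ^ e.+1)%N by rewrite card_ffun card_ord.
    apply: (@card_ge_fin _ _ _ (lincomb cst b)); last first.
      by move=> c; apply: H0_sum => i _; exact: H0Z.
    move=> c c' cc'; apply: contrapT => ne; apply: nd; exists [ffun i => c i - c' i].
      apply/eqP => /ffunP z; apply: ne; apply/ffunP => i; apply/eqP.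
      by rewrite -subr_eq0; have := z i; rewrite !ffunE => ->.
    by rewrite -lincombB cc' subrr.
  by move=> /card_bounds/(_ he); rewrite leq_exp2l ?card_F_gt1 // ltnn.
have := xgetPex 0%N (ex_intro _ d hd); rewrite -/(dim_over cst (H0 D)) -/(ell D).
move=> /has_dim_card[] //; by move=> c b Db; apply: H0_sum => i _; exact: H0Z.
Qed.

(** For k large, k D - D1 has a section f, where D1 attains the genus; dividing
    by f embeds H0 (k D) in H0 (D1 + Z) with Z the effective divisor of zeros of
    f, and the degree of Z is that of k D - D1. *)
Lemma H0_multiple_bound D : 0 < degree_div D -> exists k, [/\ (0 < k)%N &
  (H0 (dscale k%:Z D) #<= `I_(q ^ (k * `|degree_div D|))%N)%card].
Proof.
move=> D0; have [D1 [a [D1a hi]]] := exact_divisor; exists a.+1; split=> //.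
pose E := dadd (dscale a.+1 D) (dscale (-1) D1).
have dE : degree_div E = a.+1%:Z * degree_div D - a%:Z.
  by rewrite degree_dadd !degree_dscale D1a mulN1r.
have [|e e1 [_ lo]] := @riemann_inequality E 1 isT.
  by rewrite dE; nia.
have [f f0 Ef] : exists2 f, f != 0 & H0 E f.
  apply: contrapT => no; suff : (H0 E #<= `I_1)%card.
    move=> /(card_bounds lo); rewrite -(expn0 q) leq_exp2l ?card_F_gt1 // leqNgt.
    by rewrite e1.
  apply: (@card_le_inj _ _ _ _ (fun=> 0%N)) => // g h Eg Eh _.
  have z k : H0 E k -> k = 0.
    by move=> Ek; apply/eqP; apply: contrapT => /negP k0; apply: no; exists k.
  by rewrite (z _ Eg) (z _ Eh).
have [l [lf lE]] := section_divisor f0 Ef.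
have := degree_ge0_of_section f0 lf.
rewrite degree_dadd degree_dscale mulN1r subr_ge0 degree_dpoints => lE'.
have {}hi := H0_steps l hi.
have {}hi : (H0 (dadd D1 (dpoints l)) #<= `I_(q ^ (a.+1 * `|degree_div D|))%N)%card.
  apply: card_le_trans hi _; rewrite card_le_II leq_exp2l ?card_F_gt1 //.
  by rewrite -lez_nat PoszD PoszM gtz0_abs //; rewrite dE in lE'; lia.
have f0V : f^-1 != 0 by rewrite invr_eq0.
pose G := dscale (-1) (dadd E (dscale (-1) (dpoints l))).
have Gf : H0 G f^-1.
  by apply/(H0P _ f0V) => y; rewrite ordV // lE /= !mulN1r !opprK.
apply: (H0_mul_inj f0V Gf); rewrite (@H0_eq _ _ _ (dadd D1 (dpoints l))) // => y /=.
by ring.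
Qed.


(** The functions of more than the least order at a point of degree one make up
    at least a fraction 1 / q of all sections. *)
Lemma increasing_exists z r D : degree_pt z = 1%N -> (`I_(q ^ r)%N #<= H0 D)%card ->
  exists c, increasing z D r c.
Proof.
move=> z1; elim: r D => [|r IH] D lo; first by exists (fun=> 0).
have [g [g0 Dg]] : exists g, g != 0 /\ H0 D g.
  apply: contrapT => no; have : (H0 D #<= `I_1)%card.
    apply: (@card_le_inj _ _ _ _ (fun=> 0%N)) => // g h Eg Eh _.
    have zr k : H0 D k -> k = 0.
      by move=> Ek; apply/eqP; apply: contrapT => /negP k0; apply: no; exists k.
    by rewrite (zr _ Eg) (zr _ Eh).
  by move/(card_bounds lo); rewrite -(expn0 q) leq_exp2l ?card_F_gt1.
have exn : exists n : nat, `[< exists g, [/\ g != 0, H0 D g & ord z g + D z = n] >].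
  exists `|(ord z g + D z)%R|%N; apply/asboolP; exists g; split=> //.
  by rewrite gez0_abs //; have := (H0P _ g0).1 Dg z; lia.
case: (ex_minnP exn) => n /asboolP[f [f0 Df fn]] nmin.
have fmin h : h != 0 -> H0 D h -> ord z f <= ord z h.
  move=> h0 Dh; have hz := (H0P _ h0).1 Dh z.
  suff : (n <= `|(ord z h + D z)%R|)%N by move: fn hz; lia.
  by apply: nmin; apply/asboolP; exists h; split=> //; move: hz; lia.
pose D' := dadd D (dscale (- ord z f - 1 - D z) (dpoint z)).
have D'z : D' z = - ord z f - 1 by rewrite /= eqxx mulr1; ring.
have D'D : H0 D' `<=` H0 D.
  apply: H0_sub => y /=; case: eqVneq => [->|_]; last by rewrite mulr0 addr0.
  by rewrite mulr1; have := (H0P _ f0).1 Df z; lia.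
have DD' : H0 D `<=` H0 (dadd D' (dpoint z)).
  move=> h Dh; have [->|h0] := eqVneq h 0; first exact: H0_0.
  apply/(H0P _ h0) => y; have := (H0P _ h0).1 Dh y; rewrite /=.
  by case: eqVneq => [->|_]; [have := fmin h h0 Dh; lia | lia].
have [c [Dc cc]] : exists c, increasing z D' r c.
  apply: IH; have [e he] := H0_finite D'.
  have /finite_setP[n' /card_eqPle[hi lo']] : finite_set (H0 D').
    exact: card_le_finite he (finite_II _).
  apply: card_le_trans lo'; rewrite card_le_II.
  have := H0_step z hi; rewrite z1 expn1 => hi'.
  have := card_bounds lo (card_le_trans (subset_card_le DD') hi').
  by rewrite expnSr leq_pmul2r // ltnW // card_F_gt1.
exists (fun i => if i is i'.+1 then c i' else f); split=> [[|i] ir|[|i] ir] //.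
- by have [Dci ci0] := Dc i ir; split=> //; exact: D'D.
- have [Dci ci0] := Dc 0%N ir; have := (H0P _ ci0).1 Dci z; rewrite D'z; lia.
- exact: cc.
Qed.

(** The products are c_0 c'_0, ..., c_0 c'_b, c_1 c'_b, ..., c_a c'_b. *)
Lemma increasing_mul y D E a b c c' : increasing y D a.+1 c -> increasing y E b.+1 c' ->
  exists c'', increasing y (dadd D E) (a + b).+1 c''.
Proof.
move=> [Dc cc] [Ec' cc'].
exists (fun i => if (i <= b)%N then c 0%N * c' i else c (i - b)%N * c' b).
have nz i : (i <= a)%N -> H0 D (c i) /\ c i != 0 by move=> ia; exact: Dc.
have nz' i : (i <= b)%N -> H0 E (c' i) /\ c' i != 0 by move=> ib; exact: Ec'.
split=> [i ir|i ir].
  case: leqP => ib.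
    have [[Dc0 c0] [Ei ci]] := (nz 0%N (leq0n _), nz' i ib).
    by split; [exact: H0M | exact: mulf_neq0].
  have ia : (i - b <= a)%N by move: ir; rewrite ltnS => ir; lia.
  have [[Dc0 c0] [Ei ci]] := (nz _ ia, nz' b (leqnn _)).
  by split; [exact: H0M | exact: mulf_neq0].
have [_ c00] := nz 0%N (leq0n _); have [_ cb0] := nz' b (leqnn _).
case: (ltngtP i b) => ib.
- have [_ ci] := nz' i (ltnW ib); have [_ ci1] := nz' i.+1 ib.
  by rewrite !ordM // ltrD2l; exact: cc'.
- have ia1 : (i.+1 - b <= a)%N by lia.
  have ia : (i - b <= a)%N by lia.
  have [_ ci] := nz _ ia; have [_ ci1] := nz _ ia1.
  by rewrite !ordM // ltrD2r subSn ?(ltnW ib) //; apply: cc; lia.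
- have ia : (1 <= a)%N by lia.
  rewrite ib subSnn; have [_ c1] := nz _ ia.
  by rewrite !ordM // ltrD2r; apply: cc; lia.
Qed.

Lemma increasing_power y D a c k : increasing y D a.+1 c ->
  exists c', increasing y (dscale k%:Z D) (k * a).+1 c'.
Proof.
move=> ic; elim: k => [|k [c' IH]].
  exists (fun=> 1); split=> // i _; split; last exact: oner_neq0.
  by apply/H0P => [|z]; rewrite ?oner_eq0 // ord_one /= mul0r.
have [c'' ic''] := increasing_mul ic IH; exists c''; rewrite mulSn.
case: ic'' => h1 h2; split=> // i /h1[Di ci]; split=> //.
by rewrite (@H0_eq _ _ _ (dadd D (dscale k D))) // => z /=; rewrite -add1n PoszD mulrDl mul1r.
Qed.

(** More than q ^ d sections would include d + 1 of increasing orders at a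
    rational point, and the products of k of them would be k d + 1 sections of
    k D of increasing orders. *)
Lemma H0_card D (d : nat) : (0 < d)%N -> degree_div D = d ->
  (H0 D #<= `I_(q ^ d)%N)%card /\ (`I_(q ^ d)%N #<= H0 D)%card.
Proof.
move=> d0 dD; have [|e de [hi lo]] := @riemann_inequality D d d0; first by rewrite dD.
suff ed : (e <= d)%N by have eqd : e = d by [apply/anti_leq; rewrite ed de]; rewrite -eqd.
rewrite leqNgt; apply/negP => lt.
have [z z1] := rational_point.
have [|c ic] := @increasing_exists z d.+1 D z1.
  by apply: card_le_trans lo; rewrite card_le_II leq_exp2l ?card_F_gt1.
have [|k [k0 hik]] := @H0_multiple_bound D; first by rewrite dD.
have [c' ic'] := increasing_power k ic.
have := card_bounds (increasing_card ic') hik.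
by rewrite dD leq_exp2l ?card_F_gt1 //= ltnn.
Qed.

Lemma H0_eval_surj D y u : (degree_pt y)%:Z < degree_div D -> u != 0 -> ord y u = - D y ->
  forall r, exists2 f, H0 D f & value_at y (f / u) = r.
Proof.
move=> yD u0 ou; pose d := `|(degree_div D - (degree_pt y)%:Z)%R|%N.
have dE : d%:Z = degree_div D - (degree_pt y)%:Z by rewrite /d; lia.
have d0 : (0 < d)%N by move: yD dE; lia.
have [|_ lo] := @H0_card D (d + degree_pt y)%N (leq_trans d0 (leq_addr _ _)).
  by rewrite PoszD dE subrK.
have [|hi _] := @H0_card (dadd D (dscale (-1) (dpoint y))) d d0.
  by rewrite degree_dadd degree_dscale degree_dpoint mulN1r.
exact: value_at_surj_of_card lo hi.
Qed.

(** A quotient of sections of two multiples of y, neither of which vanishes in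
    the fibre at y: global sections have finitely many zeros and poles. *)
Lemma prescribed_order y (k : int) :
  exists f, [/\ f != 0, ord y f = k & finite_set [set z | ord z f != 0]].
Proof.
have neg (n : nat) : (1 < n)%N ->
    exists f, [/\ f != 0, ord y f = - n%:Z & finite_set [set z | ord z f != 0]].
  move=> n1; pose D := dscale n (dpoint y).
  have Dy : D y = n by rewrite /= eqxx mulr1.
  pose u := unif y ^ (- n%:Z); have u0 : u != 0 by exact: texpz_neq0.
  have ou : ord y u = - n%:Z by rewrite ord_expz ?unif_neq0 // ord_unif mul1r.
  have [||f Df fu] := @H0_eval_surj D y u _ u0 _ 1.
  - by rewrite degree_dscale degree_dpoint; have := degree_pt_gt0 y; nia.
  - by rewrite ou Dy.
  have f0 : f != 0.
    apply/eqP => fz; move/eqP: fu; rewrite fz mul0r.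
    by rewrite ((value_at_eq0 (v0 y)).2 (maximal0 y)) eq_sym oner_eq0.
  exists f; split=> //; last exact: finite_ord_support Df.
  have fu0 : f / u != 0 by rewrite mulf_neq0 ?invr_eq0.
  have yfu : y (f / u).
    apply/(v_ord y fu0); rewrite ordM ?invr_eq0 // ordV // ou -Dy.
    by have := (H0P _ f0).1 Df y; lia.
  have : ~ maximal_set y (f / u).
    by move=> /(value_at_eq0 yfu); rewrite fu => /eqP; rewrite oner_eq0.
  rewrite maximal_ord // => /negP; rewrite -leNgt.
  move/(v_ord y fu0): yfu; rewrite ordM ?invr_eq0 // ordV // ou; lia.
have [|f [f0 fo ff]] := neg (2 + `|k|)%N; first lia.
have [|g [g0 go gf]] := neg `|(2 + `|k|%N%:Z + k)%R|%N; first lia.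
exists (f / g); split; first by rewrite mulf_neq0 ?invr_eq0.
  by rewrite ordM ?invr_eq0 // ordV // fo go; lia.
apply: (@sub_finite_set _ _ ([set z | ord z f != 0] `|` [set z | ord z g != 0])).
  move=> z nz; have [fz|] := eqVneq (ord z f) 0; last by left.
  right; apply/eqP => gz; move/eqP: nz; apply.
  by rewrite ordM ?invr_eq0 // ordV // fz gz oppr0 addr0.
by rewrite finite_setU.
Qed.

End RiemannRoch.

(** * Homomorphisms of sheaves *)

Definition linear_pack (R : pzRingType) (U V : lmodType R) (f : U -> V) (h : linear f) :
  {linear U -> V} := HB.pack f (GRing.isLinear.Build R U V _ f h).

Section Sheaves.
Variables (F : finFieldType) (X : curve F).
Local Notation K := (funfield X).
Local Notation cst := (Defs.cst X).
Local Notation point := (closed_point X).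
Implicit Types (M N : modsheaf X) (U V W : open_set X) (D E : divisor X).

Lemma osub_trans U V W : osub V U -> osub W V -> osub W U.
Proof. by move=> VU WV z /WV /VU. Qed.

Lemma res_res M U V W (h : osub V U) (k : osub W V) (s : M U) :
  res k (res h s) = res (osub_trans h k) s.
Proof. exact: res_comp. Qed.

Lemma res_pi M U V (h k : osub V U) (s : M U) : res h s = res k s.
Proof. by rewrite (Prop_irrelevance h k). Qed.

(** Separation is the uniqueness part of the gluing axiom. *)
Lemma sections_ext M U (C : open_cover U) (s t : M U) :
  (forall i, res (@csub _ _ _ C i) s = res (@csub _ _ _ C i) t) -> s = t.
Proof.
move=> st; have [|u [_ uU]] := @res_glue _ _ M U C (fun i => res (@csub _ _ _ C i) s).
  by move=> i j; rewrite !res_res; exact: res_pi.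
by rewrite -(uU s) // -(uU t) // => i; rewrite st.
Qed.

Definition sheaf_comp M N P (g : sheaf_hom N P) (f : sheaf_hom M N) : sheaf_hom M P.
Proof.
refine (@SheafHom _ _ M P (fun U => g U \o f U : {linear M U -> P U}) _).
by move=> U V h s /=; rewrite !hnat.
Defined.

Lemma sheaf_iso_trans M N P : sheaf_iso M N -> sheaf_iso N P -> sheaf_iso M P.
Proof.
move=> [f fb] [g gb]; exists (sheaf_comp g f) => U; exact: (bij_comp (gb U) (fb U)).
Qed.

Lemma sheaf_iso_inverse M N : sheaf_iso M N -> exists f : sheaf_hom M N, exists g : sheaf_hom N M,
  (forall U, cancel (f U) (g U)) /\ (forall U, cancel (g U) (f U)).
Proof.
move=> [f fb]; exists f.
have ex U : exists g : N U -> M U, cancel (f U) g /\ cancel g (f U).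
  by have [g] := fb U; exists g.
pose g U := sval (cid (ex U)); have gP U := svalP (cid (ex U)).
have glin U : linear (g U).
  move=> a s t; have [fK gK] := gP U; apply: (can_inj fK).
  by rewrite linearP !gK.
unshelve eexists.
  apply: (@SheafHom _ _ N M (fun U => linear_pack (glin U))) => U V h s /=.
  have [fK gK] := gP V; apply: (can_inj fK); rewrite gK hnat.
  by have [_ ->] := gP U.
split=> U; [exact: (gP U).1 | exact: (gP U).2].
Qed.

Lemma sheaf_iso_sym M N : sheaf_iso M N -> sheaf_iso N M.
Proof.
by move=> /sheaf_iso_inverse[f [g [fK gK]]]; exists g => U; exists (f U); [exact: gK | exact: fK].
Qed.

Lemma isoclass_eq M N : sheaf_iso M N -> isoclass M = isoclass N.
Proof.
move=> MN; apply/funext => P; apply/propext; split=> h.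
  exact: sheaf_iso_trans (sheaf_iso_sym MN) h.
exact: sheaf_iso_trans MN h.
Qed.

Lemma dsum_iso n (M N : 'I_n -> modsheaf X) : (forall i, sheaf_iso (M i) (N i)) ->
  sheaf_iso (dsum M) (dsum N).
Proof.
move=> MN; pose f i := sval (cid (MN i)); have fb i := svalP (cid (MN i)).
have flin U : linear (fun s : dsum M U => (fun i => f i U (s i)) : dsum N U).
  by move=> a s t; apply: functional_extensionality_dep => i; exact: linearP.
unshelve eexists.
  apply: (@SheafHom _ _ (dsum M) (dsum N) (fun U => linear_pack (flin U))) => U V h s.
  by apply: functional_extensionality_dep => i; exact: hnat.
move=> U; have ex i : exists g : N i U -> M i U, cancel (f i U) g /\ cancel g (f i U).
  by have [g] := fb i U; exists g.
exists (fun t i => sval (cid (ex i)) (t i)) => s; apply: functional_extensionality_dep => i /=.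
  by case: (cid (ex i)) => g [].
by case: (cid (ex i)) => g [].
Qed.

(** * The sheaves O(D) *)

Definition Oval D U (s : OXD D U) : K := val s.
Definition Osec D U f (h : OXD_set D U f) : OXD D U := mksm (S := OXD_sec D U) h.

Lemma OvalP D U (s : OXD D U) : OXD_set D U (Oval s).
Proof. exact: (@smtypeP _ _ (OXD_sec D U) s). Qed.
Lemma OsecK D U f (h : OXD_set D U f) : Oval (Osec h) = f.
Proof. by []. Qed.
Lemma Oval_res D U V (h : osub V U) (s : OXD D U) : Oval (res h s) = Oval s.
Proof. by []. Qed.
Lemma OvalD D U (s t : OXD D U) : Oval (s + t) = Oval s + Oval t.
Proof. by []. Qed.
Lemma OvalZ D U a (s : OXD D U) : Oval (a *: s) = val a * Oval s.
Proof. by []. Qed.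
Lemma Oval0 D U : Oval (0 : OXD D U) = 0.
Proof. by []. Qed.
Lemma Oval_sum D U I (r : seq I) (P : pred I) (f : I -> OXD D U) :
  Oval (\sum_(i <- r | P i) f i) = \sum_(i <- r | P i) Oval (f i).
Proof. exact: (big_morph (@Oval D U) (@OvalD D U) (@Oval0 D U)). Qed.
Definition Oreg U f (h : regular_on U f) : OX U := mksr (S := OX_set U) h.

(** The sections of O(D) over V are then the multiples of u by the functions
    regular on V. *)
Definition generates D V u := u != 0 /\ forall z, V z -> ord z u = - D z.

Lemma generates_sec D V u : generates D V u -> OXD_set D V u.
Proof. by move=> [u0 ou] z Vz; apply/(val_geP _ _ u0); rewrite ou. Qed.

Lemma generates_sub D U V u : osub U V -> generates D V u -> generates D U u.
Proof. by move=> UV [u0 ou]; split=> // z /UV; exact: ou. Qed.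

Lemma generatesM D E V u w : generates D V u -> generates E V w ->
  generates (dadd D E) V (u * w).
Proof.
move=> [u0 ou] [w0 ow]; split; first exact: mulf_neq0.
by move=> z Vz; rewrite ordM // ou // ow //= opprD.
Qed.

Lemma val_ge_div (z : point) u f : u != 0 -> val_ge z (ord z u) f <-> z (f / u).
Proof.
move=> u0; have [->|f0] := eqVneq f 0.
  by rewrite mul0r; split=> _; [exact: v0|exact: val_ge0].
have q0 : f / u != 0 by rewrite mulf_neq0 ?invr_eq0.
by rewrite (val_geP _ _ f0) (v_ord _ q0) ordM ?invr_eq0 // ordV // subr_ge0.
Qed.

Lemma generates_point D (z : point) V u f : generates D V u -> V z ->
  val_ge z (- D z) f <-> z (f / u).
Proof. by move=> [u0 ou] Vz; rewrite -ou //; exact: val_ge_div. Qed.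

Lemma generates_reg D V u f : generates D V u -> OXD_set D V f <-> regular_on V (f / u).
Proof.
by move=> gu; split=> h z Vz; [apply/(generates_point f gu Vz)/h|apply/(generates_point f gu Vz)/h].
Qed.

Hypothesis hX : elliptic X.

Lemma local_generator D (y : point) : exists V u, V y /\ generates D V u.
Proof.
have [u [u0 uy uf]] := prescribed_order hX y (- D y).
have fin : finite_set [set z | ~ (z = y \/ ord z u = 0 /\ D z = 0)].
  apply: (@sub_finite_set _ _ ([set z | ord z u != 0] `|` [set z | D z != 0])).
    move=> z /= /not_orP[_ /not_andP[/eqP|/eqP]]; first by left.
    by right.
  by rewrite finite_setU; split=> //; exact: dcoef_fin.
exists (OpenSet fin), u; split; first by left.
by split=> // z [->|[-> ->]] //; rewrite oppr0.
Qed.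

Lemma Osec_eq D U (s t : OXD D U) : Oval s = Oval t -> s = t.
Proof. exact: val_inj. Qed.

(** Every section is locally a fraction of a generator u, so the homomorphism is
    multiplication by the ratio of the image of u to u.  The bound on the poles
    of that ratio is seen on the local generators at each point. *)
Lemma hom_OXD D E (f : sheaf_hom (OXD D) (OXD E)) :
  exists g, (forall U s, Oval (f U s) = g * Oval s) /\ H0 (dadd E (dscale (-1) D)) g.
Proof.
have [z0 _] := rational_point hX; have [V [u [_ gu]]] := local_generator D z0.
have [u0 ou] := gu; pose g := Oval (f V (Osec (generates_sec gu))) / u.
have fE U s : Oval (f U s) = g * Oval s.
  pose W := openI U V; have r : regular_on W (Oval s / u).
    apply/(generates_reg _ (generates_sub (@openIr _ _ U V) gu)) => z [Uz _].
    exact: OvalP.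
  rewrite -(Oval_res (@openIl _ _ U V)) -hnat.
  have -> : res (@openIl _ _ U V) s =
      Oreg r *: res (@openIr _ _ U V) (Osec (generates_sec gu)).
    by apply: Osec_eq; rewrite OvalZ !Oval_res OsecK /= divfK.
  by rewrite linearZ OvalZ hnat Oval_res /= /g; field.
exists g; split=> // y _.
have [V' [w [Vy gw]]] := local_generator D y; have [w0 ow] := gw.
have := @OvalP _ _ (f V' (Osec (generates_sec gw))) y Vy.
rewrite fE OsecK; have [->|g0] := eqVneq g 0; first by move=> _; exact: val_ge0.
move/(val_geP _ _ (mulf_neq0 g0 w0)); rewrite ordM // ow // => h.
by apply/(val_geP _ _ g0) => /=; lia.
Qed.

Lemma hom_OXD_eq0 D E (f : sheaf_hom (OXD D) (OXD E)) : degree_div E < degree_div D ->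
  forall U s, f U s = 0.
Proof.
move=> ED U s; have [g [fE gH]] := hom_OXD f; apply: Osec_eq; rewrite fE.
have [->|g0] := eqVneq g 0; first by rewrite mul0r.
have := degree_ge0_of_section hX g0 gH.
by rewrite degree_dadd degree_dscale mulN1r subr_ge0 leNgt ED.
Qed.
End Sheaves.

(** * Line bundles come from divisors *)

Lemma bijective_of (S T : Type) (f : S -> T) :
  injective f -> (forall t, exists s, f s = t) -> bijective f.
Proof.
move=> fI fS; pose g t := sval (cid (fS t)); have gK t : f (g t) = t := svalP (cid (fS t)).
by exists g => // s; apply: fI; rewrite gK.
Qed.

Section LineBundles.
Variables (F : finFieldType) (X : curve F).
Local Notation K := (funfield X).
Local Notation point := (closed_point X).
Implicit Types (M N : modsheaf X) (U V W : open_set X) (D E : divisor X).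

Hypothesis hX : elliptic X.

Definition base_point : point := sval (cid (rational_point hX)).

Definition trace_cover U (V : point -> open_set X) (Vy : forall y, V y y) : open_cover U :=
  Cover base_point (fun y => @openIl _ _ U (V y)) (fun z Uz => ex_intro _ z (conj Uz (Vy z))).

Definition frame (L : modsheaf X) U (e : L U) := forall V (h : osub V U) (s : L V),
  exists! a : OX V, s = a *: res h e.

Lemma line_bundle_frame L : line_bundle L ->
  forall y : point, exists U, U y /\ exists e : L U, frame e.
Proof.
move=> lb y; have [U [Uy [e eP]]] := lb y; exists U; split=> //; exists (e ord0).
move=> V h s; have [a [sa aU]] := eP V h s; exists (a ord0); split.
  by rewrite sa big_ord1.
move=> b sb; rewrite (aU [ffun=> b]) ?ffunE //.
by rewrite big_ord1 ffunE.
Qed.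

Section Coordinate.
Variables (L : modsheaf X) (U_ : point -> open_set X) (e_ : forall y, L (U_ y)).
Hypotheses (Uy : forall y, U_ y y) (eP : forall y, frame (e_ y)).
Local Notation U0 := (U_ base_point).
Local Notation e0 := (e_ base_point).

(** The coordinate in the frame at the base point, which is defined near that
    point only but is a rational function; through it L becomes a subsheaf of
    the constant sheaf K. *)
Definition coord U (s : L U) : K :=
  val (sval (cid (eP (@openIr _ _ U U0) (res (@openIl _ _ U U0) s)))).

Lemma coordE U W (h : osub W U) (k : osub W U0) (s : L U) (a : OX W) :
  res h s = a *: res k e0 -> val a = coord s.
Proof.
rewrite /coord; case: cid => b /= [sb _] sa.
pose j : osub W (openI U U0) := fun z Wz => conj (h z Wz) (k z Wz).
have [c [_ cU]] := eP k (res h s).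
rewrite -(cU a sa) (cU (OX_res j b)) //.
have := congr1 (fun r => res j r) sb; rewrite res_scale !res_res.
by rewrite (res_pi (osub_trans _ j) h) (res_pi (osub_trans _ j) k).
Qed.

Lemma coord_local U (s : L U) : exists W (h : osub W U) (k : osub W U0) (a : OX W),
  res h s = a *: res k e0 /\ val a = coord s.
Proof.
have [a [sa _]] := eP (@openIr _ _ U U0) (res (@openIl _ _ U U0) s).
by exists (openI U U0), (@openIl _ _ U U0), (@openIr _ _ U U0), a; split=> //; exact: coordE sa.
Qed.

Lemma coord_res U V (h : osub V U) (s : L U) : coord (res h s) = coord s.
Proof.
have [W [k [l [a [sa <-]]]]] := coord_local (res h s).
by apply: (coordE (h := osub_trans h k) (k := l)); rewrite -res_res.
Qed.

Lemma coord_linear U (a : OX U) (s t : L U) : coord (a *: s + t) = val a * coord s + coord t.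
Proof.
have [b [sb _]] := eP (@openIr _ _ U U0) (res (@openIl _ _ U U0) s).
have [c [tc _]] := eP (@openIr _ _ U U0) (res (@openIl _ _ U U0) t).
rewrite -(coordE sb) -(coordE tc); apply/esym.
rewrite -[LHS]/(val (OX_res (@openIl _ _ U U0) a * b + c)).
apply: (coordE (h := @openIl _ _ U U0) (k := @openIr _ _ U U0)).
by rewrite res_add res_scale sb tc scalerDl scalerA.
Qed.

Lemma coordZ U (a : OX U) (s : L U) : coord (a *: s) = val a * coord s.
Proof.
have z : coord (0 : L U) = 0.
  have := coord_linear 1 (0 : L U) 0; rewrite scaler0 addr0 mul1r => /eqP.
  by rewrite eq_sym -subr_eq0 addrK => /eqP.
by have := coord_linear a s 0; rewrite addr0 z addr0.
Qed.

Definition transition y := coord (e_ y).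

Lemma transition_neq0 y : transition y != 0.
Proof.
apply/eqP => g0; have [W [h [k [a [ea va]]]]] := coord_local (e_ y).
have a0 : a = 0 by apply: val_inj; rewrite va -[RHS]g0.
rewrite a0 scale0r in ea; have [b [_ bU]] := eP h (res h (e_ y)).
have b0 : b = 0 by apply: bU; rewrite ea scaler0.
have b1 : b = 1 by apply: bU; rewrite scale1r.
by have /eqP := oner_neq0 (OX W); rewrite -b1 b0.
Qed.

Lemma coord_frame U y (s : L U) V (h : osub V U) (k : osub V (U_ y)) (a : OX V) :
  res h s = a *: res k (e_ y) -> coord s = val a * transition y.
Proof. by move=> sa; rewrite -(coord_res h) sa coordZ coord_res. Qed.

Lemma coord_inj U : injective (@coord U).
Proof.
move=> s t st; apply: (sections_ext (C := trace_cover U Uy)) => y /=.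
have [a [sa _]] := eP (@openIr _ _ U (U_ y)) (res (@openIl _ _ U (U_ y)) s).
have [b [tb _]] := eP (@openIr _ _ U (U_ y)) (res (@openIl _ _ U (U_ y)) t).
rewrite sa tb; congr (_ *: _); apply/val_inj/(mulIf (transition_neq0 y)).
by rewrite -(coord_frame sa) -(coord_frame tb).
Qed.

Lemma coord_reg U (s : L U) (y : point) : U y -> y (coord s / transition y).
Proof.
move=> Uyy; have [a [sa _]] := eP (@openIr _ _ U (U_ y)) (res (@openIl _ _ U (U_ y)) s).
rewrite (coord_frame sa) mulfK ?transition_neq0 //; apply: OXP.
by split=> //; exact: Uy.
Qed.

(** Near y the section is (f / g_y) e_y, where g_y is the transition function:
    the poles of f / g_y are harmless at the other points z because g_z / g_y is
    regular there. *)
Lemma coord_surj U f : (forall y : point, U y -> y (f / transition y)) ->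
  exists s : L U, coord s = f.
Proof.
move=> fU; have g0 := transition_neq0.
have r y : regular_on (openI U (U_ y)) (f / transition y).
  move=> z [Uz Uyz]; have -> : f / transition y = (f / transition z) * (transition z / transition y).
    by rewrite mulrA divfK.
  apply: vM; first exact: fU.
  have [a [za _]] := eP (@openIr _ _ (U_ z) (U_ y)) (res (@openIl _ _ (U_ z) (U_ y)) (e_ z)).
  by rewrite {1}/transition (coord_frame za) mulfK //; apply: OXP; split.
pose s y : L (openI U (U_ y)) := Oreg (r y) *: res (@openIr _ _ U (U_ y)) (e_ y).
have sf y : coord (s y) = f by rewrite coordZ coord_res /= divfK.
have [|t [tE _]] := @res_glue _ _ L U (trace_cover U Uy) s.
  by move=> i j; apply: coord_inj; rewrite !coord_res /= !sf.
by exists t; rewrite -(sf base_point) -(coord_res (@openIl _ _ U U0)) -[in RHS]tE.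
Qed.

Lemma transition_support : finite_set [set y | ord y (transition y) != 0].
Proof.
apply: sub_finite_set (ocofinite U0) => y /= + U0y; apply/negP; rewrite negbK; apply/eqP.
have g0 := transition_neq0 y; have g00 := transition_neq0 base_point.
have c0 : transition base_point = 1.
  have h : osub U0 U0 by [].
  rewrite -[LHS](@coordE _ U0 h h _ 1) //.
  by rewrite scale1r.
have yg : y (transition y).
  have [a [ya _]] := eP (@openIr _ _ (U_ y) U0) (res (@openIl _ _ (U_ y) U0) (e_ y)).
  by rewrite /transition -(coordE ya); apply: OXP; split=> //; exact: Uy.
have ygV : y (transition y)^-1.
  have [a [ya _]] := eP (@openIr _ _ U0 (U_ y)) (res (@openIl _ _ U0 (U_ y)) e0).
  have := coord_frame ya; rewrite -/(transition base_point) c0 => a1.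
  have -> : (transition y)^-1 = val a by rewrite -[LHS]mul1r a1 mulfK.
  by apply: OXP; split=> //; exact: Uy.
apply/le_anti; rewrite -oppr_ge0 -ordV //; apply/andP; split; last exact/v_ord.
by apply/v_ord; rewrite ?invr_eq0.
Qed.

Lemma coord_iso : exists D, sheaf_iso L (OXD D).
Proof.
have fin : finite_set [set y | - ord y (transition y) != 0].
  apply: sub_finite_set transition_support => y /=; by rewrite oppr_eq0.
pose D := Divisor fin; exists D.
have cD U (s : L U) : OXD_set D U (coord s).
  by move=> y Uyy; rewrite /= opprK; apply/val_ge_div; [exact: transition_neq0|exact: coord_reg].
have lin U : linear (fun s : L U => Osec (cD U s)).
  by move=> a s t; apply: Osec_eq; exact: coord_linear.
unshelve eexists.
  apply: (@SheafHom _ _ L (OXD D) (fun U => linear_pack (lin U))) => U V h s.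
  by apply: Osec_eq; exact: coord_res.
move=> U; apply: bijective_of => [s t /(congr1 (@Oval _ _ D U))|t]; first exact: coord_inj.
have [s st] : exists s : L U, coord s = Oval t.
  apply: coord_surj => y Uyy; apply/(val_ge_div _ _ (transition_neq0 y)).
  by have := @OvalP _ _ _ _ t y Uyy; rewrite /= opprK.
by exists s; apply: Osec_eq.
Qed.
End Coordinate.

(** The coordinate of sections in one frame embeds a line bundle in the rational
    functions; the orders of the transition functions give the divisor. *)
Lemma line_bundle_OXD L : line_bundle L -> exists D, sheaf_iso L (OXD D).
Proof.
move=> /line_bundle_frame fr.
have ex y : exists Ue : {U : open_set X & L U}, projT1 Ue y /\ frame (projT2 Ue).
  by have [U [Uy [e eP]]] := fr y; exists (existT _ U e).
have [g gP] := choice ex.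
exact: (coord_iso (fun y => (gP y).1) (fun y => (gP y).2)).
Qed.

End LineBundles.

(** * Tensor products and direct sums of the O(D) *)

Section Tensor.
Variables (F : finFieldType) (X : curve F).
Local Notation K := (funfield X).
Local Notation point := (closed_point X).
Implicit Types (M N : modsheaf X) (U V W : open_set X) (D E : divisor X).

(** The universal property determines the tensor product up to isomorphism. *)
Lemma tensor_iso M N T (b : bilinear_map M N T) : is_tensor b -> sheaf_iso (tensor M N) T.
Proof.
move=> bT; rewrite /tensor; case: pselect => [e|ne]; last by case: ne; exists T, b.
have [b' b'T] := svalP (cid e); set T' := sval (cid e) in b' b'T *.
have [f fb _] := b'T T b; have [g gb _] := bT T' b'.
have [h _ hU] := b'T T' b'; have [k _ kU] := bT T b.
pose id' P : sheaf_hom P P := SheafHom (M := P) (N := P)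
  (happ := fun U => idfun : {linear P U -> P U}) (fun _ _ _ _ => erefl).
exists f => U; exists (g U) => w.
  transitivity (h U w); first by apply: (hU (sheaf_comp g f)) => V s t /=; rewrite fb gb.
  by symmetry; apply: (hU (id' T')).
transitivity (k U w); first by apply: (kU (sheaf_comp f g)) => V s t /=; rewrite gb fb.
by symmetry; apply: (kU (id' T)).
Qed.

Hypothesis hX : elliptic X.

Section Product.
Variables (L : modsheaf X) (D E : divisor X) (al : sheaf_hom L (OXD D)) (be : sheaf_hom (OXD D) L).
Hypotheses (alK : forall U, cancel (al U) (be U)) (beK : forall U, cancel (be U) (al U)).

Lemma prod_sec U (s : L U) (t : OXD E U) :
  OXD_set (dadd D E) U (Oval (al U s) * Oval t).
Proof. by move=> y Uy; rewrite /= opprD; apply: val_geM; exact: OvalP. Qed.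

Definition prod_app U (s : L U) (t : OXD E U) : OXD (dadd D E) U := Osec (prod_sec s t).

Lemma prod_linl U (t : OXD E U) : linear (fun s : L U => prod_app s t).
Proof.
move=> a s s'; apply: Osec_eq; rewrite OvalD OvalZ !OsecK linearP OvalD OvalZ.
by rewrite mulrDl mulrA.
Qed.

Lemma prod_linr U (s : L U) : linear (fun t : OXD E U => prod_app s t).
Proof.
move=> a t t'; apply: Osec_eq; rewrite OvalD OvalZ !OsecK OvalD OvalZ.
by rewrite mulrDr mulrCA.
Qed.

Lemma prod_nat U V (h : osub V U) (s : L U) (t : OXD E U) :
  prod_app (res h s) (res h t) = res h (prod_app s t).
Proof. by apply: Osec_eq; rewrite Oval_res !OsecK hnat !Oval_res. Qed.

Definition prod_map : bilinear_map L (OXD E) (OXD (dadd D E)) :=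
  BilinearMap prod_linl prod_linr prod_nat.

Section Universal.
Variables (P : modsheaf X) (c : bilinear_map L (OXD E) P).
Variables (V_ : point -> open_set X) (u_ w_ : point -> K).
Hypotheses (Vy : forall y, V_ y y) (gu : forall y, generates D (V_ y) (u_ y))
  (gw : forall y, generates E (V_ y) (w_ y)).

Let us y : L (V_ y) := be (V_ y) (Osec (generates_sec (gu y))).
Let ws y : OXD E (V_ y) := Osec (generates_sec (gw y)).
Let p y : P (V_ y) := c (V_ y) (us y) (ws y).

Lemma bilZl U (a : OX U) (s : L U) (t : OXD E U) : c U (a *: s) t = a *: c U s t.
Proof.
pose f := linear_pack (@blinl _ _ _ _ _ c U t); exact: (linearZZ f a s).
Qed.
Lemma bilZr U (a : OX U) (s : L U) (t : OXD E U) : c U s (a *: t) = a *: c U s t.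
Proof.
pose f := linear_pack (@blinr _ _ _ _ _ c U s); exact: (linearZZ f a t).
Qed.

Lemma quot_reg U y (f : OXD (dadd D E) U) :
  regular_on (openI U (V_ y)) (Oval f / (u_ y * w_ y)).
Proof.
move=> z [Uz Vz]; apply/(generates_point _ (generatesM (gu y) (gw y)) Vz); exact: OvalP.
Qed.

(** Near y, the generators of both factors determine the values of a bilinear
    map, which depend on the product of the arguments only. *)
Lemma bilE y W (k : osub W (V_ y)) (s : L W) (t : OXD E W) (a : OX W) :
  val a = Oval (al W s) * Oval t / (u_ y * w_ y) -> c W s t = a *: res k (p y).
Proof.
have [u0 _] := gu y; have [w0 _] := gw y.
have ru : regular_on W (Oval (al W s) / u_ y).
  by apply/(generates_reg _ (generates_sub k (gu y))); exact: OvalP.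
have rw : regular_on W (Oval t / w_ y).
  by apply/(generates_reg _ (generates_sub k (gw y))); exact: OvalP.
have -> : s = Oreg ru *: res k (us y).
  apply: (can_inj (@alK W)); rewrite linearZ hnat beK.
  by apply: Osec_eq; rewrite OvalZ Oval_res OsecK /= divfK.
have -> : t = Oreg rw *: res k (ws y).
  by apply: Osec_eq; rewrite OvalZ Oval_res OsecK /= divfK.
move=> va; rewrite bilZl bilZr scalerA bnat; congr (_ *: _).
apply: val_inj; rewrite va linearZ hnat beK !OvalZ !Oval_res !OsecK /= !divfK //.
by field; rewrite u0 w0.
Qed.

Definition local_value U (f : OXD (dadd D E) U) y : P (openI U (V_ y)) :=
  Oreg (quot_reg (y := y) f) *: res (@openIr _ _ U (V_ y)) (p y).

(** The local values agree on overlaps by the formula above, applied to the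
    generators at one point seen near the other. *)
Lemma glue_value U (f : OXD (dadd D E) U) : exists t : P U,
  forall y, res (@openIl _ _ U (V_ y)) t = local_value f y.
Proof.
have [|t [tE _]] := @res_glue _ _ P U (trace_cover hX U Vy) (local_value f); last by exists t.
move=> y z; rewrite /local_value !res_scale !res_res.
set W := openI _ _; have k : osub W (V_ y) by move=> v [[]].
have l : osub W (V_ z) by move=> v [_ []].
rewrite (res_pi _ k) (res_pi _ l) /p -bnat.
have [u0 _] := gu y; have [w0 _] := gw y; have [u0' _] := gu z; have [w0' _] := gw z.
have r : regular_on W (u_ y * w_ y / (u_ z * w_ z)).
  apply/(generates_reg _ (generates_sub l (generatesM (gu z) (gw z)))).
  exact: generates_sec (generates_sub k (generatesM (gu y) (gw y))).
rewrite (@bilE z W l _ _ (Oreg r)).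
  rewrite scalerA; congr (_ *: _); apply: val_inj => /=.
  by field; rewrite u0 w0 u0' w0'.
by rewrite hnat beK !Oval_res !OsecK.
Qed.

Let phi U (f : OXD (dadd D E) U) : P U := sval (cid (glue_value f)).

Lemma phiE U (f : OXD (dadd D E) U) y :
  res (@openIl _ _ U (V_ y)) (phi f) = local_value f y.
Proof. exact: svalP (cid (glue_value f)) y. Qed.

Lemma phi_linear U : linear (@phi U).
Proof.
move=> a f g; apply: (sections_ext (C := trace_cover hX U Vy)) => y /=.
rewrite res_add res_scale !phiE /local_value scalerA -scalerDl; congr (_ *: _).
by apply: val_inj => /=; rewrite OvalD OvalZ mulrDl mulrA.
Qed.

Lemma phi_nat U V (h : osub V U) f : phi (res h f) = res h (phi f).
Proof.
apply: (sections_ext (C := trace_cover hX V Vy)) => y /=.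
have k : osub (openI V (V_ y)) (openI U (V_ y)) by move=> z [/h Uz Vz].
rewrite phiE res_res (res_pi _ (osub_trans (@openIl _ _ U (V_ y)) k)) -res_res phiE.
rewrite /local_value res_scale res_res; congr (_ *: _); last exact: res_pi.
exact: val_inj.
Qed.

Lemma product_universal : exists2 f : sheaf_hom (OXD (dadd D E)) P,
  (forall U s t, f U (prod_map U s t) = c U s t) &
  forall g : sheaf_hom (OXD (dadd D E)) P, (forall U s t, g U (prod_map U s t) = c U s t) ->
    forall U w, g U w = f U w.
Proof.
exists (@SheafHom _ _ (OXD (dadd D E)) P (fun U => linear_pack (@phi_linear U)) phi_nat).
  move=> U s t; apply: (sections_ext (C := trace_cover hX U Vy)) => y /=.
  rewrite phiE /local_value -bnat; apply/esym/bilE.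
  by rewrite hnat !Oval_res.
move=> g gE U f; apply: (sections_ext (C := trace_cover hX U Vy)) => y /=.
rewrite phiE /local_value -hnat -bnat.
have [u0 _] := gu y; have [w0 _] := gw y.
have -> : res (@openIl _ _ U (V_ y)) f = Oreg (quot_reg (y := y) f) *:
    prod_map _ (res (@openIr _ _ U (V_ y)) (us y)) (res (@openIr _ _ U (V_ y)) (ws y)).
  apply: Osec_eq; rewrite OvalZ Oval_res OsecK hnat beK !Oval_res !OsecK /=.
  by field; rewrite u0 w0.
by rewrite linearZ gE.
Qed.
End Universal.

Lemma product_tensor : is_tensor prod_map.
Proof.
move=> P c.
have exD y : exists Vu : open_set X * K, Vu.1 y /\ generates D Vu.1 Vu.2.
  by have [V [u Vu]] := local_generator hX D y; exists (V, u).
have exE y : exists Vu : open_set X * K, Vu.1 y /\ generates E Vu.1 Vu.2.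
  by have [V [u Vu]] := local_generator hX E y; exists (V, u).
have [d dP] := choice exD; have [e eP] := choice exE.
apply: (@product_universal P c (fun y => openI (d y).1 (e y).1) (fun y => (d y).2) (fun y => (e y).2)).
- by move=> y; split; [exact: (dP y).1|exact: (eP y).1].
- by move=> y; apply: generates_sub (dP y).2; exact: openIl.
- by move=> y; apply: generates_sub (eP y).2; exact: openIr.
Qed.
End Product.

Lemma twist_OXD L D x : sheaf_iso L (OXD D) ->
  sheaf_iso (twist x L) (OXD (dadd D (minus_point x))).
Proof.
move=> /sheaf_iso_inverse[al [be [alK beK]]].
exact: tensor_iso (@product_tensor _ _ (minus_point x) _ _ alK beK).
Qed.

Lemma vector_bundle_iso n M N : sheaf_iso M N -> vector_bundle n N -> vector_bundle n M.
Proof.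
move=> /sheaf_iso_inverse[f [g [fK gK]]] vb y; have [U [Uy [e eP]]] := vb y.
exists U; split=> //; exists (fun i => g U (e i)) => V h s.
have E (a : {ffun 'I_n -> OX V}) :
    f V (\sum_i a i *: res h (g U (e i))) = \sum_i a i *: res h (e i).
  by rewrite linear_sum; apply: eq_bigr => i _; rewrite linearZ hnat gK.
have [a [sa aU]] := eP V h (f V s); exists a; split.
  by apply: (can_inj (fK V)); rewrite E.
by move=> b sb; apply: aU; rewrite sb E.
Qed.

Lemma vector_bundle_dsum_OXD n (E : 'I_n -> divisor X) :
  vector_bundle n (dsum (fun i => OXD (E i))).
Proof.
move=> y; have ex i : exists Vu : open_set X * K, Vu.1 y /\ generates (E i) Vu.1 Vu.2.
  by have [V [u Vu]] := local_generator hX (E i) y; exists (V, u).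
have [d dP] := choice ex.
have fin : finite_set [set z | ~ forall i, (d i).1 z].
  apply: (@sub_finite_set _ _ (\bigcup_(i in setT) [set z | ~ (d i).1 z])).
    by move=> z /= /existsNP[i ni]; exists i.
  by apply: bigcup_finite => // i _; exact: ocofinite.
exists (OpenSet fin); split; first by move=> i; exact: (dP i).1.
have gE i : generates (E i) (OpenSet fin) (d i).2.
  by apply: generates_sub (dP i).2 => z; exact.
pose e i : dsum (fun i => OXD (E i)) (OpenSet fin) :=
  fun k => if k == i then Osec (generates_sec (gE k)) else 0.
exists e => V h s.
have r i : regular_on V (Oval (s i) / (d i).2).
  by apply/(generates_reg _ (generates_sub h (gE i))); exact: OvalP.
have coordE (a : {ffun 'I_n -> OX V}) k :
    Oval ((\sum_i a i *: res h (e i)) k) = val (a k) * (d k).2.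
  rewrite (_ : (\sum_i a i *: res h (e i)) k = \sum_i (a i *: res h (e i k))); last first.
    by apply: (big_morph (fun t : dsum (fun i => OXD (E i)) V => t k)).
  rewrite Oval_sum (bigD1 k) //= big1 ?addr0 => [|i ik]; rewrite OvalZ Oval_res /e.
    by rewrite eqxx.
  by rewrite eq_sym (negbTE ik) mulr0.
exists [ffun i => Oreg (r i)]; split.
  apply: functional_extensionality_dep => k; apply: Osec_eq.
  by rewrite coordE ffunE /= divfK //; have [] := gE k.
move=> b sb; apply/ffunP => k; apply: val_inj; rewrite ffunE /=.
by rewrite sb coordE mulfK //; have [] := gE k.
Qed.

End Tensor.

(** * Subsheaves with quotient the skyscraper *)

Section Hecke.
Variables (F : finFieldType) (X : curve F).
Local Notation K := (funfield X).
Local Notation point := (closed_point X).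
Implicit Types (M N : modsheaf X) (U W : open_set X).

Hypothesis hX : elliptic X.

Lemma subsheaf_ext M (S T : subsheaf M) : (forall U s, S U s <-> T U s) -> S = T.
Proof.
case: S => S Sres Sloc; case: T => T Tres Tloc /= ST.
have E : S = T.
  apply: functional_extensionality_dep => U; move: (ST U).
  case: (S U) (T U) => [A A0 AD AZ] [B B0 BD BZ] /= AB.
  have EAB : A = B by apply/funext => s; apply/propext; exact: AB.
  case: _ / EAB in B0 BD BZ AB *.
  by congr SubmodSet; exact: Prop_irrelevance.
case: _ / E in Tres Tloc ST *.
by congr Subsheaf; exact: Prop_irrelevance.
Qed.

(** An arbitrary representative of r may have poles elsewhere; those of f / u,
    with f a global section and u of finite support, are finite in number. *)
Lemma local_lift (x : point) (r : residue_field x) :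
  exists W f, [/\ W x, regular_on (X:=X) W f & value_at x f = r].
Proof.
have [u [u0 ux uf]] := prescribed_order hX x (- 2%:Z).
have Dx : dscale 2 (dpoint x) x = 2 by rewrite /= eqxx mulr1.
have [||f Df fr] := @H0_eval_surj _ _ hX (dscale 2 (dpoint x)) x u _ u0 _ r.
- by rewrite degree_dscale degree_dpoint; have := degree_pt_gt0 x; lia.
- by rewrite ux Dx.
have fin : finite_set [set z | ~ (z = x \/ ord z u = 0)].
  by apply: sub_finite_set uf => z /= /not_orP[_ /eqP].
exists (OpenSet fin), (f / u); split=> //; first by left.
move=> z [->|uz]; apply/(val_ge_div _ _ u0).
  by have := Df x I; rewrite ux Dx.
have [-> |zx] := pselect (z = x); first by have := Df x I; rewrite ux Dx.
have := Df z I; rewrite uz /=; case: eqVneq => [//|_].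
by rewrite mulr0 oppr0.
Qed.

Section Sum.
Variables (n : nat) (L : 'I_n -> modsheaf X) (D : 'I_n -> divisor X).
Variables (al : forall i, sheaf_hom (L i) (OXD (D i))) (be : forall i, sheaf_hom (OXD (D i)) (L i)).
Hypotheses (alK : forall i U, cancel (al i U) (be i U)) (beK : forall i U, cancel (be i U) (al i U)).
Variables (x : point) (V : open_set X) (Vx : V x) (u : 'I_n -> K).
Hypothesis gu : forall i, generates (D i) V (u i).
Local Notation A := (dsum L).
Local Notation kx := (residue_field x).
Local Notation Q := (dsum (fun _ : 'I_1 => skyscraper x)).

Definition comp_val U (s : A U) i : K := Oval (al i U (s i)).
Definition fibre_val U (s : A U) i : kx := value_at x (comp_val s i / u i).

Lemma u_neq0 i : u i != 0. Proof. by have [] := gu i. Qed.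

Lemma sec_quot_v U (f : K) i : U x -> OXD_set (D i) U f -> x (f / u i).
Proof. by move=> Ux Df; apply/(generates_point f (gu i) Vx)/Df. Qed.

Lemma comp_val_v U (s : A U) i : U x -> x (comp_val s i / u i).
Proof. by move=> Ux; apply: sec_quot_v Ux _; exact: OvalP. Qed.

Lemma comp_val_linear U (a : OX U) (s t : A U) i :
  comp_val (a *: s + t) i = val a * comp_val s i + comp_val t i.
Proof.
rewrite /comp_val (_ : (a *: s + t) i = a *: s i + t i) //.
by rewrite linearP OvalD OvalZ.
Qed.

Lemma comp_val_res U W (h : osub W U) (s : A U) i : comp_val (res h s) i = comp_val s i.
Proof. by rewrite /comp_val hnat Oval_res. Qed.

Lemma fibre_val_res U W (h : osub W U) (s : A U) i : fibre_val (res h s) i = fibre_val s i.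
Proof. by rewrite /fibre_val comp_val_res. Qed.

Lemma fibre_val_linear U (Ux : U x) (a : OX U) (s t : A U) i :
  fibre_val (a *: s + t) i = value_at x (val a) * fibre_val s i + fibre_val t i.
Proof.
have xa : x (val a) := OXP a Ux.
rewrite /fibre_val comp_val_linear mulrDl -mulrA value_atD; last exact: comp_val_v.
  by rewrite value_atM //; exact: comp_val_v.
by apply: vM => //; exact: comp_val_v.
Qed.

Section Functional.
Variable lam : 'I_n -> kx.

Definition functional U (s : A U) : kx := \sum_i lam i * fibre_val s i.

Lemma functional_linear U (Ux : U x) (a : OX U) (s t : A U) :
  functional (a *: s + t) = value_at x (val a) * functional s + functional t.
Proof.
rewrite /functional mulr_sumr -big_split; apply: eq_bigr => i _ /=.
by rewrite fibre_val_linear // mulrDr mulrCA.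
Qed.

Lemma functional_res U W (h : osub W U) (s : A U) : functional (res h s) = functional s.
Proof. by apply: eq_bigr => i _; rewrite fibre_val_res. Qed.

Definition ker_set U (s : A U) : Prop := U x -> functional s = 0.

Lemma functional0 U : functional (0 : A U) = 0.
Proof.
apply: big1 => i _; rewrite /fibre_val /comp_val (_ : (0 : A U) i = 0) // linear0.
by rewrite Oval0 mul0r ((value_at_eq0 (v0 x)).2 (maximal0 x)) mulr0.
Qed.

Lemma ker0 U : @ker_set U 0.
Proof. by move=> _; exact: functional0. Qed.

Lemma kerZ U (a : OX U) (s : A U) : ker_set s -> ker_set (a *: s).
Proof.
by move=> ks Ux; rewrite -[a *: s]addr0 functional_linear // ks // functional0 mulr0 addr0.
Qed.

Lemma kerD U (s t : A U) : ker_set s -> ker_set t -> ker_set (s + t).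
Proof.
move=> ks kt Ux; rewrite -[s]scale1r functional_linear // ks // kt //.
by rewrite mulr0 addr0.
Qed.

Definition ker_submod U : submod_set (A U) := SubmodSet (@ker0 U) (@kerD U) (@kerZ U).

Lemma ker_res U W (h : osub W U) (s : A U) : ker_submod U s -> ker_submod W (res h s).
Proof. by move=> ks /h Ux; rewrite functional_res; exact: ks. Qed.

Lemma ker_loc U (C : open_cover U) (s : A U) :
  (forall i, ker_submod (C i) (res (@csub _ _ _ C i) s)) -> ker_submod U s.
Proof.
move=> ks Ux; have [i Cx] := ccov C Ux.
by rewrite -(functional_res (@csub _ _ _ C i)); exact: ks.
Qed.

Definition ker_sheaf : subsheaf A := Subsheaf ker_res ker_loc.
End Functional.

Definition basis_sec i : A V := fun k => if k == i then be k V (Osec (generates_sec (gu k))) else 0.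

Lemma comp_val_basis i k : comp_val (basis_sec i) k = if k == i then u k else 0.
Proof.
rewrite /comp_val /basis_sec; case: eqP => _; first by rewrite beK OsecK.
by rewrite linear0 Oval0.
Qed.

Lemma fibre_val_basis i k W (Wx : W x) (h : osub W V) (a : OX W) :
  fibre_val (a *: res h (basis_sec i)) k = if k == i then value_at x (val a) else 0.
Proof.
rewrite -[_ *: _]addr0 fibre_val_linear // fibre_val_res /fibre_val comp_val_basis.
have r0 : value_at x 0 = 0 by apply/(value_at_eq0 (v0 x)); exact: maximal0.
rewrite (_ : comp_val 0 k = 0) ?mul0r ?r0 ?addr0; last first.
  by rewrite /comp_val (_ : (0 : A W) k = 0) // linear0 Oval0.
case: eqP => _; last by rewrite mul0r r0 mulr0.
by rewrite divff ?u_neq0 // value_at1 mulr1.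
Qed.

Lemma functional_basis lam W (Wx : W x) (h : osub W V) (a b : OX W) i k : i != k ->
  functional lam (a *: res h (basis_sec i) + b *: res h (basis_sec k)) =
  lam i * value_at x (val a) + lam k * value_at x (val b).
Proof.
move=> ik; rewrite -[a *: _]scale1r functional_linear // value_at1 mul1r.
by congr (_ + _); rewrite /functional; [rewrite (bigD1 i)|rewrite (bigD1 k)] => //=;
  rewrite fibre_val_basis // eqxx big1 ?addr0 // => j /negbTE jk;
  rewrite fibre_val_basis // jk mulr0.
Qed.

Lemma functional_basis1 lam W (Wx : W x) (h : osub W V) (a : OX W) i :
  functional lam (a *: res h (basis_sec i)) = lam i * value_at x (val a).
Proof.
rewrite /functional (bigD1 i) //= fibre_val_basis // eqxx big1 ?addr0 // => j /negbTE ji.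
by rewrite fibre_val_basis // ji mulr0.
Qed.

Lemma sec_expand U (s : A U) (W := openI U V) :
  exists a : 'I_n -> OX W, (forall i, val (a i) = comp_val s i / u i) /\
  res (@openIl _ _ U V) s = \sum_i a i *: res (@openIr _ _ U V) (basis_sec i).
Proof.
have r i : regular_on W (comp_val s i / u i).
  apply/(generates_reg _ (generates_sub (@openIr _ _ U V) (gu i))) => z [Uz _].
  exact: OvalP.
exists (fun i => Oreg (r i)); split=> //.
apply: functional_extensionality_dep => k; apply: (can_inj (@alK k W)); apply: Osec_eq.
rewrite -[LHS]/(comp_val _ k) -[RHS]/(comp_val _ k) comp_val_res.
have sumE (b : 'I_n -> A W) : comp_val (\sum_i b i) k = \sum_i comp_val (b i) k.
  apply: (big_morph (fun t => comp_val t k)) => [t t'|].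
    by rewrite -[t]scale1r comp_val_linear mul1r scale1r.
  by rewrite /comp_val (_ : (0 : A W) k = 0) // linear0 Oval0.
have scaleE (c : OX W) (t : A W) : comp_val (c *: t) k = val c * comp_val t k.
  rewrite -[c *: t]addr0 comp_val_linear (_ : comp_val 0 k = 0) ?addr0 //.
  by rewrite /comp_val (_ : (0 : A W) k = 0) // linear0 Oval0.
rewrite sumE (bigD1 k) //= scaleE comp_val_res comp_val_basis eqxx /= divfK ?u_neq0 //.
rewrite big1 ?addr0 // => i ik.
by rewrite scaleE comp_val_res comp_val_basis eq_sym (negbTE ik) mulr0.
Qed.

Lemma value_at_germ W (Wx : W x) (a : OX W) : residue x (germ Wx a) = value_at x (val a).
Proof. by rewrite (value_atE (OXP a Wx)). Qed.

(** The coordinate lam_i is the image of the i-th local generator, and linearity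
    over the functions regular near x gives the other values. *)
Lemma quotient_functional (S : subsheaf A) : quotient_iso S Q ->
  exists lam, (exists i, lam i != 0) /\ S = ker_sheaf lam.
Proof.
move=> [p [psurj pker]].
pose lam i : kx := p V (basis_sec i) ord0 Vx.
have pE U (s : A U) (Ux : U x) : p U s ord0 Ux = functional lam s.
  have [a [aE sE]] := sec_expand s; set W := openI U V in a aE sE.
  have Wx : W x by split.
  have -> : p U s ord0 Ux = p W (res (@openIl _ _ U V) s) ord0 Wx.
    by rewrite hnat /= /ds_res /= /sky_res; congr (p U s ord0 _); exact: Prop_irrelevance.
  rewrite sE linear_sum.
  have -> : (\sum_i p W (a i *: res (@openIr _ _ U V) (basis_sec i))) ord0 Wx =
     \sum_i (p W (a i *: res (@openIr _ _ U V) (basis_sec i)) ord0 Wx : kx).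
    by apply: (big_morph (fun t : Q W => t ord0 Wx : kx)).
  apply: eq_bigr => i _; rewrite linearZ hnat.
  rewrite -[LHS]/(residue x (germ Wx (a i)) * (p V (basis_sec i) ord0 (@openIr _ _ U V x Wx) : kx)).
  rewrite value_at_germ aE mulrC; congr (_ * _); rewrite /lam; congr (p V _ ord0 _).
  exact: Prop_irrelevance.
exists lam; split.
  apply: contrapT => no.
  have l0 i : lam i = 0 by apply/eqP; apply: contrapT => /negP li; apply: no; exists i.
  (* The skyscraper has a section with value 1 at x, which lifts near x. *)
  have [W [h [Wx [s ps]]]] := psurj V (fun _ _ => 1 : kx) x Vx.
  have := pE W s Wx; rewrite ps /functional big1 => [/eqP|i _]; last by rewrite l0 mul0r.
  by rewrite -[_ == _]/((1 : kx) == 0) oner_eq0.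
apply: subsheaf_ext => U s; split=> [/pker ps0 Ux|ks].
  by rewrite -pE ps0.
apply/pker; apply: functional_extensionality_dep => i.
apply: functional_extensionality_dep => Ux; rewrite (ord1 i) pE; exact: ks.
Qed.

Lemma residue_inv (r : kx) : r != 0 -> exists mu, mu * r = 1.
Proof.
have [f xf <-] := value_at_surj r => /eqP f0.
have [fn0 xfV] := maximalNP (fun mf => f0 ((value_at_eq0 xf).2 mf)).
by exists (value_at x f^-1); rewrite -value_atM // mulVf // value_at1.
Qed.

(** Near x a value is reached by a multiple of the k-th generator with lam_k
    nonzero; near any other point the target vanishes. *)
Lemma functional_quotient lam : (exists i, lam i != 0) -> quotient_iso (ker_sheaf lam) Q.
Proof.
move=> [k lk]; have [mu muk] := residue_inv lk.
have plin U : linear (fun s : A U => (fun _ _ => functional lam s) : Q U).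
  move=> a s t; apply: functional_extensionality_dep => i.
  apply: functional_extensionality_dep => Ux; rewrite functional_linear //.
  by rewrite -(value_at_germ Ux).
have pnat U W (h : osub W U) (s : A U) :
    linear_pack (plin W) (res h s) = res h (linear_pack (plin U) s).
  apply: functional_extensionality_dep => i.
  by apply: functional_extensionality_dep => Wx /=; rewrite functional_res.
exists (@SheafHom _ _ A Q (fun U => linear_pack (plin U)) pnat); split; last first.
  move=> U s; split=> [s0 Ux|ks]; first exact: (congr1 (fun t : Q U => t ord0 Ux) s0).
  apply: functional_extensionality_dep => i.
  by apply: functional_extensionality_dep => Ux; exact: ks.
move=> U t y Uy; have [yx|yx] := pselect (y = x).
  have [W [f [Wx fr fx]]] := local_lift (mu * (t ord0 (eq_ind y U Uy x yx) : kx)).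
  pose O := openI (openI U V) W; have OU : osub O U by move=> z [[]].
  have OV : osub O V by move=> z [[]].
  have Ox : O x by split=> //; split=> //; rewrite -yx.
  have r : regular_on O f by move=> z [_]; exact: fr.
  exists O, OU; split; first by rewrite yx.
  exists (Oreg r *: res OV (basis_sec k)).
  apply: functional_extensionality_dep => i.
  apply: functional_extensionality_dep => Ox'; rewrite /= functional_basis1 //= fx.
  rewrite mulrA [lam k * mu]mulrC muk mul1r (ord1 i) /ds_res /= /sky_res.
  congr (t _ _); exact: Prop_irrelevance.
have fin : finite_set [set z | ~ (U z /\ z <> x)].
  apply: (@sub_finite_set _ _ ([set z | ~ U z] `|` [set x])).
    by move=> z /= /not_andP[]; [left | move=> /contrapT; right].
  by rewrite finite_setU; split; [exact: ocofinite | exact: finite_set1].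
have h : osub (OpenSet fin) U by move=> z [].
exists (OpenSet fin), h; split=> //; exists 0.
apply: functional_extensionality_dep => i.
by apply: functional_extensionality_dep => Wx; have [_ /(_ erefl)] := Wx.
Qed.

(** The combination of the i-th and k-th generators with values 1 and - lam_i
    at x is a section of the first kernel; as a section of the second one it
    compares lam_i with mu_i. *)
Lemma ker_sheaf_inj lam mu k : lam k = 1 -> mu k = 1 -> ker_sheaf lam = ker_sheaf mu ->
  forall i, lam i = mu i.
Proof.
move=> lk mk E i; have [->|ik] := eqVneq i k; first by rewrite lk mk.
have [W [f [Wx fr fx]]] := local_lift (- lam i).
pose O := openI V W; have OV : osub O V by move=> z [].
have Ox : O x by [].
have r : regular_on O f by move=> z [_]; exact: fr.
pose s := (1 : OX O) *: res OV (basis_sec i) + Oreg r *: res OV (basis_sec k).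
have : ker_sheaf lam O s.
  by move=> _; rewrite functional_basis //= value_at1 mulr1 lk mul1r fx addrN.
rewrite E => /(_ Ox); rewrite functional_basis //= value_at1 mulr1 mk mul1r fx => /eqP.
by rewrite subr_eq0 => /eqP.
Qed.

Lemma ker_sheaf_scale lam mu c c' : c' * c = 1 -> (forall i, mu i = c * lam i) ->
  ker_sheaf lam = ker_sheaf mu.
Proof.
move=> cc mE; have E U (s : A U) : functional mu s = c * functional lam s.
  by rewrite /functional mulr_sumr; apply: eq_bigr => i _; rewrite mE mulrA.
apply: subsheaf_ext => U s; split=> ks Ux; first by rewrite E ks // mulr0.
by rewrite -[functional _ _]mul1r -cc -mulrA -E ks // mulr0.
Qed.

(** Scaling a functional does not change its kernel. *)
Lemma top_functional (S : subsheaf A) : quotient_iso S Q ->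
  exists (lam : 'I_n -> kx) (k : 'I_n),
  [/\ lam k = 1, (forall i : 'I_n, (k < i)%N -> lam i = 0) & S = ker_sheaf lam].
Proof.
move=> /quotient_functional[lam [[i0 l0] ->]].
have [k lk kmax] := @arg_maxnP _ i0 (fun i => lam i != 0) (fun i => i : nat) l0.
have [mu muk] := residue_inv lk; exists (fun i => mu * lam i), k; split=> //.
  move=> i ki; suff -> : lam i = 0 by rewrite mulr0.
  by apply/eqP; apply: contraLR ki => /kmax; rewrite -leqNgt.
by apply: (@ker_sheaf_scale _ _ mu (lam k)) => //; rewrite mulrC.
Qed.
End Sum.
End Hecke.

(** * Isomorphism classes of the modifications *)

Section Twists.
Variables (F : finFieldType) (X : curve F).
Local Notation K := (funfield X).
Local Notation point := (closed_point X).
Implicit Types (M N : modsheaf X) (U W : open_set X).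

Hypothesis hX : elliptic X.

Lemma val_ge_mono (z : point) a b f : (b <= a)%R -> val_ge z a f -> val_ge z b f.
Proof.
move=> ba; have [->|f0] := eqVneq f 0; first by move=> _; exact: val_ge0.
by move=> /(val_geP _ _ f0) af; apply/(val_geP _ _ f0); exact: le_trans af.
Qed.

(** The sections of O(D - x) are those of O(D) that vanish in the fibre at x. *)
Lemma OXD_minus_point D (x : point) V u U f : generates D V u -> V x ->
  OXD_set (dadd D (minus_point x)) U f <->
  OXD_set D U f /\ (U x -> value_at x (f / u) = 0).
Proof.
move=> gu Vx; have [u0 ou] := gu.
have key : val_ge x (ord x u + 1) f <-> val_ge x (ord x u) f /\ value_at x (f / u) = 0.
  have [->|f0] := eqVneq f 0.
    rewrite mul0r; split=> _; last exact: val_ge0.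
    by split; [exact: val_ge0 | apply/(value_at_eq0 (v0 x)); exact: maximal0].
  have q0 : f / u != 0 by rewrite mulf_neq0 ?invr_eq0.
  have oq : ord x (f / u) = ord x f - ord x u by rewrite ordM ?invr_eq0 // ordV.
  rewrite (val_geP _ _ f0) lezD1 -subr_gt0 -oq -(maximal_ord _ q0); split=> [mf|[vf rf]].
    by split; [exact/(val_ge_div _ _ u0)/maximal_sub | exact/(value_at_eq0 (maximal_sub mf))].
  by apply/(value_at_eq0 _); first exact/(val_ge_div _ _ u0).
have mx z : minus_point x z = if z == x then -1 else 0 by [].
split=> [h|[h1 h2] z Uz].
  split=> [z Uz|Ux].
    by apply: val_ge_mono (h z Uz); rewrite /= lerN2; case: eqP => _; lia.
  have := h x Ux; rewrite /= eqxx opprD opprK -ou // => /key[].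
  by [].
rewrite /= ; case: eqP => [zx|_]; last by rewrite addr0; exact: h1.
by subst z; rewrite opprD opprK -ou //; apply/key; split; [rewrite ou //; exact: h1|exact: h2].
Qed.

Section Nonisomorphic.
Variables (n : nat) (A B : 'I_n -> divisor X).

Lemma inj_sec_subproof i U (s : OXD (A i) U) k :
  OXD_set (A k) U (if k == i then Oval s else 0).
Proof.
by case: eqP => [->|_]; [exact: OvalP | move=> z _; exact: val_ge0].
Qed.

Definition inj_sec i U (s : OXD (A i) U) : dsum (fun i => OXD (A i)) U :=
  fun k => Osec (inj_sec_subproof s k).

Section Component.
Variable f : sheaf_hom (dsum (fun i => OXD (A i))) (dsum (fun i => OXD (B i))).
Variables i l : 'I_n.

Lemma component_linear U : linear (fun s : OXD (A i) U => f U (inj_sec s) l : OXD (B l) U).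
Proof.
move=> a s t; rewrite -[RHS]/((a *: f U (inj_sec s) + f U (inj_sec t)) l) -linearP.
congr (f U _ l); apply: functional_extensionality_dep => k; apply: Osec_eq.
rewrite -[LHS]/(if _ then _ else _) -[RHS]/(val a * (if _ then _ else _) + (if _ then _ else _)).
by case: eqP => // _; rewrite mulr0 addr0.
Qed.

Lemma component_nat U V (h : osub V U) (s : OXD (A i) U) :
  linear_pack (@component_linear V) (res h s) = res h (linear_pack (@component_linear U) s).
Proof.
rewrite /= -[RHS]/((res h (f U (inj_sec s))) l) -hnat.
congr (f V _ l); apply: functional_extensionality_dep => k; exact: Osec_eq.
Qed.

Definition component : sheaf_hom (OXD (A i)) (OXD (B l)) :=
  @SheafHom _ _ (OXD (A i)) (OXD (B l)) (fun U => linear_pack (@component_linear U)) component_nat.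
End Component.

Lemma component_sum (f : sheaf_hom (dsum (fun i => OXD (A i))) (dsum (fun i => OXD (B i)))) U
    (s : dsum (fun i => OXD (A i)) U) l :
  Oval (f U s l) = \sum_i Oval (component f i l U (s i)).
Proof.
have sE : s = \sum_i inj_sec (s i).
  apply: functional_extensionality_dep => k; apply: Osec_eq.
  rewrite (_ : (\sum_i inj_sec (s i)) k = \sum_i inj_sec (s i) k); last first.
    by apply: (big_morph (fun t : dsum (fun i => OXD (A i)) U => t k)).
  rewrite Oval_sum (bigD1 k) //= big1 ?addr0 => [|i ik]; rewrite OsecK ?eqxx //.
  by rewrite eq_sym (negbTE ik).
rewrite {1}sE linear_sum -Oval_sum; congr Oval.
transitivity (\sum_i f U (inj_sec (s i)) l); last by apply: eq_bigr => i _.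
by apply: (big_morph (fun t : dsum (fun i => OXD (B i)) U => t l)).
Qed.
End Nonisomorphic.

(** Homomorphisms from O(A_i) to O(B_l) vanish for i >= j >= l.  In the matrix
    of an isomorphism, the identity of size j + 1 would therefore factor through
    the j first summands of the source. *)
Lemma dsum_not_iso n (A B : 'I_n -> divisor X) (j : 'I_n) :
  (forall i l : 'I_n, (j <= i)%N -> (l <= j)%N -> degree_div (B l) < degree_div (A i)) ->
  ~ sheaf_iso (dsum (fun i => OXD (A i))) (dsum (fun i => OXD (B i))).
Proof.
move=> AB /sheaf_iso_inverse[f [g [_ gK]]].
have exf (il : 'I_n * 'I_n) : exists p : K,
    forall U s, Oval (component f il.1 il.2 U s) = p * Oval s.
  by have [p []] := hom_OXD hX (component f il.1 il.2); exists p.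
have exg (il : 'I_n * 'I_n) : exists p : K,
    forall U s, Oval (component g il.1 il.2 U s) = p * Oval s.
  by have [p []] := hom_OXD hX (component g il.1 il.2); exists p.
have [p pE] := choice exf; have [r rE] := choice exg.
have [z0 _] := rational_point hX.
have gen (E : divisor X) : exists U u, generates E U u.
  by have [U [u [_]]] := local_generator hX E z0; exists U, u.
have id l l' : \sum_i r (l, i) * p (i, l') = (l' == l)%:R.
  have [U [u gu]] := gen (B l); have [u0 _] := gu.
  pose t := @inj_sec n B l U (Osec (generates_sec gu)).
  have tE k : Oval (t k) = if k == l then u else 0 by [].
  have gE i : Oval (g U t i) = r (l, i) * u.
    rewrite component_sum (bigD1 l) //= (rE (l, i)) tE eqxx big1 ?addr0 // => k /negbTE kl.
    by rewrite (rE (k, i)) tE kl mulr0.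
  apply: (mulIf u0); rewrite mulr_suml.
  transitivity (Oval (t l')); last by rewrite tE; case: eqP; rewrite ?mul1r ?mul0r.
  rewrite -[in RHS](gK U t) component_sum; apply: eq_bigr => i _.
  by rewrite (pE (i, l')) gE; ring.
have p0 (i l : 'I_n) : (j <= i)%N -> (l <= j)%N -> p (i, l) = 0.
  move=> ji lj; have [U [u gu]] := gen (A i); have [u0 _] := gu.
  have := pE (i, l) U (Osec (generates_sec gu)).
  rewrite (hom_OXD_eq0 hX) /=; last exact: AB.
  by rewrite OsecK Oval0 => /esym/eqP; rewrite mulf_eq0 (negbTE u0) orbF => /eqP.
have jn := ltn_ord j; pose w1 := widen_ord jn; pose w2 := widen_ord (ltnW jn).
pose G : 'M[K]_(j.+1, j) := \matrix_(a, b) r (w1 a, w2 b).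
pose H : 'M[K]_(j, j.+1) := \matrix_(b, a) p (w2 b, w1 a).
have GH : G *m H = 1%:M.
  apply/matrixP => a b; rewrite !mxE.
  transitivity (\sum_i r (w1 a, i) * p (i, w1 b)).
    rewrite [RHS](bigID (fun i : 'I_n => (i < j)%N)) /= [X in _ + X]big1 ?addr0.
      rewrite (big_ord_narrow (ltnW jn)).
      by apply: eq_bigr => i _; rewrite !mxE.
    move=> i; rewrite -leqNgt => ji; rewrite p0 ?mulr0 //.
    by rewrite -ltnS; exact: (ltn_ord b).
  rewrite id eq_sym; congr (_%:R).
have := mxrankM_maxl G H; rewrite GH mxrank1 => /leq_trans/(_ (rank_leq_col G)).
by rewrite ltnn.
Qed.

Section Modifications.
Variables (n : nat) (L : 'I_n -> modsheaf X) (D : 'I_n -> divisor X).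
Variables (al : forall i, sheaf_hom (L i) (OXD (D i))) (be : forall i, sheaf_hom (OXD (D i)) (L i)).
Hypotheses (alK : forall i U, cancel (al i U) (be i U)) (beK : forall i U, cancel (be i U) (al i U)).
Variables (x : point) (V : open_set X) (Vx : V x) (u : 'I_n -> K).
Hypothesis gu : forall i, generates (D i) V (u i).
Hypothesis gap : forall i k : 'I_n, (i < k)%N ->
  degree_div (D i) + (degree_pt x)%:Z < degree_div (D k).
Local Notation A := (dsum L).
Local Notation kx := (residue_field x).
Local Notation ker := (ker_sheaf al Vx gu).

Definition twisted k i := if i == k then dadd (D i) (minus_point x) else D i.

(** The degree of the twisted summand stays above those of the previous ones
    and is below that of the untwisted one. *)
Lemma twisted_not_iso k j : k != j ->
  ~ sheaf_iso (dsum (fun i => OXD (twisted k i))) (dsum (fun i => OXD (twisted j i))).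
Proof.
have mp : degree_div (minus_point x) = - (degree_pt x)%:Z.
  rewrite -mulN1r -degree_dpoint -degree_dscale; apply: eq_fsbigr => z _.
  by rewrite /=; case: eqVneq; rewrite ?mulr1 ?mulr0.
have x0 := degree_pt_gt0 x.
have lt (a b : 'I_n) : (a < b)%N ->
    ~ sheaf_iso (dsum (fun i => OXD (twisted a i))) (dsum (fun i => OXD (twisted b i))).
  move=> ab; apply: (dsum_not_iso (j := b)) => i l bi lb; rewrite /twisted.
  have -> : (i == a) = false by apply/eqP => ia; move: ab; rewrite -ia; lia.
  have le : degree_div (D b) <= degree_div (D i).
    by move: bi; rewrite leq_eqVlt => /orP[/eqP/val_inj->//|/gap]; lia.
  case: eqP => [->|/eqP lb']; first by rewrite degree_dadd mp; lia.
  by have := @gap l b; rewrite ltn_neqAle lb andbT => /(_ lb'); lia.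
case: (ltngtP k j) => [/lt //|/lt h _ /sheaf_iso_sym //|/val_inj ->].
by rewrite eqxx.
Qed.

(** The homomorphism phi_i from O(D_i) to O(D_k) exists for i < k because of the
    gap between the degrees; for i > k it is zero. *)
Lemma shear_coefficients (lam : 'I_n -> kx) (k : 'I_n) :
  (forall i : 'I_n, (k < i)%N -> lam i = 0) ->
  exists phi : 'I_n -> K, forall i, i != k ->
    H0 (dadd (D k) (dscale (-1) (D i))) (phi i) /\ value_at x (phi i * u i / u k) = lam i.
Proof.
move=> top; have u0 i := u_neq0 gu i.
have ex i : exists f, i != k ->
    H0 (dadd (D k) (dscale (-1) (D i))) f /\ value_at x (f * u i / u k) = lam i.
  case: (ltngtP i k) => [ik|ki|/val_inj ->]; last by exists 0; rewrite eqxx.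
    have [|||f Df fE] := @H0_eval_surj _ _ hX (dadd (D k) (dscale (-1) (D i))) x (u k / u i) _ _ _ (lam i).
    - by rewrite degree_dadd degree_dscale; have := gap ik; lia.
    - by rewrite mulf_neq0 ?invr_eq0.
    - have [_ ok] := gu k; have [_ oi] := gu i.
      by rewrite ordM ?invr_eq0 // ordV // ok // oi //=; ring.
    by exists f => _; split=> //; rewrite -fE; congr (value_at x _); rewrite invf_div mulrA.
  exists 0 => _; split; first exact: H0_0.
  by rewrite !mul0r top // ((value_at_eq0 (v0 x)).2 (maximal0 x)).
have [phi phiP] := choice ex; by exists phi.
Qed.

Section Shear.
Variables (lam : 'I_n -> kx) (k : 'I_n) (phi : 'I_n -> K).
Hypotheses (lamk : lam k = 1) (phiP : forall i, i != k ->
    H0 (dadd (D k) (dscale (-1) (D i))) (phi i) /\ value_at x (phi i * u i / u k) = lam i).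

Definition shear (w : 'I_n -> K) i : K :=
  if i == k then w k + \sum_(l | l != k) phi l * w l else w i.

Lemma shear_term_sec U l (f : K) : l != k -> OXD_set (D l) U f -> OXD_set (D k) U (phi l * f).
Proof.
move=> lk Df z Uz; have [Hphi _] := phiP lk.
have -> : - D k z = - dadd (D k) (dscale (-1) (D l)) z - D l z by rewrite /=; ring.
by apply: val_geM; [exact: Hphi | exact: Df].
Qed.

Lemma value_at_shear_term U l (f : K) : U x -> l != k -> OXD_set (D l) U f ->
  value_at x (phi l * f / u k) = lam l * value_at x (f / u l).
Proof.
move=> Ux lk Df; have [Hphi <-] := phiP lk; have u0 i := u_neq0 gu i.
have gV : OXD_set (D l) V (u l) by exact: generates_sec.
rewrite -value_atM.
- by congr (value_at x _); field; rewrite !u0.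
- by apply: (sec_quot_v Vx gu Vx); exact: shear_term_sec gV.
- exact: (sec_quot_v Vx gu Ux Df).
Qed.

Lemma OXD_sum D' U I (r : seq I) (P : pred I) (f : I -> K) :
  (forall i, P i -> OXD_set D' U (f i)) -> OXD_set D' U (\sum_(i <- r | P i) f i).
Proof.
move=> Df z Uz; apply: big_ind => [||i Pi]; [exact: val_ge0|exact: val_geD|exact: Df].
Qed.

(** The shear turns the functional lam into the k-th coordinate. *)
Lemma shear_functional U (w : 'I_n -> K) : U x -> (forall i, OXD_set (D i) U (w i)) ->
  value_at x (shear w k / u k) = \sum_i lam i * value_at x (w i / u i).
Proof.
move=> Ux Dw; rewrite /shear eqxx mulrDl mulr_suml.
have xk l : l != k -> x (phi l * w l / u k).
  by move=> lk; apply: (sec_quot_v Vx gu Ux); exact: shear_term_sec.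
rewrite value_atD; [|exact: (sec_quot_v Vx gu Ux)|exact: v_sum].
rewrite value_at_sum // [RHS](bigD1 k) //= lamk mul1r; congr (_ + _).
by apply: eq_bigr => l lk; exact: (value_at_shear_term Ux).
Qed.

Lemma shear_sec U (w : 'I_n -> K) i : (forall i, OXD_set (D i) U (w i)) ->
  (U x -> \sum_i lam i * value_at x (w i / u i) = 0) -> OXD_set (twisted k i) U (shear w i).
Proof.
move=> Dw kerw; rewrite /twisted; case: eqP => [->|/eqP ik]; last first.
  by rewrite /shear (negbTE ik); exact: Dw.
apply/(OXD_minus_point _ _ (gu k) Vx); split; last first.
  by move=> Ux; rewrite (shear_functional Ux Dw); exact: kerw.
rewrite /shear eqxx => z Uz; apply: val_geD; first exact: Dw.
by apply: (OXD_sum (U := U)) => // l lk; exact: shear_term_sec.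
Qed.

Definition unshear (w : 'I_n -> K) i : K :=
  if i == k then w k - \sum_(l | l != k) phi l * w l else w i.

Lemma unshearK w : shear (unshear w) =1 w.
Proof.
move=> i; rewrite /shear /unshear eqxx; case: eqP => [->|//].
rewrite [X in _ + X](eq_bigr (fun l => phi l * w l)) ?subrK //.
by move=> l /negbTE ->.
Qed.

Lemma shearK w : unshear (shear w) =1 w.
Proof.
move=> i; rewrite /shear /unshear eqxx; case: eqP => [->|//].
rewrite [X in _ - X](eq_bigr (fun l => phi l * w l)) ?addrK //.
by move=> l /negbTE ->.
Qed.

Lemma unshear_sec U (w : 'I_n -> K) i : (forall i, OXD_set (twisted k i) U (w i)) ->
  OXD_set (D i) U (unshear w i).
Proof.
move=> Tw; have Dw l : OXD_set (D l) U (w l).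
  have := Tw l; rewrite /twisted; case: eqP => // -> /(OXD_minus_point _ _ (gu k) Vx)[].
  by [].
rewrite /unshear; case: eqP => [->|_] //.
rewrite -mulN1r => z Uz; apply: val_geD; first exact: Dw.
rewrite -[- D k z]add0r; apply: val_geM; first by apply/val_ge_v/vN/v1.
by apply: (OXD_sum (U := U)) => // l lk; exact: shear_term_sec.
Qed.

Lemma ker_shear_iso : sheaf_iso (sheaf_of_sub (ker lam)) (dsum (fun i => OXD (twisted k i))).
Proof.
pose w U (s : sheaf_of_sub (ker lam) U) i := comp_val al (val s) i.
have wsec U (s : sheaf_of_sub (ker lam) U) i : OXD_set (twisted k i) U (shear (w U s) i).
  apply: shear_sec => [l|]; first exact: OvalP.
  exact: (smtypeP s).
have lin U : linear (fun s : sheaf_of_sub (ker lam) U =>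
    (fun i => Osec (wsec U s i)) : dsum (fun i => OXD (twisted k i)) U).
  move=> a s t; apply: functional_extensionality_dep => i; apply: Osec_eq.
  rewrite -[LHS]/(shear _ i) -[RHS]/(val a * shear _ i + shear _ i).
  have wE l : w U (a *: s + t) l = val a * w U s l + w U t l by exact: comp_val_linear.
  rewrite /shear; case: eqP => _ //; rewrite wE.
  under eq_bigr => l _ do rewrite wE mulrDr mulrCA.
  by rewrite big_split /= -mulr_sumr; ring.
have nat U W (h : osub W U) (s : sheaf_of_sub (ker lam) U) :
    linear_pack (lin W) (res h s) = res h (linear_pack (lin U) s).
  apply: functional_extensionality_dep => i; apply: Osec_eq.
  rewrite -[LHS]/(shear _ i) -[RHS]/(shear _ i).
  have wE l : w W (res h s) l = w U s l by exact: comp_val_res.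
  by rewrite /shear wE; case: eqP => // _; congr (_ + _); apply: eq_bigr => l _; rewrite wE.
exists (@SheafHom _ _ _ (dsum (fun i => OXD (twisted k i))) (fun U => linear_pack (lin U)) nat).
move=> U; apply: bijective_of => [s t st|t].
  apply: val_inj; apply: functional_extensionality_dep => i.
  apply: (can_inj (@alK i U)); apply: Osec_eq.
  have E l : shear (w U s) l = shear (w U t) l.
    exact: (congr1 (fun r : dsum (fun i => OXD (twisted k i)) U => Oval (r l)) st).
  rewrite -[LHS]/(w U s i) -[RHS]/(w U t i) -(shearK (w U s)) -(shearK (w U t)).
  by rewrite /unshear E; case: eqP => // _; congr (_ - _); apply: eq_bigr => l _; rewrite E.
pose v i := Oval (t i); have tv i : OXD_set (twisted k i) U (v i) by exact: OvalP.
pose s : A U := fun i => be i U (Osec (unshear_sec i tv)).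
have sE i : comp_val al s i = unshear v i by rewrite /comp_val /s beK OsecK.
have ks : ker lam U s.
  move=> Ux; have Ds i : OXD_set (D i) U (comp_val al s i) by exact: OvalP.
  rewrite -[LHS](shear_functional Ux Ds) /shear eqxx.
  have /(OXD_minus_point _ _ (gu k) Vx)[_ /(_ Ux) <-] :
      OXD_set (dadd (D k) (minus_point x)) U (v k) by have := tv k; rewrite /twisted eqxx.
  congr (value_at x (_ / _)); rewrite -[RHS](unshearK v) /shear eqxx sE.
  by congr (_ + _); apply: eq_bigr => l _; rewrite sE.
exists (mksm (S := ker_submod al Vx gu lam U) ks).
apply: functional_extensionality_dep => i; apply: Osec_eq.
rewrite -[LHS]/(shear (comp_val al s) i) -[RHS](unshearK v) /shear !sE.
by case: eqP => // _; congr (_ + _); apply: eq_bigr => l _; rewrite sE.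
Qed.
End Shear.
End Modifications.
End Twists.

(** * Counting the modifications *)

Section Count.
Variables (F : finFieldType) (X : curve F).
Local Notation K := (funfield X).
Local Notation point := (closed_point X).

(** The residue field is not known as a finite type; this numbering of it serves
    to count families of residues. *)
Lemma residue_enum (x : point) : exists (T : finType) (code : residue_field x -> T) decode,
  [/\ cancel code decode, cancel decode code & #|T| = (#|F| ^ degree_pt x)%N].
Proof.
have [e [_ eU]] := residue_has_dim x.
pose T := {ffun 'I_(degree_pt x) -> F}.
have ex s : exists c : T, s = lincomb (residue_cst x) e c.
  by have [c [sc _]] := eU s I; exists c.
have [code codeP] := choice ex.
exists T, code, (lincomb (residue_cst x) e); split.
- by move=> s; rewrite -codeP.
- move=> c; have [c' [_ c'U]] := eU (lincomb (residue_cst x) e c) I.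
  exact: etrans (esym (c'U _ (codeP _))) (c'U c erefl).
- by rewrite card_ffun card_ord.
Qed.

Hypothesis hX : elliptic X.

Variables (n : nat) (L : 'I_n -> modsheaf X) (D : 'I_n -> divisor X).
Variables (al : forall i, sheaf_hom (L i) (OXD (D i))) (be : forall i, sheaf_hom (OXD (D i)) (L i)).
Hypotheses (alK : forall i U, cancel (al i U) (be i U)) (beK : forall i U, cancel (be i U) (al i U)).
Variables (x : point) (V : open_set X) (Vx : V x) (u : 'I_n -> K).
Hypothesis gu : forall i, generates (D i) V (u i).
Hypothesis gap : forall i k : 'I_n, (i < k)%N ->
  degree_div (D i) + (degree_pt x)%:Z < degree_div (D k).
Local Notation A := (dsum L).
Local Notation kx := (residue_field x).
Local Notation ker := (ker_sheaf al Vx gu).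
Local Notation Q := (dsum (fun _ : 'I_1 => skyscraper x)).
Local Notation B k := (dsum (fun i => OXD (twisted D x k i))).

Lemma top_ker_iso (lam : 'I_n -> kx) (k : 'I_n) : lam k = 1 ->
  (forall i : 'I_n, (k < i)%N -> lam i = 0) -> sheaf_iso (sheaf_of_sub (ker lam)) (B k).
Proof.
move=> lk /(shear_coefficients hX Vx gu gap)[phi phiP].
exact: (ker_shear_iso alK beK Vx gu lk phiP).
Qed.

Lemma hecke_classification (S : subsheaf A) : quotient_iso S Q ->
  exists (lam : 'I_n -> kx) (k : 'I_n), [/\ lam k = 1,
    (forall i : 'I_n, (k < i)%N -> lam i = 0), S = ker lam & sheaf_iso (sheaf_of_sub S) (B k)].
Proof.
move=> /(top_functional alK beK Vx gu)[lam [k [lk top ->]]].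
by exists lam, k; split=> //; exact: top_ker_iso.
Qed.

(** The kernels isomorphic to the k-th modification are those of the functionals
    with last nonzero coordinate lam_k = 1, and the k coordinates before it are
    free. *)
Lemma hecke_subsheaves_card (k : 'I_n) :
  (hecke_subsheaves x 1 (A := A) (B k) #= `I_((#|F| ^ degree_pt x) ^ k)%N)%card.
Proof.
have [T [code [decode [codeK decodeK <-]]]] := residue_enum x.
have cardE : #|{: {ffun 'I_k -> T}}| = (#|T| ^ k)%N by rewrite card_ffun card_ord.
have kn i : (i < k)%N -> (i < n)%N by move=> ik; apply: ltn_trans (ltn_ord k).
pose w (i : 'I_k) : 'I_n := widen_ord (ltnW (ltn_ord k)) i.
rewrite -cardE; apply/card_eqPle; split.
  have ex (S : subsheaf A) : exists lam : 'I_n -> kx,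
      hecke_subsheaves x 1 (A := A) (B k) S ->
      [/\ lam k = 1, (forall i : 'I_n, (k < i)%N -> lam i = 0) & S = ker lam].
    have [[SB SQ]|no] := pselect (hecke_subsheaves x 1 (A := A) (B k) S); last by exists (fun=> 0).
    have [lam [k' [lk top SE Siso]]] := hecke_classification SQ.
    have kk : k' = k.
      apply/eqP; apply: contrapT => /negP kk; apply: (twisted_not_iso hX gap kk).
      exact: sheaf_iso_trans (sheaf_iso_sym Siso) SB.
    by exists lam => _; rewrite -kk; split.
  have [lam lamP] := choice ex.
  apply: (@card_le_fin _ _ _ (fun S => [ffun i : 'I_k => code (lam S (w i))])) => S S' hS hS' E.
  have [lk top SE] := lamP S hS; have [lk' top' SE'] := lamP S' hS'.
  rewrite SE SE'; congr (ker _); apply/funext => i.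
  case: (ltngtP i k) => [ik|ki|/val_inj ->]; last 2 first.
  - by rewrite top // top'.
  - by rewrite lk lk'.
  have /ffunP/(_ (Ordinal ik)) := E; rewrite !ffunE => /(can_inj codeK).
  by rewrite (_ : w (Ordinal ik) = i) //; exact: val_inj.
pose lam (c : {ffun 'I_k -> T}) (i : 'I_n) : kx :=
  if i == k then 1 else if insub (val i) is Some j then decode (c j) else 0.
have lk c : lam c k = 1 by rewrite /lam eqxx.
have top c (i : 'I_n) : (k < i)%N -> lam c i = 0.
  move=> ki; rewrite /lam insubF; last by rewrite ltnNge ltnW.
  by case: eqP => // ik; move: ki; rewrite ik ltnn.
have lamw c j : lam c (w j) = decode (c j).
  rewrite /lam -val_eqE /= ltn_eqF // insubT //= => jk.
  by congr (decode (c _)); exact: val_inj.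
apply: (@card_ge_fin _ _ _ (fun c => ker (lam c))) => [c c' E|c].
  apply/ffunP => j; apply: (can_inj decodeK); rewrite -!lamw.
  exact: (ker_sheaf_inj hX beK (lk c) (lk c') E).
split; first by apply: top_ker_iso; [exact: lk | exact: top].
by apply: (functional_quotient hX beK); exists k; rewrite lk oner_eq0.
Qed.

Lemma hecke_mult_twisted (k : 'I_n) M : sheaf_iso M (B k) ->
  hecke_mult x 1 A M = ((#|F| ^ degree_pt x) ^ k)%N.
Proof.
move=> MB; have HE : hecke_subsheaves x 1 (A := A) M = hecke_subsheaves x 1 (A := A) (B k).
  apply/funext => S; apply/propext; split=> -[SM SQ]; split=> //.
    exact: sheaf_iso_trans SM MB.
  exact: sheaf_iso_trans SM (sheaf_iso_sym MB).
rewrite /hecke_mult HE; have hk := hecke_subsheaves_card k.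
case: xgetP => [m _ /= hm|/(_ _ hk) //].
by apply/card_eq_II; apply: card_eq_trans hk; rewrite card_eq_sym.
Qed.
End Count.

Theorem theorem5p2 (F : finFieldType) (X : curve F) (hX : elliptic X)
  (x : closed_point X) (n : nat) (n_gt0 : (0 < n)%N) (L : 'I_n -> modsheaf X)
  (hL : forall i, line_bundle (L i))
  (hdeg : forall i j : 'I_n, j = i.+1 :> nat ->
     degree (L j) > degree (L i) + (degree_pt x)%:Z) :
  hecke_neighbours n x 1 (dsum L) =
  (fun t => exists k : 'I_n,
     t = HeckeEdge (isoclass (dsum L))
           (isoclass (dsum (fun i => if i == k then twist x (L i) else L i)))
           ((#|F| ^ degree_pt x) ^ k)%N).
Proof.
have exD i : exists D, sheaf_iso (L i) (OXD D) /\ degree (L i) = degree_div D.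
  have [D LD] := line_bundle_OXD hX (hL i); rewrite /degree.
  case: xgetP => [d _ [D' LD' ->]|no]; first by exists D'.
  by case: (no (degree_div D)); exists D.
have [D DP] := choice exD; have LD i : sheaf_iso (L i) (OXD (D i)) := (DP i).1.
pose al i := sval (cid (sheaf_iso_inverse (LD i))).
have beP i := svalP (cid (sheaf_iso_inverse (LD i))).
pose be i := sval (cid (beP i)).
have alK i U : cancel (al i U) (be i U) := (svalP (cid (beP i))).1 U.
have beK i U : cancel (be i U) (al i U) := (svalP (cid (beP i))).2 U.
have gap (i k : 'I_n) : (i < k)%N -> degree_div (D i) + (degree_pt x)%:Z < degree_div (D k).
  case: k => k kn /=; elim: k kn => // k IH kn; rewrite ltnS leq_eqVlt.
  have kn' := ltnW kn; have step := hdeg (Ordinal kn') (Ordinal kn) erefl.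
  rewrite !(DP _).2 in step => /orP[/eqP ik|/(IH kn')]; last by lia.
  by rewrite (_ : i = Ordinal kn') //; exact: val_inj.
have exV i : exists Vu : open_set X * funfield X, Vu.1 x /\ generates (D i) Vu.1 Vu.2.
  by have [V [u Vu]] := local_generator hX (D i) x; exists (V, u).
have [Vu VuP] := choice exV.
have fin : finite_set [set z | ~ forall i, (Vu i).1 z].
  apply: (@sub_finite_set _ _ (\bigcup_(i in setT) [set z | ~ (Vu i).1 z])).
    by move=> z /= /existsNP[i ni]; exists i.
  by apply: bigcup_finite => // i _; exact: ocofinite.
pose V := OpenSet fin; have Vx : V x by move=> i; exact: (VuP i).1.
have gu i : generates (D i) V (Vu i).2 by apply: generates_sub (VuP i).2 => z; exact.
pose B k := dsum (fun i => if i == k then twist x (L i) else L i).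
have BE k : sheaf_iso (B k) (dsum (fun i => OXD (twisted D x k i))).
  apply: dsum_iso => i; rewrite /twisted; case: eqP => _ //.
  exact: twist_OXD.
have mult := hecke_mult_twisted hX alK beK Vx gu gap.
have q0 k : ((#|F| ^ degree_pt x) ^ k)%N <> 0%N.
  by apply/eqP; rewrite -lt0n !expn_gt0 ltnW ?card_F_gt1.
apply/funext => t; apply/propext; split.
  move=> [M [_ m0 ->]].
  have [S [SM SQ]] : exists S, hecke_subsheaves x 1 (A := dsum L) M S.
    apply: contrapT => no; apply: m0; rewrite /hecke_mult.
    case: xgetP => // m _ /= hm; apply/card_eq_II; rewrite card_eq_sym in hm.
    apply: card_eq_trans hm _; rewrite II0 card_eq0; apply/eqP.
    by apply/seteqP; split=> // S hS; case: no; exists S.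
  have [lam [k [_ _ _ SB]]] := hecke_classification hX alK beK Vx gu gap SQ.
  have MB := sheaf_iso_trans (sheaf_iso_sym SM) SB.
  exists k; congr HeckeEdge; last exact: mult MB.
  exact/isoclass_eq/(sheaf_iso_trans MB)/sheaf_iso_sym/BE.
move=> [k ->]; exists (B k); split.
- by apply: vector_bundle_iso (BE k) _; exact: vector_bundle_dsum_OXD.
- by rewrite (mult k _ (BE k)); exact: q0.
- by rewrite (mult k _ (BE k)).
Qed.
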